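(* Let constants $\Lambda>0$, $\Lambda_0\ge 0$, $p>2$, $m>1+\frac{\max(n,2)}{p}$ be given, let $\Omega\subseteq\mathbb{R}^n$ be open and $T>0$, let $f\in L^m([0,T]\times\Omega)$ with $\|f\|_{L^m}\le\Lambda$, let $A\in L^\infty([0,T]\times\Omega;\mathbb{R}^{n\times n})$ be a matrix-valued function with $\|A\|_{L^\infty}\le\Lambda$, and let $\bar\Omega\subset\Omega$ be compact and $0<s<T$. There exists $0<\gamma<1$, depending on $p,\Lambda,\Lambda_0,m,n$, such that any $u\in L^\infty((0,T)\times\Omega)$ with $\nabla u\in L^p$ satisfying $$\partial_t u+\Lambda^{-1}|\nabla u|^p-\operatorname{div}(A\nabla u)\le f$$ in the sense of distributions and satisfying $$\partial_t u+\Lambda|\nabla u|^p-\Lambda_0\, m^-(D^2u)\ge-\Lambda$$ in the sense of viscosity will have $$u\in C^\gamma((s,T)\times\bar\Omega),$$ with $C^\gamma$ norm depending on $\|u\|_{L^\infty}$, $p$, $\Lambda$, $\Lambda_0$, $m$, $n$, $s$, and the distance between $\bar\Omega$ and $\mathbb{R}^n\setminus\Omega$.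
   Context: $n\ge1$ is the space dimension; $\nabla$, $\operatorname{div}$ and $D^2$ (the Hessian) are taken in the space variable $x$ only. Here $\bar\Omega$ is just a name for a given compact subset of $\Omega$, not the closure of $\Omega$. For a symmetric matrix $X$, $m^-(X)$ denotes the lowest eigenvalue of $X$, or $0$ if all eigenvalues of $X$ are positive. A function $u$ satisfies $\partial_t u+\Lambda|\nabla u|^p-\Lambda_0 m^-(D^2u)\ge-\Lambda$ in the sense of viscosity if the lower-semicontinuous envelope of $u$ is a viscosity supersolution of $\partial_t u+\Lambda|\nabla u|^p-\Lambda_0 m^-(D^2u)=-\Lambda$. Saying that $\gamma$ (respectively the norm) depends on a list of quantities means that it can be chosen (respectively bounded) in terms of those quantities only. *)

(* Defs.v *)
From HB Require Import structures.
From mathcomp Require Import all_boot all_order all_algebra.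
From mathcomp Require Import all_classical all_reals all_analysis ess_sup_inf.

Set Implicit Arguments.
Unset Strict Implicit.
Unset Printing Implicit Defensive.
Import Order.TTheory GRing.Theory Num.Theory Num.Def.
Import numFieldNormedType.Exports.
Local Open Scope classical_set_scope.
Local Open Scope ring_scope.

Definition rV_display : measure_display -> measure_display. Proof. exact. Qed.

Section measurable_rV.
Context (R : realType) (n : nat).
Let coord (i : 'I_n) (x : 'rV[R]_n) : R := x ord0 i.

Let rV_set0 : g_sigma_preimage coord set0.
Proof. exact: sigma_algebra0. Qed.

Let rV_setC A : g_sigma_preimage coord A -> g_sigma_preimage coord (~` A).
Proof. exact: sigma_algebraC. Qed.

Let rV_bigcup (F : _^nat) : (forall i, g_sigma_preimage coord (F i)) ->
  g_sigma_preimage coord (\bigcup_i (F i)).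
Proof. exact: sigma_algebra_bigcup. Qed.

(* The sigma-algebra generated by the coordinates, which is the Borel one for
   the topology of 'rV[R]_n. *)
HB.instance Definition _ := @isMeasurable.Build
  (rV_display default_measure_display)
  'rV[R]_n (g_sigma_preimage coord) rV_set0 rV_setC rV_bigcup.

Lemma measurable_coord (i : 'I_n) :
  measurable_fun [set: 'rV[R]_n] (fun x => x ord0 i).
Proof.
move=> _ Y mY; rewrite setTI; apply: sub_sigma_algebra => /=.
rewrite -bigcup_seq/=; exists i => /=; first by rewrite mem_index_enum.
by exists Y => //; rewrite setTI.
Qed.

Lemma measurable_fun_rV d (T : measurableType d) (f : T -> 'rV[R]_n) :
  (forall i, measurable_fun [set: T] (fun t => f t ord0 i)) ->
  measurable_fun [set: T] f.
Proof.
move=> mf _ A mA; rewrite setTI.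
suff : preimage_set_system [set: T] f (g_sigma_preimage coord) `<=` measurable.
  by apply; exists A; rewrite // setTI.
rewrite -g_sigma_preimage_comp.
apply: smallest_sub; first exact: sigma_algebra_measurable.
rewrite -bigcup_seq; apply: bigcup_sub => i _ B [C mC <-].
exact: mf.
Qed.

End measurable_rV.

(* lebesgue_measure lives on the copy measurableTypeR R of R; it is restated here
   on R itself, where the topological and the measurable structures coexist. *)
Section lebesgue1.
Context (R : realType).

Definition lebesgue1 : set R -> \bar R := @lebesgue_measure R.
Let m0 : lebesgue1 set0 = 0%E. Proof. exact: measure0. Qed.
Let mge0 A : (0 <= lebesgue1 A)%E. Proof. exact: measure_ge0. Qed.
Let mss : semi_sigma_additive lebesgue1.
Proof. exact: (@measure_semi_sigma_additive _ _ _ (@lebesgue_measure R)). Qed.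
HB.instance Definition _ := isMeasure.Build default_measure_display _ _ lebesgue1 m0 mge0 mss.
Let msf : sigma_finite setT lebesgue1.
Proof. exact: (@sigma_finiteT _ _ _ (@lebesgue_measure R)). Qed.
HB.instance Definition _ := Measure_isSigmaFinite.Build _ _ _ lebesgue1 msf.
End lebesgue1.
Arguments lebesgue1 {R}.

Section lebesgueS.
Context (R : realType) (n : nat).

Definition cons_rV (p : R * 'rV[R]_n) : 'rV[R]_n.+1 :=
  row_mx p.1%:M p.2 : 'rV[R]_(1 + n).

Lemma cons_rV0 p : cons_rV p ord0 ord0 = p.1.
Proof.
have -> : (ord0 : 'I_n.+1) = lshift n (ord0 : 'I_1) by exact/val_inj.
by apply: etrans (row_mxEl _ _ _ _) _; rewrite mxE eqxx mulr1n.
Qed.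

Lemma cons_rVS p j : cons_rV p ord0 (lift ord0 j) = p.2 ord0 j.
Proof.
have -> : lift ord0 j = rshift 1 j by exact/val_inj.
exact: row_mxEr.
Qed.

Lemma measurable_cons_rV : measurable_fun [set: R * 'rV[R]_n] cons_rV.
Proof.
apply: measurable_fun_rV => i.
case: (unliftP ord0 i) => [j|] ->.
  under eq_fun do rewrite cons_rVS.
  exact: (measurableT_comp (measurable_coord j) measurable_snd).
under eq_fun do rewrite cons_rV0.
exact: measurable_fst.
Qed.

Context (m : {sigma_finite_measure set 'rV[R]_n -> \bar R}).

Definition lebesgueS : set 'rV[R]_n.+1 -> \bar R :=
  pushforward (lebesgue1 \x m)%E cons_rV.


Let preim A : measurable A -> measurable (cons_rV @^-1` A).
Proof. by move=> mA; rewrite -[X in measurable X]setTI; exact: measurable_cons_rV. Qed.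

Let lS0 : lebesgueS set0 = 0%E.
Proof. by rewrite /lebesgueS /pushforward preimage_set0 measure0. Qed.

Let lS_ge0 A : (0 <= lebesgueS A)%E.
Proof. by rewrite /lebesgueS /pushforward; exact: measure_ge0. Qed.

Let lS_additive : semi_sigma_additive lebesgueS.
Proof.
move=> F mF tF mUF; rewrite /lebesgueS /pushforward preimage_bigcup.
apply: measure_semi_sigma_additive.
- by move=> k; apply: preim; exact: mF.
- apply/trivIsetP => i j _ _ ij; rewrite -preimage_setI.
  by move/trivIsetP : tF => /(_ _ _ _ _ ij) ->//; rewrite preimage_set0.
- by rewrite -preimage_bigcup; exact: preim.
Qed.

HB.instance Definition _ :=
  isMeasure.Build _ _ _ lebesgueS lS0 lS_ge0 lS_additive.

Lemma lebesgueSE (A : set R) (B : set 'rV[R]_n) :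
  measurable A -> measurable B ->
  lebesgueS [set x : 'rV[R]_n.+1 | A (x ord0 ord0) /\ B (\row_j x ord0 (lift ord0 j))] =
  (lebesgue1 A * m B)%E.
Proof.
move=> mA mB; rewrite -product_measure1E// /lebesgueS /pushforward; congr (product_measure1 _ _ _).
apply/seteqP; split=> -[t y] /=; rewrite cons_rV0;
  by under [\row_j _]eq_mx do rewrite cons_rVS; rewrite [\row_j _](_ : _ = y) //;
     apply/rowP => j; rewrite mxE.
Qed.

Let uncons_measurable (B : set 'rV[R]_n) : measurable B ->
  measurable ((fun x : 'rV[R]_n.+1 => \row_j x ord0 (lift ord0 j)) @^-1` B).
Proof.
move=> mB; rewrite -[X in measurable X]setTI.
suff : measurable_fun [set: 'rV[R]_n.+1] (fun x => \row_j x ord0 (lift ord0 j)).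
  exact.
apply: measurable_fun_rV => j; under eq_fun do rewrite mxE.
exact: measurable_coord.
Qed.

Let lS_sigma_finite : sigma_finite setT lebesgueS.
Proof.
have /sigma_finiteP[F [TF ndF Foo]] := sigma_finiteT (@lebesgue1 R).
have /sigma_finiteP[G [TG ndG Goo]] := sigma_finiteT m.
exists (fun k => [set x : 'rV[R]_n.+1 | F k (x ord0 ord0) /\
                       G k (\row_j x ord0 (lift ord0 j))]).
  apply/seteqP; split=> // x _.
  have [i _ Fi] : (\bigcup_i F i) (x ord0 ord0) by rewrite -TF.
  have [k _ Gk] : (\bigcup_i G i) (\row_j x ord0 (lift ord0 j)) by rewrite -TG.
  exists (maxn i k) => //; split.
    by move: Fi; exact/subsetPset/ndF/leq_maxl.
  by move: Gk; exact/subsetPset/ndG/leq_maxr.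
move=> k; have [mF Fk] := Foo k; have [mG Gk] := Goo k; split.
  apply: measurableI; last exact: uncons_measurable.
  by rewrite -[X in measurable X]setTI; exact: measurable_coord.
by rewrite lebesgueSE// lte_mul_pinfty// ge0_fin_numE.
Qed.

HB.instance Definition _ :=
  Measure_isSigmaFinite.Build _ _ _ lebesgueS lS_sigma_finite.

End lebesgueS.

Fixpoint lebesgue (R : realType) (n : nat) :
    {sigma_finite_measure set 'rV[R]_n -> \bar R} :=
  if n is k.+1 then lebesgueS (lebesgue R k) else \d_(0 : 'rV[R]_0).

Lemma lebesgue_box (R : realType) (n : nat) (A : 'I_n -> set R) :
  (forall i, measurable (A i)) ->
  lebesgue R n [set x : 'rV[R]_n | forall i, A i (x ord0 i)] =
  (\prod_(i < n) lebesgue_measure (A i))%E.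
Proof.
elim: n => [|n IHn] in A *.
  by move=> _; rewrite big_ord0 /= diracE mem_set// => -[].
move=> mA; rewrite big_ord_recl -IHn//.
rewrite -(lebesgueSE (lebesgue R n)) //.
  congr (lebesgueS _ _); apply/seteqP; split=> x /=.
    by move=> Ax; split=> // i; rewrite mxE.
  move=> [A0 AS] i; case: (unliftP ord0 i) => [j|] -> //.
  by have := AS j; rewrite mxE.
rewrite (_ : [set _ | _] = \bigcap_(i in [set: 'I_n])
    (fun x : 'rV[R]_n => x ord0 i) @^-1` A (lift ord0 i)).
  apply: fin_bigcap_measurable => // i _.
  by rewrite -[X in measurable X]setTI; exact: measurable_coord.
by apply/seteqP; split=> x /= Ax i; [move=> _; exact: Ax|exact: Ax].
Qed.

Definition lebesgue_st (R : realType) (n : nat) :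
    {measure set (R * 'rV[R]_n)%type -> \bar R} :=
  (lebesgue1 \x lebesgue R n)%E.

Section euclidean.
Context (R : realType) (n : nat).
Implicit Types (x y : 'rV[R]_n) (z w : R * 'rV[R]_n).

(* The library norm of 'rV[R]_n is the sup norm; it is used for topology only. *)
Definition enorm x : R := Num.sqrt (\sum_i x ord0 i ^+ 2).

Definition st_dist z w : R :=
  Num.sqrt ((z.1 - w.1) ^+ 2 + enorm (z.2 - w.2) ^+ 2).

Definition dot x y : R := \sum_i x ord0 i * y ord0 i.

(* The action of X on the column vector identified with x. *)
Definition mxapp (X : 'M[R]_n) x : 'rV[R]_n := x *m X^T.

Definition opnorm (X : 'M[R]_n) : R :=
  sup [set enorm (mxapp X x) | x in [set x | enorm x <= 1]].

(* +oo when A or B is empty. *)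
Definition set_dist (A B : set 'rV[R]_n) : \bar R :=
  ereal_inf [set (enorm (x - y))%:E | x in A & y in B].

(* The eigenvalues of a symmetric matrix form a finite nonempty set of reals if
   0 < n, so the infimum is then a minimum. *)
Definition mminus (X : 'M[R]_n) : R :=
  if `[< forall a : R, eigenvalue X a -> 0 < a >] then 0
  else inf [set a | eigenvalue X a].

End euclidean.

Section calculus.
Context (R : realType) (n : nat).
Implicit Types (phi : R * 'rV[R]_n -> R) (z v : R * 'rV[R]_n).
Implicit Types (Q : set (R * 'rV[R]_n)).

Definition dirt : R * 'rV[R]_n := (1, 0).
Definition dirx (i : 'I_n) : R * 'rV[R]_n := (0, delta_mx ord0 i).

Definition dt phi z : R := 'D_dirt phi z.
Definition grad phi z : 'rV[R]_n := \row_i 'D_(dirx i) phi z.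
Definition hess phi z : 'M[R]_n :=
  \matrix_(i, j) 'D_(dirx i) ('D_(dirx j) phi) z.

Definition smooth phi : Prop :=
  forall (s : seq (R * 'rV[R]_n)),
    let psi := foldr (fun v g => 'D_v g) phi s in
    continuous psi /\ forall z v, derivable psi z v.

Definition test_function Q phi : Prop :=
  smooth phi /\
  exists K, [/\ compact K, K `<=` Q & forall z, ~ K z -> phi z = 0].

(* Class C^1 in time and C^2 in space on the open set Q. *)
Definition C12 Q phi : Prop := forall z, Q z ->
  [/\ derivable phi z dirt /\ {for z, continuous (dt phi)},
      forall i, derivable phi z (dirx i) /\
                {for z, continuous ('D_(dirx i) phi)} &
      forall i j, derivable ('D_(dirx j) phi) z (dirx i) /\
                  {for z, continuous ('D_(dirx i) ('D_(dirx j) phi))}].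

End calculus.
Arguments dirt {R n}.
Arguments dirx {R n} i.

Section Lebesgue_spaces.
Context (R : realType) (n : nat).
Local Notation E := (R * 'rV[R]_n)%type.

Definition LnormOn (q : \bar R) (D : set E) (f : E -> R) : \bar R :=
  'N[lebesgue_st R n]_q[EFin \o f \_ D]%E.

(* Elements of L^q(D) are represented by Borel functions on D, which reach every
   class modulo equality almost everywhere. *)
Definition in_L (q : \bar R) (D : set E) (f : E -> R) : Prop :=
  measurable_fun D f /\ (LnormOn q D f < +oo)%E.

Definition in_L_rV (q : \bar R) (D : set E) (G : E -> 'rV[R]_n) : Prop :=
  measurable_fun D G /\ (LnormOn q D (fun z => enorm (G z)) < +oo)%E.

Definition weak_gradient (Q : set E) (u : E -> R) (G : E -> 'rV[R]_n) : Prop :=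
  forall phi i, test_function Q phi ->
    (\int[lebesgue_st R n]_(z in Q) (u z * 'D_(dirx i) phi z))%R =
    (- \int[lebesgue_st R n]_(z in Q) (G z ord0 i * phi z))%R.

(* Distributional form on Q of
     dt u + a |grad u|^p - div (A grad u) <= f,
   with G standing for the weak gradient of u. *)
Definition distributional_subsolution (Q : set E) (a p : R)
    (A : E -> 'M[R]_n) (f u : E -> R) (G : E -> 'rV[R]_n) : Prop :=
  forall phi, test_function Q phi -> (forall z, 0 <= phi z) ->
    (\int[lebesgue_st R n]_(z in Q)
       (- (u z * dt phi z) + a * enorm (G z) `^ p * phi z
        + dot (mxapp (A z) (G z)) (grad phi z)) <=
     \int[lebesgue_st R n]_(z in Q) (f z * phi z))%R.

(* The lower-semicontinuous envelope of a class of functions modulo equality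
   almost everywhere: the essential lower limit of u at z, which is the largest
   of the pointwise envelopes of the representatives of u. The pointwise envelope
   of one given representative would carry no information on the class, since it
   can be lowered at will by changing u on a dense null set. *)
Definition lsc_envelope (u : E -> R) (z : E) : \bar R :=
  ereal_sup [set ess_inf (lebesgue_st R n)
                   (patch (cst +oo%E) (ball z r) (EFin \o u))
            | r in [set r : R | 0 < r]].

(* Viscosity supersolutions on Q of dt w + F (grad w) (D^2 w) = g, for w finite
   on Q. *)
Definition viscosity_supersolution (Q : set E)
    (F : 'rV[R]_n -> 'M[R]_n -> R) (g : R) (w : E -> \bar R) : Prop :=
  (forall z (a : R), Q z -> (a%:E < w z)%E ->
     \forall y \near z, (a%:E < w y)%E) /\
  forall phi z, C12 Q phi -> Q z ->
    (\forall y \near z, w z - (phi z)%:E <= w y - (phi y)%:E)%E ->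
    g <= dt phi z + F (grad phi z) (hess phi z).

(* -oo for D empty. *)
Definition holder_norm (gamma : R) (D : set E) (v : E -> R) : \bar R :=
  (ereal_sup [set `|v z|%:E | z in D] +
   ereal_sup [set (`|v z - v w| / st_dist z w `^ gamma)%:E | z in D & w in D])%E.

End Lebesgue_spaces.

(* Main.v *)
(* A subsolution controls its averages forward in time: testing the equation with a
   kernel transported along a tube from one space-time place to another, the
   gradient terms are absorbed by |grad u|^p, and the average at the end is at most
   the average at the start plus an error.  Changing the radius r of the kernel
   dyadically, with times of order r^q where max(2, n/(m-1)) < q < p, the errors sum
   up.  At density points this compares values: if u <= a on a set of positive
   measure and u >= b on one of positive measure a bit later, then b - a is small as
   soon as the time gap and the spatial distance are in the right proportion.
   Conversely, if a supersolution is >= c + M del on the first half of a cylinder and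
   >= c on all of it, a barrier shows that it is >= c + M del / 2 at the end.  One of
   the two alternatives always reduces the oscillation by a fixed factor when passing
   to a smaller cylinder whose radius is (c M)^((p-1)/p) tau^(1/p) for the duration
   tau, and iterating gives the Hoelder estimate. *)

Require Import Defs.
From HB Require Import structures.
From mathcomp Require Import all_boot all_order all_algebra.
From mathcomp Require Import all_classical all_reals all_analysis ess_sup_inf measurable_realfun.
From mathcomp Require Import ring lra.
Set Implicit Arguments.
Unset Strict Implicit.
Unset Printing Implicit Defensive.
Import Order.TTheory GRing.Theory Num.Theory Num.Def.
Import numFieldNormedType.Exports.
Local Open Scope classical_set_scope.
Local Open Scope ring_scope.

(** * Space-time Lebesgue measure *)

(** The matrix [A] is only bounded, so the second-order term has no sign and must be paid for by
    |grad u|^p. A kernel of radius r moved over a distance d in a time of order r^q has velocity of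
    order d r^(-q) + r^(1-q); the term in [A] acts like an extra velocity 1/r, which is no worse
    because q >= 2. By Young's inequality a step costs r^q times the power p' = p/(p-1) of the
    velocity, that is d^p' r^(q (1-p')) + r^((p-q)/(p-1)), and q < p makes the last exponent
    positive. The contribution of f is of order r^((q (m-1) - n)/m), with positive exponent because
    q > n/(m-1). The lower bound on m leaves room for such a q below p. With r^q proportional to
    tau, the first cost is d^p' tau^(-1/(p-1)) up to a constant, whatever q is; it is proportional
    to c M when d is proportional to (c M)^((p-1)/p) tau^(1/p). At this radius a barrier of height
    del M has a slope whose p-th power times tau is of order c^(1-p) del^(p-1) (del M). Hence one
    radius serves both alternatives, once del is small with respect to c. *)

Section space_time_measure.
Context (R : realType) (n : nat).
Local Notation E := (R * 'rV[R]_n)%type.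
Local Notation mu := (lebesgue_st R n).
Implicit Types (z w : E).

Lemma ballE z (e : R) w : 0 < e ->
  ball z e w <-> `|z.1 - w.1| < e /\ forall i, `|z.2 ord0 i - w.2 ord0 i| < e.
Proof.
move=> e0; split=> [[b1 [_ b2]]|[b1 b2]]; first by split => // i; exact: b2.
by split=> //; split=> // i j; rewrite (ord1 i); exact: b2.
Qed.

Lemma ball_box z (e : R) : 0 < e ->
  ball z e = [set w : E | ball z.1 e w.1 /\
    forall i, (ball (z.2 ord0 i) e : set R) (w.2 ord0 i)].
Proof. by move=> e0; apply/seteqP; split => w /=; rewrite ballE. Qed.

Lemma measurable_rVbox (A : 'I_n -> set R) : (forall i, measurable (A i)) ->
  measurable [set x : 'rV[R]_n | forall i, A i (x ord0 i)].
Proof.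
move=> mA; rewrite (_ : [set _ | _] =
  \bigcap_(i in [set: 'I_n]) (fun x : 'rV[R]_n => x ord0 i) @^-1` A i).
  apply: fin_bigcap_measurable => // i _.
  by rewrite -[X in measurable X]setTI; exact: measurable_coord.
by apply/seteqP; split=> z /= Az i; [move=> _|]; exact: Az.
Qed.

Lemma measurable_box (I : set R) (A : 'I_n -> set R) :
  measurable I -> (forall i, measurable (A i)) ->
  measurable [set z : E | I z.1 /\ forall i, A i (z.2 ord0 i)].
Proof.
by move=> mI mA; apply: (measurableX mI (measurable_rVbox mA)).
Qed.

Lemma lebesgue_st_box (I : set R) (A : 'I_n -> set R) :
  measurable I -> (forall i, measurable (A i)) ->
  mu [set z : E | I z.1 /\ forall i, A i (z.2 ord0 i)] =
  (lebesgue_measure I * \prod_(i < n) lebesgue_measure (A i))%E.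
Proof.
move=> mI mA; rewrite -lebesgue_box//.
exact: (product_measure1E lebesgue1 (lebesgue R n) mI (measurable_rVbox mA)).
Qed.

Lemma measurable_stball z (e : R) : measurable (ball z e).
Proof.
have [e0|e0] := ltP 0 e; last first.
  rewrite (_ : ball z e = set0); first exact: measurable0.
  apply/seteqP; split => // w [b1 _].
  by have := le_lt_trans (normr_ge0 _) (lt_le_trans (b1 : `|z.1 - w.1| < e) e0); rewrite ltxx.
by rewrite ball_box//; apply: (@measurable_box (ball z.1 e) (fun i => ball (z.2 ord0 i) e)) => [|i]; exact: measurable_ball.
Qed.

Let idx := (rat * 'rV[rat]_n * nat)%type.
Let rball (k : idx) : set E :=
  ball (ratr k.1.1 : R, map_mx ratr k.1.2 : 'rV[R]_n) (k.2.+1%:R^-1 : R).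

(** Provides a countable base. Measurability of open sets and the passage from local to global
    almost everywhere statements both reduce to countably many such balls. *)
Lemma rational_ball z (e : R) : 0 < e ->
  exists k : idx, rball k z /\ rball k `<=` ball z e.
Proof.
move=> e0.
have [N _ Ne] := near_infty_natSinv_lt (PosNum (divr_gt0 e0 (ltr0Sn R 1))).
have N0 : (0 : R) < N.+1%:R^-1 by rewrite invr_gt0.
have {}Ne : (N.+1%:R^-1 : R) < e / 2 by apply: Ne => /=.
have dq (x : R) : exists q : rat, `|ratr q - x| < N.+1%:R^-1.
  have [|y [By [q _ qy]]] := @dense_rat R (ball x N.+1%:R^-1) _ (ball_open _ _).
    by exists x; exact: ballxx.
  by exists q; rewrite qy distrC.
pose q0 := projT1 (cid (dq z.1)).
pose q : 'rV[rat]_n := \row_i projT1 (cid (dq (z.2 ord0 i))).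
have q0P : `|ratr q0 - z.1| < N.+1%:R^-1 by exact: projT2 (cid (dq z.1)).
have qP i : `|ratr (q ord0 i) - z.2 ord0 i| < N.+1%:R^-1.
  by rewrite mxE; exact: projT2 (cid (dq (z.2 ord0 i))).
exists (q0, q, N); split.
  by apply/ballE => //=; split => // i; rewrite mxE.
move=> w /ballE /= [//|w1 w2]; apply/ballE => //; split=> [|i].
  rewrite (le_lt_trans (ler_distD (ratr q0) _ _))// [e]splitr distrC.
  by apply: ltrD; [exact: lt_trans q0P _|exact: lt_trans w1 _].
rewrite (le_lt_trans (ler_distD (ratr (q ord0 i)) _ _))// [e]splitr distrC.
apply: ltrD; first exact: lt_trans (qP i) _.
by have := w2 i; rewrite mxE => /lt_trans; apply.
Qed.

Lemma open_bigcup_balls (O : set E) : open O ->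
  exists2 S : set idx, O = \bigcup_(k in S) rball k & forall k, S k -> rball k `<=` O.
Proof.
move=> oO; exists [set k | rball k `<=` O] => //; apply/seteqP; split; last first.
  by apply: bigcup_sub => k; exact.
move=> z Oz; have /nbhs_ballP[e /= e0 eO] : nbhs z O by exact: open_nbhs_nbhs.
have [k [kz ke]] := rational_ball z e0.
by exists k => //= w /ke/eO.
Qed.

Lemma open_measurable_st (O : set E) : open O -> measurable O.
Proof.
move=> /open_bigcup_balls[S -> _]; rewrite bigcup_mkcond.
apply: countable_bigcupT_measurable => [|k]; first exact: (@countableP (rat * 'rV[rat]_n * nat)%type).
by case: ifPn => // _; exact: measurable_stball.
Qed.

Lemma measurable_fun_continuous_st (f : E -> R) :
  continuous f -> measurable_fun [set: E] f.
Proof.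
move=> /continuousP cf; apply: (measurability _ (RGenOpens.measurableE R)).
by move=> _ [_ [a [b ->]] <-]; rewrite setTI; apply: open_measurable_st; apply: cf; exact: interval_open.
Qed.

(** Lindelof argument: every point of [Q] lies in a rational ball on which [P] holds almost
    everywhere, and the countably many exceptional sets have a null union. *)
Lemma ae_local (Q : set E) (P : E -> Prop) :
  (forall z, Q z -> exists2 O, nbhs z O & {ae mu, forall w, O w -> P w}) ->
  {ae mu, forall w, Q w -> P w}.
Proof.
move=> QP; pose S := [set k : idx | {ae mu, forall w, rball k w -> P w}].
have : {ae mu, forall w, forall m, if unpickle m is Some k then S k -> rball k w -> P w else True}.
  apply/ae_foralln => m; case: (unpickle m) => [k|]; last exact: nearW.
  have [Sk|nSk] := pselect (S k); last by apply: nearW => w /nSk.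
  by apply: filterS Sk => w Hw _; exact: Hw.
apply: filterS => w Hw /QP[U /nbhs_ballP[e /= e0 eO] aeO].
have [k [kw ke]] := rational_ball w e0.
have := Hw (pickle k); rewrite pickleK; apply => //.
by apply: filterS aeO => y + ky; apply; exact/eO/ke.
Qed.

Lemma stball_gt0 z (e : R) : 0 < e -> (0 < mu (ball z e))%E.
Proof.
move=> e0; rewrite ball_box// (@lebesgue_st_box (ball z.1 e) (fun i => ball (z.2 ord0 i) e))//; last 2 first.
- exact: measurable_ball.
- by move=> i; exact: measurable_ball.
rewrite lebesgue_measure_ball ?ltW// mule_gt0//; first by rewrite lte_fin mulrn_wgt0.
elim/big_ind : _ => //; first by move=> x y; exact: mule_gt0.
by move=> i _; rewrite lebesgue_measure_ball ?ltW// lte_fin mulrn_wgt0.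
Qed.

Lemma lebesgue_st_gt0 : (0 < mu [set: E])%E.
Proof.
apply: lt_le_trans (stball_gt0 0 (ltr01 : 0 < 1 :> R)) _.
by apply: le_measure; rewrite ?inE//; exact: measurable_stball.
Qed.
End space_time_measure.

(** * Affine changes of variables in space-time *)

Section affine_change_of_variables.
Context (R : realType).

(** Uniqueness of Lebesgue measure: the right-hand side is a measure in [A] with the correct value
    on half-open intervals. *)
Lemma lebesgue_measure_affine (b h : R) (A : set R) : 0 < h -> measurable A ->
  lebesgue_measure A = (h%:E * lebesgue_measure ((fun t => (b + h * t)%R) @^-1` A))%E.
Proof.
move=> h0 mA.
have mphi : measurable_fun setT (fun t : measurableTypeR R => (b + h * t)%R : measurableTypeR R).
  by apply: measurable_funD => //; exact: measurable_funM.
pose phi := fun t : measurableTypeR R => (b + h * t)%R : measurableTypeR R.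
pose m2 : {measure set (measurableTypeR R) -> \bar R} :=
  mscale (NngNum (ltW h0)) (pushforward (@lebesgue_measure R) phi).
transitivity (m2 mphi A) => //.
apply: lebesgue_measure_unique => //= _ [[c d]] _ <-.
rewrite /mscale/= /pushforward.
rewrite (_ : _ @^-1` _ = `](c - b) / h, (d - b) / h]%classic); last first.
  apply/seteqP; split => t /=; rewrite !in_itv/= ltr_pdivrMr// ler_pdivlMr//;
   by rewrite ltrBlDl lerBrDl [t * h]mulrC.
rewrite !lebesgue_measure_itv/= !lte_fin ltr_pM2r ?invr_gt0// ltrD2r.
case: ifP => // _; last by rewrite mule0.
by rewrite -EFinM; congr EFin; field; rewrite gt_eqF.
Qed.

Variable n : nat.
Local Notation E := (R * 'rV[R]_n)%type.
Local Notation mu := (lebesgue_st R n).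

Definition st_affine (b h : R) (y : 'rV[R]_n) (r : R) (z : E) : E :=
  (b + h * z.1, y + r *: z.2).

Lemma measurable_st_affine b h y r : measurable_fun [set: E] (st_affine b h y r).
Proof.
apply/measurable_fun_pair => /=.
  by apply: measurable_funD => //; apply: measurable_funM => //; exact: measurable_fst.
apply: measurable_fun_rV => i; under eq_fun do rewrite !mxE.
apply: measurable_funD => //; apply: measurable_funM => //.
exact: (measurableT_comp (measurable_coord i) measurable_snd).
Qed.

Definition boxes : set (set E) :=
  [set [set z : E | IA.1 z.1 /\ forall i, IA.2 i (z.2 ord0 i)] | IA in
    [set IA : set R * ('I_n -> set R) |
      measurable IA.1 /\ forall i, measurable (IA.2 i)]].

(** Makes it enough to compare measures on boxes. A set prescribed by a single coordinate is a box
    whose other sides are the whole line. *)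
Lemma measurable_st_boxes : @measurable _ E = <<s boxes >>.
Proof.
rewrite eqEsubset; split; last first.
  apply: smallest_sub; first exact: sigma_algebra_measurable.
  by move=> _ [[I A]] /= [mI mA] <-; exact: measurable_box.
have sS : sigma_algebra [set: E] <<s boxes >> by exact: smallest_sigma_algebra.
apply: smallest_sub => // _ [] [Y mY <-].
  apply: sub_sigma_algebra; exists (Y, fun=> setT) => //=.
  by apply/seteqP; split => z //= [].
rewrite setTI.
pose S := [set Y : set 'rV[R]_n | <<s boxes >> (snd @^-1` Y)].
have sSS : sigma_algebra setT S.
  split; rewrite /S /=.
  - by rewrite preimage_set0; exact: sigma_algebra0.
  - move=> B SB; rewrite setTD preimage_setC -setTD; exact: sigma_algebraCD.
  - by move=> F SF; rewrite preimage_bigcup; exact: sigma_algebra_bigcup.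
suff : g_sigma_preimage (fun i (x : 'rV[R]_n) => x ord0 i) `<=` S by apply.
apply: smallest_sub => //; rewrite -bigcup_seq; apply: bigcup_sub => i _ _ [B mB <-].
apply: sub_sigma_algebra; exists (setT, fun j => if j == i then B else setT) => /=.
  by split => // j; case: ifP.
apply/seteqP; split => z /= [].
  by move=> _ /(_ i); rewrite eqxx.
by move=> _ Bz; split => // j; case: ifP => // /eqP ->.
Qed.

(** Two measures that agree on boxes, a generating family stable under intersection, and are finite
    on the exhausting boxes [g k]. This is what makes the mass of [weight] independent of place and
    scale. *)
Lemma lebesgue_st_affine b h y r (A : set E) : 0 < h -> 0 < r -> measurable A ->
  mu A = ((h * r ^+ n)%:E * mu (st_affine b h y r @^-1` A))%E.
Proof.
move=> h0 r0 mA.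
have hr0 : 0 <= h * r ^+ n by rewrite mulr_ge0// ?exprn_ge0// ltW.
pose m2 : {measure set E -> \bar R} := mscale (NngNum hr0) (pushforward mu (st_affine b h y r)).
transitivity (m2 (@measurable_st_affine b h y r) A) => //.
pose I_ (k : nat) : set R := `[- k%:R, k%:R]%classic.
pose g k : set E := [set z : E | I_ k z.1 /\ forall i, I_ k (z.2 ord0 i)].
apply: (measure_unique boxes g) => //.
- exact: measurable_st_boxes.
- move=> _ _ [[I1 A1]] /= [mI1 mA1] <- [[I2 A2]] /= [mI2 mA2] <-.
  exists (I1 `&` I2, fun i => A1 i `&` A2 i) => /=.
    by split => [|i]; exact: measurableI.
  apply/seteqP; split => z /=.
    by move=> [[a1 a2] ab]; split; split => // i; case: (ab i).
  by move=> [[? a] [? b']]; split => // i.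
- by move=> k; exists (I_ k, fun=> I_ k) => //=; split => [|i]; exact: measurable_itv.
- apply/seteqP; split => // z _.
  have [k Hk] : exists k, `|z| <= k%:R.
    by exists (truncn `|z|).+1; rewrite ltW// truncnS_gt.
  exists k => //; split => /=.
    by change (z.1 \in `[- k%:R, k%:R]); rewrite in_itv/= -ler_norml (le_trans _ Hk)// prod_normE/= le_max lexx.
  move=> i; change (z.2 ord0 i \in `[- k%:R, k%:R]).
  rewrite in_itv/= -ler_norml (le_trans _ Hk)// prod_normE/= le_max.
  apply/orP; right; rewrite /normr/= mx_normrE.
  exact: (le_bigmax _ (fun i : 'I_1 * 'I_n => `|z.2 i.1 i.2|) (ord0, i)).
- move=> _ [[I B]] /= [mI mB] <-; rewrite /mscale/= /pushforward.
  rewrite lebesgue_st_box//.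
  rewrite [X in mu X](_ : _ = [set z : E | ((fun t => b + h * t) @^-1` I) z.1 /\
     forall i, ((fun t => y ord0 i + r * t) @^-1` B i) (z.2 ord0 i)]); last first.
    by apply/seteqP; split => z /= [Iz Bz]; split => // i; have := Bz i; rewrite !mxE.
  have mpre (c d : R) (D : set R) : measurable D -> measurable ((fun t => c + d * t) @^-1` D).
    move=> mD; rewrite -[X in measurable X]setTI.
    have : measurable_fun setT (fun t => c + d * t).
      by apply: measurable_funD => //; exact: measurable_funM.
    exact.
  rewrite (lebesgue_st_box (mpre b h _ mI) (fun i => mpre (y ord0 i) r _ (mB i))).
  rewrite (lebesgue_measure_affine b h0 mI) EFinM muleACA; congr (_ * _)%E.
  rewrite (eq_bigr (fun i => r%:E * lebesgue_measure ((fun t => (y ord0 i + r * t)%R) @^-1` B i))%E); last first.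
    by move=> i _; exact: lebesgue_measure_affine.
  by rewrite big_split/= prodEFin prodr_const card_ord.
- move=> k; have [c Ec] : exists c : R, lebesgue_measure (I_ k) = c%:E.
    rewrite /I_ lebesgue_measure_itv/=; case: ifP => _; last by exists 0.
    by rewrite -EFinB; eexists.
  have mI : measurable (I_ k) by exact: measurable_itv.
  rewrite (lebesgue_st_box mI (fun=> mI)) Ec.
  by rewrite prodEFin -EFinM ltry.
Qed.
End affine_change_of_variables.

(** * Outer regularity of the space-time measure *)

Section regularity.
Context (R : realType) (n : nat).
Local Notation E := (R * 'rV[R]_n)%type.
Local Notation mu := (lebesgue_st R n).
Variables (B : set E) (mB : measurable B) (finB : (mu B < +oo)%E).

(** Outer regularity of [A] and of its complement at once, relative to [B]: the two open hulls
    overlap little. The symmetric form makes stability under complement immediate. *)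
Definition regular_in : set (set E) := [set A | forall e : R, 0 < e ->
  exists U V : set E, [/\ open U, open V, A `<=` U, ~` A `<=` V &
    (mu (B `&` (U `&` V)) <= e%:E)%E]].

Lemma regular_inC A : regular_in A -> regular_in (~` A).
Proof.
move=> rA e /rA[U [V [oU oV AU AV h]]]; exists V, U; split => //.
  by rewrite setCK.
by rewrite [V `&` U]setIC.
Qed.

Lemma regular_in_bigcup (A : nat -> set E) :
  (forall i, regular_in (A i)) -> regular_in (\bigcup_i A i).
Proof.
move=> rA e e0.
have e20 i : 0 < e / 2 / (2 ^ i.+1)%:R by rewrite divr_gt0 ?divr_gt0// ltr0n expn_gt0.
have {}rA i : {UV : set E * set E | [/\ open UV.1, open UV.2, A i `<=` UV.1, ~` A i `<=` UV.2 &
    (mu (B `&` (UV.1 `&` UV.2)) <= (e / 2 / (2 ^ i.+1)%:R)%:E)%E]}.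
  by apply: cid; have [U [V h]] := rA i _ (e20 i); exists (U, V).
pose U i := (projT1 (rA i)).1; pose V i := (projT1 (rA i)).2.
have oU i : open (U i) by case: (projT2 (rA i)).
have oV i : open (V i) by case: (projT2 (rA i)).
have AU i : A i `<=` U i by case: (projT2 (rA i)).
have AV i : ~` A i `<=` V i by case: (projT2 (rA i)).
have UVe i : (mu (B `&` (U i `&` V i)) <= (e / 2 / (2 ^ i.+1)%:R)%:E)%E.
  by case: (projT2 (rA i)).
(* The complement of the union lies in every [V i], but only finite intersections of them are open.
   The overlaps [W N] decrease to a set of measure at most e/2, so continuity from above, which uses
   that [B] has finite measure, gives a good [N]. *)
pose VN N := \big[setI/setT]_(i < N) V i.
have oVN N : open (VN N).
  rewrite /VN; elim: N => [|N IH]; first by rewrite big_ord0; exact: openT.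
  by rewrite big_ord_recr/=; exact: openI.
have oUU : open (\bigcup_i U i) by apply: bigcup_open => i _; exact: oU.
pose W N := B `&` ((\bigcup_i U i) `&` VN N).
have mW N : measurable (W N).
  by apply: measurableI => //; apply: open_measurable_st; exact: openI.
have niW : nonincreasing_seq W.
  apply/nonincreasing_seqP => N; rewrite /W /VN big_ord_recr/=; apply/subsetPset.
  by do 2 apply: setIS; exact: subIsetl.
have W0 : (mu (W 0%N) < +oo)%E.
  by apply: le_lt_trans finB; apply: measureIl => //; apply: open_measurable_st; exact: openI.
have cW := nonincreasing_cvg_mu W0 mW (bigcapT_measurable mW) niW.
have : (mu (\bigcap_N W N) <= (e / 2)%:E)%E.
  have mBUV i : measurable (B `&` (U i `&` V i)).
    by apply: measurableI => //; apply: open_measurable_st; exact: openI.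
  have sub : \bigcap_N W N `<=` \bigcup_i (B `&` (U i `&` V i)).
    move=> z Wz; have [Bz [[i _ Uiz] _]] := Wz 0%N I.
    exists i => //; split => //; split => //.
    have [_ [_]] := Wz i.+1 I; rewrite /VN big_ord_recr/=; by case.
  have h : (mu (\bigcap_N W N) <= \sum_(i <oo) mu (B `&` (U i `&` V i)))%E.
    by apply: measure_sigma_subadditive => //; exact: bigcapT_measurable.
  apply: le_trans h _.
  apply: le_trans (epsilon_trick0 xpredT _); last by rewrite divr_ge0// ltW.
  by apply: lee_nneseries => i *; [exact: measure_ge0|exact: UVe].
move=> We.
have [N WNe] : exists N, (mu (W N) <= e%:E)%E.
  apply: contrapT => /forallNP nW.
  suff : (e%:E <= (e / 2)%:E)%E by rewrite lee_fin; lra.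
  apply: le_trans We; rewrite -(cvg_lim _ cW)//; apply: lime_ge.
    by apply/cvg_ex; eexists; exact: cW.
  by apply: nearW => N; have /negP := nW N; rewrite -ltNge => /ltW.
exists (\bigcup_i U i), (VN N); split => //.
- by move=> z [i _ Az]; exists i => //; exact: AU.
- move=> z nA; rewrite /VN -bigcap_mkord => i _; apply: AV => Az.
  by apply: nA; exists i.
Qed.

Lemma sigma_algebra_regular_in : sigma_algebra setT regular_in.
Proof.
split.
- move=> e e0; exists set0, setT; split; [exact: open0|exact: openT|exact: sub0set|by []|].
  by rewrite set0I setI0 measure0 lee_fin ltW.
- by move=> A; rewrite setTD; exact: regular_inC.
- exact: regular_in_bigcup.
Qed.

(** For the generating half-lines the preimage is open, and its complement f <= a is enclosed in the
    open sets f < a + 1/(k+1), whose overlaps with f > a decrease to the empty set. *)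
Lemma regular_in_preimage (f : E -> R) (Y : set R) :
  continuous f -> measurable Y -> regular_in (f @^-1` Y).
Proof.
move=> cf; pose S := [set Y | regular_in (f @^-1` Y)].
have sS : sigma_algebra setT S.
  split; rewrite /S /=.
  - by rewrite preimage_set0; case: sigma_algebra_regular_in.
  - by move=> A SA; rewrite setTD preimage_setC; exact: regular_inC.
  - by move=> F SF; rewrite preimage_bigcup; exact: regular_in_bigcup.
move=> mY; have : (@RGenOInfty.G R).-sigma.-measurable Y by rewrite -RGenOInfty.measurableE.
suff : <<s @RGenOInfty.G R >> `<=` S by apply.
apply: smallest_sub => // _ [a ->]; rewrite /S /= => e e0.
have opre (X : set R) : open X -> open (f @^-1` X) by move: X; exact/continuousP.
pose V k := f @^-1` `]-oo, (a + k.+1%:R^-1)[.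
have oU : open (f @^-1` `]a, +oo[) by apply: opre; exact: interval_open.
have oV k : open (V k) by apply: opre; exact: interval_open.
pose W k := B `&` (f @^-1` `]a, +oo[ `&` V k).
have mW k : measurable (W k).
  by apply: measurableI => //; apply: open_measurable_st; exact: openI.
have W0 : (mu (W 0%N) < +oo)%E.
  by apply: le_lt_trans finB; apply: measureIl => //; apply: open_measurable_st; exact: openI.
have niW : nonincreasing_seq W.
  apply/nonincreasing_seqP => k; apply/subsetPset; do 2 apply: setIS.
  move=> z; rewrite /V /= !in_itv/= => /lt_le_trans; apply.
  by rewrite lerD2l lef_pV2 ?posrE// ler_nat.
have cW := nonincreasing_cvg_mu W0 mW (bigcapT_measurable mW) niW.
have We : \bigcap_k W k = set0.
  apply/seteqP; split => // z Wz.
  have [_ [/= ]] := Wz 0%N I; rewrite in_itv/= andbT => af _.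
  have [k _ /(_ k (leqnn k))] := near_infty_natSinv_lt (PosNum (eqbRL (subr_gt0 _ _) af)).
  rewrite /= ltrBrDr addrC; have [_ [_ ]] := Wz k I; rewrite /V /= in_itv/= => h1 h2.
  by have := lt_trans h1 h2; rewrite ltxx.
rewrite We measure0 in cW.
have [k Wke] : exists k, (mu (W k) <= e%:E)%E.
  apply: contrapT => /forallNP nW.
  suff : (e%:E <= 0)%E by rewrite lee_fin leNgt e0.
  rewrite -(cvg_lim _ cW)//; apply: lime_ge.
    by apply/cvg_ex; eexists; exact: cW.
  by apply: nearW => k; have /negP := nW k; rewrite -ltNge => /ltW.
exists (f @^-1` `]a, +oo[), (V k); split => //.
move=> z /=; rewrite !in_itv/= andbT => /negP; rewrite -leNgt => /le_lt_trans; apply.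
by rewrite ltrDl.
Qed.

Lemma continuous_time : continuous (fun z : E => z.1).
Proof. by move=> z; exact: cvg_fst. Qed.

Lemma continuous_space i : continuous (fun z : E => z.2 ord0 i).
Proof.
move=> z; apply: (@continuous_comp _ _ _ snd (fun x : 'rV[R]_n => x ord0 i)).
  exact: cvg_snd.
exact: coord_continuous.
Qed.

Lemma measurable_regular_in (A : set E) : measurable A -> regular_in A.
Proof.
suff : @measurable _ E `<=` regular_in by apply.
apply: smallest_sub; first exact: sigma_algebra_regular_in.
move=> _ [] [Y mY <-]; rewrite setTI.
  exact: (regular_in_preimage continuous_time (mY : measurable (Y : set R))).
pose S := [set Y : set 'rV[R]_n | regular_in (snd @^-1` Y)].
have sS : sigma_algebra setT S.
  split; rewrite /S /=.
  - by rewrite preimage_set0; case: sigma_algebra_regular_in.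
  - by move=> X SX; rewrite setTD preimage_setC; exact: regular_inC.
  - by move=> F SF; rewrite preimage_bigcup; exact: regular_in_bigcup.
suff : g_sigma_preimage (fun i (x : 'rV[R]_n) => x ord0 i) `<=` S by apply.
apply: smallest_sub => //; rewrite -bigcup_seq; apply: bigcup_sub => i _ _ [X mX <-].
rewrite setTI; change (regular_in ((fun z : E => z.2 ord0 i) @^-1` X)).
exact: (regular_in_preimage (@continuous_space i) mX).
Qed.

Lemma outer_regular (A : set E) (e : R) : measurable A -> 0 < e ->
  exists U, [/\ open U, A `<=` U & (mu (B `&` (U `\` A)) <= e%:E)%E].
Proof.
move=> mA /(measurable_regular_in mA)[U [V [oU oV AU AV h]]].
exists U; split => //; apply: le_trans h; apply: le_measure; rewrite ?inE.
- by apply: measurableI => //; apply: measurableD => //; exact: open_measurable_st.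
- by apply: measurableI => //; apply: open_measurable_st; exact: openI.
- by apply: setIS => z [Uz /AV].
Qed.
End regularity.

(** * Density cells *)

Section density.
Context (R : realType) (n : nat).
Local Notation E := (R * 'rV[R]_n)%type.
Local Notation mu := (lebesgue_st R n).

Definition cell (b h : R) (y : 'rV[R]_n) (l : R) : set E :=
  [set z : E | b <= z.1 < b + h /\
    forall i, y ord0 i - l <= z.2 ord0 i < y ord0 i + l].

Lemma measurable_cell b h y l : measurable (cell b h y l).
Proof.
have := @measurable_box R n `[b, b + h[%classic
  (fun i => `[y ord0 i - l, y ord0 i + l[%classic) (measurable_itv _) (fun i => measurable_itv _).
by under eq_set do rewrite /= in_itv/=; under eq_set => z do
  under eq_forall do rewrite in_itv/=.
Qed.

Lemma lebesgue_cell b h y l : 0 < h -> 0 < l ->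
  mu (cell b h y l) = (h * (2 * l) ^+ n)%:E.
Proof.
move=> h0 l0.
transitivity (mu [set z : E | `[b, b + h[%classic z.1 /\
    forall i, `[y ord0 i - l, y ord0 i + l[%classic (z.2 ord0 i)]).
  by congr (mu _); apply/seteqP; split => z /=; rewrite !in_itv/= => -[z1 z2];
    split => // i; have := z2 i; rewrite in_itv.
rewrite (@lebesgue_st_box R n `[b, b + h[%classic
  (fun i => `[y ord0 i - l, y ord0 i + l[%classic))//.
rewrite lebesgue_measure_itv/= lte_fin ltrDl h0 -EFinB addrAC subrr add0r.
rewrite EFinM; congr (_ * _)%E; rewrite (eq_bigr (fun=> (2 * l)%:E)).
  by rewrite prodEFin prodr_const card_ord.
move=> i _; rewrite lebesgue_measure_itv/= lte_fin ifT; last by lra.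
by rewrite -EFinB; congr EFin; ring.
Qed.

Lemma cell_ball b h y l (e : R) z : cell b h y l z -> h < e -> 2 * l < e ->
  cell b h y l `<=` ball z e.
Proof.
move=> [/andP[z1 z1'] z2] he le w [/andP[w1 w1'] w2].
have h0 : 0 < h by lra.
apply/ballE; first by lra.
split => [|i]; first by rewrite ltr_norml; apply/andP; split; lra.
by have /andP[] := z2 i; have /andP[] := w2 i; rewrite ltr_norml => *; apply/andP; split; lra.
Qed.

Definition grid_cell (h l : R) (k : int * 'rV[int]_n) : set E :=
  cell (k.1%:~R * h) h (\row_i ((k.2 ord0 i)%:~R * (2 * l) + l)) l.

Lemma grid_cellP h l k z : 0 < h -> 0 < l -> grid_cell h l k z <->
  k = (floor (z.1 / h), \row_i floor (z.2 ord0 i / (2 * l))).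
Proof.
have key (d c : R) (m : int) : 0 < d -> m%:~R * d <= c < m%:~R * d + d -> floor (c / d) = m.
  move=> d0 /andP[h1 h2]; apply: floor_def; rewrite ler_pdivlMr// h1/= ltr_pdivrMr//.
  by rewrite intrD mulrDl mul1r.
have key2 (d c : R) : 0 < d -> (floor (c / d))%:~R * d <= c < (floor (c / d))%:~R * d + d.
  move=> d0; have /andP[] := floor_itv (c / d).
  by rewrite ler_pdivlMr// ltr_pdivrMr// intrD mulrDl mul1r => -> ->.
move=> h0 l0; have l20 : 0 < 2 * l by rewrite mulr_gt0.
split => [[z1 z2]|->].
  rewrite [k]surjective_pairing; congr pair; first by rewrite (key _ _ k.1).
  apply/rowP => i; rewrite mxE (key _ _ (k.2 ord0 i))//.
  by have := z2 i; rewrite mxE => /andP[? ?]; apply/andP; split; lra.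
split => [|i] /=; first exact: key2.
by rewrite !mxE; have /andP[] := key2 _ (z.2 ord0 i) l20 => *; apply/andP; split; lra.
Qed.

(** A weak form of the density theorem for cells of prescribed, possibly very flat shape, which
    needs no maximal function. If [A] filled at most the fraction 1 - e of every cell in [O], then
    covering an open hull of measure at most (1 + e) a, where a is the measure of a bounded piece of
    [A] in [O], by fine grid cells would give a <= (1 - e)(1 + e) a. *)
Lemma density_cell (O A : set E) (h l : nat -> R) (e : R) :
  open O -> measurable A -> (0 < mu (O `&` A))%E ->
  (forall j, 0 < h j) -> (forall j, 0 < l j) -> h @ \oo --> 0 -> l @ \oo --> 0 ->
  0 < e -> exists j b y, cell b (h j) y (l j) `<=` O /\
    (mu (cell b (h j) y (l j) `\` A) <= e%:E * mu (cell b (h j) y (l j)))%E.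
Proof.
move=> oO mA OA0 h0 l0 hc lc; wlog e1 : e / e < 1.
  move=> wl e0; have [e1|e1] := ltP e 1; first exact: wl.
  have [|//|j [b [y [cO ce]]]] := wl 2^-1; first by lra.
  exists j, b, y; split => //; apply: le_trans ce _.
  by apply: lee_wpmul2r => //; rewrite lee_fin; lra.
move=> e0; apply: contrapT => nex.
have {nex}cellA j b y : cell b (h j) y (l j) `<=` O ->
    (mu (A `&` cell b (h j) y (l j)) <= (1 - e)%:E * mu (cell b (h j) y (l j)))%E.
  move=> cO; have mC := measurable_cell b (h j) y (l j).
  have : (e%:E * mu (cell b (h j) y (l j)) < mu (cell b (h j) y (l j) `\` A))%E.
    by rewrite ltNge; apply/negP => ce; apply: nex; exists j, b, y.
  have finC : mu (cell b (h j) y (l j)) \is a fin_num by rewrite lebesgue_cell.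
  have : mu (cell b (h j) y (l j)) =
      (mu (cell b (h j) y (l j) `\` A) + mu (cell b (h j) y (l j) `&` A))%E.
    exact: measureDI.
  rewrite [A `&` _]setIC.
  have fin X : measurable X -> mu (cell b (h j) y (l j) `&` X) \is a fin_num.
    move=> mX; rewrite ge0_fin_numE//; apply: le_lt_trans (measureIl _ mC mX) _.
    by rewrite ltey_eq finC.
  have finD : mu (cell b (h j) y (l j) `\` A) \is a fin_num.
    by rewrite setDE; apply: fin; exact: measurableC.
  have finI := fin A mA.
  move: finC finD finI; generalize (mu (cell b (h j) y (l j) `&` A)) (mu (cell b (h j) y (l j) `\` A)) (mu (cell b (h j) y (l j))).
  by move=> [i||] [d||] [c||]// _ _ _ [->]; rewrite -!EFinM lte_fin lee_fin; lra.
(* Truncation to a bounded open set, so that outer regularity applies with finite measures. *)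
pose g N : set E := O `&` ball (0 : E) N%:R.
have og N : open (g N) by apply: openI => //; exact: ball_open.
have mg N : measurable (g N `&` A) by apply: measurableI => //; exact: open_measurable_st.
have [N gN0] : exists N, (0 < mu (g N `&` A))%E.
  apply: contrapT => /forallNP ng.
  have : mu (\bigcup_N (g N `&` A)) = 0.
    have gs : (mu (\bigcup_N (g N `&` A)) <= \sum_(N <oo) mu (g N `&` A))%E.
      by apply: measure_sigma_subadditive => //; exact: bigcupT_measurable.
    apply/eqP; rewrite -measure_le0; apply: le_trans gs _; rewrite eseries0// => N _ _.
    by apply/eqP; rewrite -measure_le0 leNgt; apply/negP; exact: ng.
  rewrite (_ : \bigcup_N _ = O `&` A) => [OA|]; first by rewrite OA ltxx in OA0.
  apply/seteqP; split => [z [N _ [[]]]//|z [Oz Az]].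
  exists (truncn `|z|).+1 => //; split => //; split => //.
  by rewrite -ball_normE /= sub0r normrN truncnS_gt.
have fing : (mu (g N) < +oo)%E.
  apply: (@le_lt_trans _ _ (mu (ball (0 : E) N.+1%:R))).
    apply: le_measure; rewrite ?inE; [exact: open_measurable_st|exact: measurable_stball|].
    apply: subset_trans (@subIsetr _ _ _) _; apply: le_ball; by rewrite ler_nat.
  rewrite ball_box// (@lebesgue_st_box R n (ball (0:R) N.+1%:R) (fun i => ball ((0:E).2 ord0 i) N.+1%:R))//.
  - rewrite lebesgue_measure_ball//.
    under eq_bigr do rewrite lebesgue_measure_ball//.
    by rewrite prodEFin -EFinM ltry.
  - exact: measurable_ball.
  - by move=> i; exact: measurable_ball.
have finA : mu (g N `&` A) \is a fin_num.
  rewrite ge0_fin_numE//; apply: le_lt_trans fing; apply: measureIl => //.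
  exact: open_measurable_st.
pose a := fine (mu (g N `&` A)).
have aE : mu (g N `&` A) = a%:E by rewrite fineK.
have a0 : 0 < a by rewrite -lte_fin -aE.
have mgN : measurable (g N) by exact: open_measurable_st.
have [|U [oU AU Ue]] := @outer_regular R n (g N) mgN fing _ (e * a) (mg N).
  by rewrite mulr_gt0.
pose U' := g N `&` U.
have oU' : open U' by exact: openI.
have mU' := open_measurable_st oU'.
have U'e : (mu U' <= (a + e * a)%:E)%E.
  rewrite EFinD -aE (_ : U' = (g N `&` A) `|` (g N `&` (U `\` (g N `&` A)))).
    apply: le_trans (measureU2 _ _ _) _ => //.
      by apply: measurableI => //; apply: measurableD => //; exact: open_measurable_st.
    exact: leeD.
  apply/seteqP; split => [z [gz Uz]|z [gAz|[gz [Uz _]]]]; last 2 first.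
  - by split; [case: gAz|exact: AU].
  - by [].
  by have [|] := pselect ((g N `&` A) z); [left|right].
pose idx := (int * 'rV[int]_n)%type.
(* An enumeration of the cells of the [j]-th grid that lie inside the open hull [U']; the other
   indices give the empty set. *)
pose F j m := if @pickle_inv idx m is Some k then
  if `[< grid_cell (h j) (l j) k `<=` U' >] then grid_cell (h j) (l j) k else set0 else set0.
have mF j m : measurable (F j m).
  rewrite /F; case: pickle_inv => [k|]; last exact: measurable0.
  by case: ifP => _; [exact: measurable_cell|exact: measurable0].
have FP j m z : F j m z -> m = pickle ((floor (z.1 / h j), \row_i floor (z.2 ord0 i / (2 * l j))) : idx) /\ U' z.
  rewrite /F; case Em : (@pickle_inv idx m) => [k|//]; case: ifP => // /asboolP kU kz; split; last exact: kU.
  have := @pickle_invK idx m; rewrite Em /= => <-; congr pickle.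
  exact: (grid_cellP _ _ (h0 j) (l0 j)).1 kz.
have tF j : trivIset setT (F j).
  apply/trivIsetP => m1 m2 _ _ /eqP m12; apply/seteqP; split => // z [/FP[e1' _] /FP[e2' _]].
  by apply: m12; rewrite e1' e2'.
pose Uj j := \bigcup_m F j m.
have UjU j : Uj j `<=` U'.
  by move=> z [m _ /FP[]].
have mUj j : measurable (Uj j) by exact: bigcupT_measurable.
have AUj j : (mu (A `&` Uj j) <= (1 - e)%:E * mu (Uj j))%E.
  rewrite /Uj setI_bigcupr !measure_bigcup//; last 2 first.
  - by move=> m _; exact: measurableI.
  - by apply: trivIset_setIl.
  rewrite -nneseriesZl; last by move=> m _; exact: measure_ge0.
  apply: lee_nneseries => [m _ _|m _]; first exact: measure_ge0.
  rewrite /F; case: pickle_inv => [k|]; last by rewrite setI0 measure0 mule0.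
  case: ifP => [/asboolP kU|_]; last by rewrite setI0 measure0 mule0.
  by apply: cellA => z /kU[[]].
(* The points covered by the retained cells of all grids from [J] on. Since [U'] is open and the
   cells shrink, these sets increase to the whole of the bounded piece. *)
pose AJ J := (g N `&` A) `&` \bigcap_(j in [set j | (J <= j)%N]) Uj j.
have mAJ J : measurable (AJ J).
  by apply: measurableI => //; apply: bigcap_measurable => [|j _]; [by exists J => /=|exact: mUj].
have AJe : \bigcup_J AJ J = g N `&` A.
  apply/seteqP; split => [z [J _ [//]]|z gAz].
  have U'z : U' z by split; [case: gAz|exact: AU].
  have /nbhs_ballP[d /= d0 dU] : nbhs z U' by exact: open_nbhs_nbhs.
  have hn : \forall j \near \oo, h j < d.
    by apply: (cvgr_lt 0).
  have ln : \forall j \near \oo, 2 * l j < d.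
    by apply: (cvgr_lt 0) => //; rewrite -(mulr0 2); apply: cvgM => //; exact: cvg_cst.
  have [J _ HJ] : \forall j \near \oo, h j < d /\ 2 * l j < d by near=> j; split; near: j.
  exists J => //; split => // j /= Jj; have [hd ld] := HJ _ Jj.
  pose k : idx := (floor (z.1 / h j), \row_i floor (z.2 ord0 i / (2 * l j))).
  have kz : grid_cell (h j) (l j) k z by apply/grid_cellP.
  exists (pickle k); first exact: I.
  rewrite /F pickleK_inv; case: asboolP => [_|]; first exact: kz.
  by case; apply: subset_trans dU; exact: cell_ball kz hd ld.
have cA : mu \o AJ @ \oo --> a%:E.
  rewrite -aE -AJe; apply: nondecreasing_cvg_mu => //.
    exact: bigcupT_measurable.
  apply/nondecreasing_seqP => J; apply/subsetPset; apply: setIS => z Uz j /= Jj.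
  by apply: Uz; exact: ltnW.
have : (a%:E <= ((1 - e) * (a + e * a))%:E)%E.
  rewrite -(cvg_lim _ cA)//; apply: lime_le; first by apply/cvg_ex; eexists; exact: cA.
  apply: nearW => J /=; apply: (@le_trans _ _ (mu (A `&` Uj J))).
    apply: le_measure; rewrite ?inE//; first exact: measurableI.
    by move=> z [[_ Az] Uz]; split => //; apply: Uz => /=.
  apply: le_trans (AUj J) _; rewrite EFinM; apply: lee_pmul => //.
    by rewrite lee_fin; lra.
  by apply: le_trans U'e; apply: le_measure; rewrite ?inE.
rewrite lee_fin leNgt => /negP; apply.
rewrite -subr_gt0 (_ : _ - _ = e ^+ 2 * a); last by ring.
by rewrite mulr_gt0// exprn_gt0.
Unshelve. all: by end_near. Qed.
End density.

(** * Smooth cut-offs *)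

Section is_derive_pointwise.
Context (R : realType) (V : normedModType R).
Implicit Types (f g : V -> R) (x v : V).

Lemma is_derive_addf f g x v (df dg : R) : is_derive x v f df -> is_derive x v g dg ->
  is_derive x v (fun y => f y + g y) (df + dg).
Proof. by move=> hf hg; exact: is_deriveD. Qed.

Lemma is_derive_oppf f x v (df : R) : is_derive x v f df ->
  is_derive x v (fun y => - f y) (- df).
Proof. by move=> hf; exact: is_deriveN. Qed.

Lemma is_derive_mulf f g x v (df dg : R) : is_derive x v f df -> is_derive x v g dg ->
  is_derive x v (fun y => f y * g y) (df * g x + f x * dg).
Proof.
move=> hf hg; apply: (is_derive_eq (is_deriveM hf hg)).
by rewrite /GRing.scale/= addrC [g x * _]mulrC.
Qed.

Let line f x v (h : R) : R := f (h *: v + x).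

(** A derivative along [v] is an ordinary derivative of the restriction to a line, which brings the
    chain rule back to one variable. *)
Let is_derive_line f x v (df : R) :
  is_derive x v f df <-> is_derive (0 : R) (1 : R) (line f x v) df.
Proof.
have E : (fun h : R => h^-1 *: ((f \o shift x) (h *: v) - f x)) =
    (fun h : R => h^-1 *: ((line f x v \o shift 0) (h *: 1) - line f x v 0)).
  by apply/funext => h; rewrite /line /shift/= scale0r add0r addr0 /GRing.scale/= mulr1.
split=> -[]; rewrite /derivable /derive => h1 h2; apply: DeriveDef; rewrite /derivable /derive.
- by rewrite -E.
- by rewrite -E.
- by rewrite E.
- by rewrite E.
Qed.

Lemma is_derive_compf (h : R -> R) g x v (dh dg : R) :
  is_derive (g x) 1 h dh -> is_derive x v g dg ->
  is_derive x v (fun y => h (g y)) (dh * dg).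
Proof.
move=> hh /is_derive_line hg; apply/is_derive_line.
apply: (@is_derive1_comp _ h (line g x v)) => //.
by rewrite /line scale0r add0r.
Qed.

Lemma is_derive_invf f x v (df : R) : f x != 0 -> is_derive x v f df ->
  is_derive x v (fun y => (f y)^-1) (- df / f x ^+ 2).
Proof.
move=> f0 hf; have hV : is_derive (f x) 1 (fun s : R => s^-1) (- (f x) ^- 2).
  apply: (is_derive_eq (@is_deriveV R id (f x) 1 1 f0 (is_derive_id _ _))).
  by rewrite /GRing.scale/= mulr1.
by apply: (is_derive_eq (is_derive_compf hV hf)); rewrite mulNr mulrC mulNr.
Qed.

End is_derive_pointwise.

Section bump_functions.
Context (R : realType).
Implicit Types (P Q : {poly R}) (s t : R).

(* The family of these functions is closed under derivation; [bump 1] is the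
   usual flat function [exp(-1/t)]. *)
Definition bump P t : R := if 0 < t then P.[t^-1] * expR (- t^-1) else 0.

(** Term by term, s^i <= i! exp s, from the exponential series. *)
Lemma horner_le_expR P : exists2 C : R, 0 < C & forall s, 0 <= s -> `|P.[s]| <= C * expR s.
Proof.
elim/poly_ind: P => [|P c _]; first by exists 1 => // s _; rewrite horner0 normr0 mul1r expR_ge0.
suff [C C0 PC] : exists2 C : R, 0 < C & forall s, 0 <= s -> `|(P * 'X + c%:P).[s]| <= C * expR s.
  by exists C.
move: (P * 'X + c%:P) => {c}P.
exists (1 + \sum_(i < size P) `|P`_i| * (i`!)%:R).
  by rewrite ltr_pwDl// sumr_ge0// => i _; rewrite mulr_ge0.
move=> s s0; rewrite horner_coef (le_trans (ler_norm_sum _ _ _))//.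
rewrite mulrDl mul1r -[leLHS]add0r lerD ?expR_ge0// mulr_suml ler_sum// => i _.
rewrite normrM -mulrA ler_wpM2l// normrX ger0_norm//.
have [->|i0] := eqVneq (i : nat) 0%N.
  by rewrite expr0 fact0 mul1r -expR0 ler_expR.
have := @expR_ge1Dxn R s i.-1 s0; rewrite prednK ?lt0n// => h.
have i0' : (0 : R) < (i`!)%:R by rewrite ltr0n fact_gt0.
by rewrite -ler_pdivrMl// mulrC (le_trans _ h)// lerDr.
Qed.

Lemma bump_bound P : exists2 C : R, 0 < C & forall t, `|bump P t| <= C.
Proof.
have [C C0 PC] := horner_le_expR P; exists C => // t; rewrite /bump.
case: ifPn => t0; last by rewrite normr0 ltW.
have t10 : 0 <= t^-1 by rewrite invr_ge0 ltW.
rewrite normrM [`|expR _|]ger0_norm ?expR_ge0// expRN ler_pdivrMr ?expR_gt0//.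
exact: PC.
Qed.

(** The bound for the polynomial X^2 P instead of P gains the factor t^2. This quadratic vanishing
    yields the derivative 0 at the origin. *)
Lemma bump_le_id P : exists2 C : R, 0 < C & forall t, `|bump P t| <= C * `|t| ^+ 2.
Proof.
have [C C0 PC] := horner_le_expR ('X ^+ 2 * P); exists C => // t; rewrite /bump.
case: ifPn => t0; last by rewrite normr0 mulr_ge0 ?exprn_ge0// ltW.
have t10 : 0 <= t^-1 by rewrite invr_ge0 ltW.
have := PC _ t10; rewrite !hornerE normrM normrX [`|t^-1|]ger0_norm// => h.
rewrite normrM [`|expR _|]ger0_norm ?expR_ge0// expRN ler_pdivrMr ?expR_gt0//.
rewrite [`|t|]gtr0_norm// (_ : `|P.[t^-1]| = t^-1 ^+ 2 * `|P.[t^-1]| * t ^+ 2); last first.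
  by field; rewrite gt_eqF.
apply: (@le_trans _ _ (C * expR t^-1 * t ^+ 2)); first by rewrite ler_wpM2r// exprn_ge0// ltW.
by rewrite /= expr2 mulrAC mulrA.
Qed.

(** With s = 1/t, the derivative of P(s) exp(-s) in t is s^2 (P - P')(s) exp(-s). *)
Definition dbump P : {poly R} := 'X ^+ 2 * (P - P^`()).

Lemma is_derive_bump P t : is_derive t 1 (bump P) (bump (dbump P) t).
Proof.
have [t0|t0|<-] := ltrgtP 0 t.
- rewrite {2}/bump t0; apply: (@near_eq_is_derive _ _ _ (fun t => P.[t^-1] * expR (- t^-1))).
  + by near=> s; rewrite /bump ifT//; near: s; exact: lt_nbhsr.
  + have dV : is_derive t 1 (fun s : R => s^-1) (- t ^- 2).
      have tn0 : id t != 0 by rewrite gt_eqF.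
      apply: (is_derive_eq (@is_deriveV R id t 1 1 tn0 (is_derive_id _ _))).
      by rewrite /GRing.scale/= mulr1.
    apply: (is_derive_eq (is_derive_mulf (is_derive1_comp (is_derive_poly P t^-1) dV)
      (is_derive1_comp (is_derive_expR _) (is_derive_oppf dV)))).
    rewrite /dbump !hornerE/=.
    have -> : (t ^- 2) = t^-1 ^+ 2 by rewrite exprVn.
    ring.
- rewrite {2}/bump ltNge (ltW t0)/=; apply: (@near_eq_is_derive _ _ _ (cst 0)).
  + by near=> s; rewrite /bump ltNge (@ltW _ _ s 0)//; near: s; exact: lt_nbhsl.
- rewrite {2}/bump ltxx.
  have [C C0 PC] := bump_le_id P.
  have lim0 : h^-1 *: (bump P (h *: 1 + 0) - bump P 0) @[h --> (0:R)^'] --> (0 : R).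
    apply/cvgr0Pnorm_le => e e0; near=> h.
    have h0 : h != 0 by near: h; exact: nbhs_dnbhs_neq.
    have hn : 0 < `|h| by rewrite normr_gt0.
    rewrite addr0 /bump ltxx subr0 -/(bump P _) normrZ normfV.
    rewrite -[_ *: 1]/(h * 1) mulr1 ler_pdivrMl//.
    apply: (le_trans (PC h)); rewrite expr2 mulrA mulrC ler_pM2l//.
    rewrite -ler_pdivlMl//.
    near: h; apply: dnbhs0_le; by rewrite mulr_gt0// invr_gt0.
  apply: DeriveDef; first by apply/cvg_ex; exists 0.
  exact/cvg_lim.
Unshelve. all: by end_near. Qed.

Lemma bump_le0 P t : t <= 0 -> bump P t = 0.
Proof. by move=> t0; rewrite /bump ltNge t0. Qed.

Lemma bump1_gt0 t : 0 < t -> 0 < bump 1 t.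
Proof. by move=> t0; rewrite /bump t0 hornerC mul1r expR_gt0. Qed.

Lemma bump1_ge0 t : 0 <= bump 1 t.
Proof. by rewrite /bump; case: ifP => // _; rewrite hornerC mul1r expR_ge0. Qed.

Lemma bump1_le1 t : bump 1 t <= 1.
Proof.
rewrite /bump; case: ifP => // t0; rewrite hornerC mul1r -[leRHS]expR0 ler_expR.
by rewrite oppr_le0 invr_ge0 ltW.
Qed.

Lemma bump1_mono s t : s <= t -> bump 1 s <= bump 1 t.
Proof.
move=> st; rewrite {1}/bump; case: ifP => [s0|_]; last exact: bump1_ge0.
have t0 := lt_le_trans s0 st.
by rewrite /bump t0 !hornerC !mul1r ler_expR lerN2 lef_pV2.
Qed.

Lemma dbump1 : dbump 1 = 'X^2.
Proof. by rewrite /dbump derivC subr0 mulr1. Qed.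

Lemma bumpX2_ge0 t : 0 <= bump 'X^2 t.
Proof.
by rewrite /bump; case: ifP => // t0; rewrite !hornerE mulr_ge0 ?expR_ge0// exprn_even_ge0.
Qed.

Lemma bumpX2_gt0 t : 0 < t -> 0 < bump 'X^2 t.
Proof.
by move=> t0; rewrite /bump t0 !hornerE mulr_gt0 ?expR_gt0// exprn_gt0// invr_gt0.
Qed.

Lemma is_derive_bumpC P t : is_derive t 1 (fun s => bump P (1 - s)) (- bump (dbump P) (1 - t)).
Proof.
have d1 : is_derive t 1 (fun s : R => 1 - s) (-1).
  apply: (is_derive_eq (is_derive_addf (is_derive_cst (1 : R) t 1) (is_derive_oppf (is_derive_id t (1 : R))))).
  by rewrite add0r.
apply: (is_derive_eq (is_derive1_comp (is_derive_bump P _) d1)).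
by rewrite mulrN1.
Qed.

Definition smooth_step t : R := bump 1 t / (bump 1 t + bump 1 (1 - t)).

(** The quotient rule after cancellation, in a form whose sign is visible. As the derivative of a
    cut-off it is the time profile of the averages. *)
Definition dsmooth_step t : R :=
  (bump 'X^2 t * bump 1 (1 - t) + bump 1 t * bump 'X^2 (1 - t)) /
  (bump 1 t + bump 1 (1 - t)) ^+ 2.

(** One of t and 1 - t is at least 1/2. The uniform lower bound is what bounds the derivative of the
    step. *)
Lemma smooth_step_den t : bump 1 2^-1 <= bump 1 t + bump 1 (1 - t).
Proof.
have [t2|t2] := leP 2^-1 t.
  by rewrite (le_trans (bump1_mono t2))// lerDl bump1_ge0.
by rewrite (@le_trans _ _ (bump 1 (1 - t)))// ?lerDr ?bump1_ge0// bump1_mono//; lra.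
Qed.

Lemma smooth_step_den_gt0 t : 0 < bump 1 t + bump 1 (1 - t).
Proof. by apply: lt_le_trans (smooth_step_den t); rewrite bump1_gt0. Qed.

Lemma is_derive_smooth_step t : is_derive t 1 smooth_step (dsmooth_step t).
Proof.
have d1 := is_derive_bump 1 t; have d2 := is_derive_bumpC 1 t.
rewrite dbump1 in d1 d2.
have D0 := smooth_step_den_gt0 t.
have dD : is_derive t 1 (fun s => bump 1 s + bump 1 (1 - s)) (bump 'X^2 t - bump 'X^2 (1 - t)).
  exact: is_derive_addf.
have Dn0 : bump 1 t + bump 1 (1 - t) != 0 by rewrite gt_eqF.
change (is_derive t 1 (fun s => bump 1 s * (bump 1 s + bump 1 (1 - s))^-1) (dsmooth_step t)).
apply: (is_derive_eq (is_derive_mulf d1 (@is_derive_invf R R^o (fun s => bump 1 s + bump 1 (1 - s)) t 1 _ Dn0 dD))).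
rewrite /dsmooth_step; field; rewrite gt_eqF//.
Qed.

Lemma smooth_step0 t : t <= 0 -> smooth_step t = 0.
Proof. by move=> t0; rewrite /smooth_step bump_le0// mul0r. Qed.

Lemma smooth_step1 t : 1 <= t -> smooth_step t = 1.
Proof.
move=> t1; rewrite /smooth_step [bump 1 (1 - t)]bump_le0 ?subr_le0// addr0 divff//.
by rewrite gt_eqF// bump1_gt0// (lt_le_trans ltr01).
Qed.

Lemma smooth_step_ge0 t : 0 <= smooth_step t.
Proof. by rewrite divr_ge0 ?bump1_ge0// ltW// smooth_step_den_gt0. Qed.

Lemma smooth_step_le1 t : smooth_step t <= 1.
Proof. by rewrite ler_pdivrMr ?smooth_step_den_gt0// mul1r lerDl bump1_ge0. Qed.

Lemma dsmooth_step_ge0 t : 0 <= dsmooth_step t.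
Proof.
by rewrite divr_ge0 ?exprn_ge0 ?(ltW (smooth_step_den_gt0 t))// addr_ge0 ?mulr_ge0 ?bump1_ge0 ?bumpX2_ge0.
Qed.

Lemma dsmooth_step_le0 t : t <= 0 -> dsmooth_step t = 0.
Proof. by move=> t0; rewrite /dsmooth_step !(bump_le0 _ t0) !mul0r addr0 mul0r. Qed.

Lemma dsmooth_step_ge1 t : 1 <= t -> dsmooth_step t = 0.
Proof.
move=> t1; have t1' : 1 - t <= 0 by rewrite subr_le0.
by rewrite /dsmooth_step !(bump_le0 _ t1') !mulr0 addr0 mul0r.
Qed.

Lemma dsmooth_step_gt0 t : 0 < t < 1 -> 0 < dsmooth_step t.
Proof.
move=> /andP[t0 t1]; have t1' : 0 < 1 - t by rewrite subr_gt0.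
by rewrite /dsmooth_step divr_gt0 ?exprn_gt0 ?smooth_step_den_gt0// addr_gt0 ?mulr_gt0 ?bump1_gt0 ?bumpX2_gt0.
Qed.

Lemma dsmooth_step_bound : exists2 L : R, 0 < L & forall t, dsmooth_step t <= L.
Proof.
have [C C0 bC] := bump_bound 'X^2.
have b2 := bump1_gt0 (ltac:(lra) : 0 < 2^-1 :> R).
exists ((C + C) / bump 1 2^-1 ^+ 2); first by rewrite divr_gt0 ?exprn_gt0// addr_gt0.
move=> t; have D0 := smooth_step_den t; have D1 := smooth_step_den_gt0 t.
have bC' s : bump 'X^2 s <= C by apply: le_trans (bC s); exact: ler_norm.
apply: ler_pM.
- by rewrite addr_ge0 ?mulr_ge0 ?bump1_ge0 ?bumpX2_ge0.
- by rewrite invr_ge0 exprn_ge0// ltW.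
- apply: lerD; rewrite -[leRHS]mulr1; first by rewrite ler_pM ?bump1_ge0 ?bumpX2_ge0 ?bump1_le1.
  by rewrite mulrC ler_pM ?bump1_ge0 ?bumpX2_ge0 ?bump1_le1.
- by rewrite lef_pV2 ?posrE ?exprn_gt0// lerXn2r ?nnegrE// ltW.
Qed.

(* The radial profile [B(s)] is the square [profile s ^+ 2], so that [B' = O(sqrt B)]. *)
Definition profile t : R := bump 1 (1 - t).

Definition dprofile t : R := - bump 'X^2 (1 - t).

Lemma is_derive_profile t : is_derive t 1 profile (dprofile t).
Proof. by have := is_derive_bumpC 1 t; rewrite dbump1. Qed.

Lemma profile_ge0 t : 0 <= profile t. Proof. exact: bump1_ge0. Qed.

Lemma profile_le1 t : profile t <= 1. Proof. exact: bump1_le1. Qed.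

Lemma profile_gt0 t : t < 1 -> 0 < profile t.
Proof. by move=> t1; rewrite bump1_gt0// subr_gt0. Qed.

Lemma profile0 t : 1 <= t -> profile t = 0.
Proof. by move=> t1; rewrite /profile bump_le0// subr_le0. Qed.

Lemma dprofile_bound : exists2 L : R, 0 < L & forall t, `|dprofile t| <= L.
Proof.
by have [C C0 bC] := bump_bound 'X^2; exists C => // t; rewrite normrN.
Qed.

End bump_functions.

Section smooth_algebra.
Context (R : realType) (n : nat).
Local Notation E := (R * 'rV[R]_n)%type.
Implicit Types (f g : E -> R) (z v : E).

(* A class of functions closed under directional derivatives; it avoids any
   computation of higher derivatives when checking that a function is smooth. *)
Inductive elementary : (E -> R) -> Prop :=
| elem_cst c : elementary (fun=> c)
| elem_time : elementary (fun z => z.1)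
| elem_space i : elementary (fun z => z.2 ord0 i)
| elem_add f g : elementary f -> elementary g -> elementary (fun z => f z + g z)
| elem_mul f g : elementary f -> elementary g -> elementary (fun z => f z * g z)
| elem_inv f : elementary f -> (forall z, f z != 0) -> elementary (fun z => (f z)^-1)
| elem_bump P f : elementary f -> elementary (fun z => bump P (f z))
| elem_exp f : elementary f -> elementary (fun z => expR (f z)).

Lemma elem_opp f : elementary f -> elementary (fun z => - f z).
Proof.
move=> ef; rewrite (_ : (fun _ => _) = fun z => (- 1) * f z).
  by apply: elem_mul => //; exact: elem_cst.
by apply/funext => z; rewrite mulN1r.
Qed.

Lemma elem_sub f g : elementary f -> elementary g -> elementary (fun z => f z - g z).
Proof. by move=> ef eg; apply: elem_add => //; exact: elem_opp. Qed.

Lemma elem_sum (I : Type) (r : seq I) (F : I -> E -> R) :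
  (forall i, elementary (F i)) -> elementary (fun z => \sum_(i <- r) F i z).
Proof.
move=> eF; elim: r => [|i r IH].
  by rewrite (_ : (fun _ => _) = fun=> 0); [exact: elem_cst|apply/funext => z; rewrite big_nil].
rewrite (_ : (fun _ => _) = fun z => F i z + \sum_(i <- r) F i z); first exact: elem_add.
by apply/funext => z; rewrite big_cons.
Qed.

Lemma elem_smooth_step f : elementary f -> elementary (fun z => smooth_step (f z)).
Proof.
move=> ef; apply: elem_mul; first exact: elem_bump.
apply: elem_inv => [|z]; last by rewrite gt_eqF// smooth_step_den_gt0.
by apply: elem_add; apply: elem_bump => //; apply: elem_sub => //; exact: elem_cst.
Qed.

Lemma elem_dsmooth_step f : elementary f -> elementary (fun z => dsmooth_step (f z)).
Proof.
move=> ef; have e1 : elementary (fun z => 1 - f z) by apply: elem_sub => //; exact: elem_cst.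
apply: elem_mul; first by apply: elem_add; apply: elem_mul; exact: elem_bump.
apply: elem_inv => [|z]; last by rewrite expf_neq0// gt_eqF// smooth_step_den_gt0.
by apply: elem_mul; apply: elem_add; exact: elem_bump.
Qed.

Lemma elem_profile f : elementary f -> elementary (fun z => profile (f z)).
Proof. by move=> ef; apply: elem_bump; apply: elem_sub => //; exact: elem_cst. Qed.

Lemma is_derive_linear (L : E -> R) z v :
  (forall (h : R) v z, L (h *: v + z) = h * L v + L z) -> is_derive z v L (L v).
Proof.
move=> lL; have lim0 : h^-1 *: (L (h *: v + z) - L z) @[h --> (0:R)^'] --> L v.
  apply: (@cvg_trans _ (cst (L v) h @[h --> (0:R)^'])); last exact: cvg_cst.
  apply: near_eq_cvg; near=> h.
  have h0 : h != 0 by near: h; exact: nbhs_dnbhs_neq.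
  by rewrite lL addrK /GRing.scale/= mulrA mulVf// mul1r.
apply: DeriveDef; first by apply/cvg_ex; exists (L v).
exact/cvg_lim.
Unshelve. all: by end_near. Qed.

Lemma is_derive_time z v : is_derive z v (fun z : E => z.1) v.1.
Proof. by apply: (is_derive_linear (L := fun z => z.1)). Qed.

Lemma is_derive_space i z v : is_derive z v (fun z : E => z.2 ord0 i) (v.2 ord0 i).
Proof.
by apply: (is_derive_linear (L := fun z => z.2 ord0 i)) => h v' z'; rewrite !mxE.
Qed.

Lemma elementary_derive f v : elementary f ->
  exists2 g, elementary g & forall z, is_derive z v f (g z).
Proof.
elim=> {f}.
- by move=> c; exists (fun=> 0); [exact: elem_cst|move=> z; exact: is_derive_cst].
- by exists (fun=> v.1); [exact: elem_cst|move=> z; exact: is_derive_time].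
- by move=> i; exists (fun=> v.2 ord0 i); [exact: elem_cst|move=> z; exact: is_derive_space].
- move=> f g _ [f' ef' df] _ [g' eg' dg]; exists (fun z => f' z + g' z); first exact: elem_add.
  by move=> z; exact: is_derive_addf.
- move=> f g ef [f' ef' df] eg [g' eg' dg]; exists (fun z => f' z * g z + f z * g' z).
    by apply: elem_add; exact: elem_mul.
  by move=> z; exact: is_derive_mulf.
- move=> f ef [f' ef' df] f0; exists (fun z => - f' z * ((f z)^-1 * (f z)^-1)).
    apply: elem_mul; first exact: elem_opp.
    by apply: elem_mul; exact: elem_inv.
  move=> z; apply: (is_derive_eq (is_derive_invf (f0 z) (df z))).
  by rewrite expr2 invfM.
- move=> P f ef [f' ef' df]; exists (fun z => bump (dbump P) (f z) * f' z).
    by apply: elem_mul => //; exact: elem_bump.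
  by move=> z; apply: is_derive_compf => //; exact: is_derive_bump.
- move=> f ef [f' ef' df]; exists (fun z => expR (f z) * f' z).
    by apply: elem_mul => //; exact: elem_exp.
  by move=> z; apply: is_derive_compf => //; exact: is_derive_expR.
Qed.

Lemma bump_continuous P : continuous (@bump R P).
Proof.
move=> t; apply/differentiable_continuous/derivable1_diffP.
by have [] := is_derive_bump P t.
Qed.

Lemma elementary_continuous f : elementary f -> continuous f.
Proof.
elim=> {f}.
- by move=> c z; exact: cvg_cst.
- exact: continuous_time.
- exact: continuous_space.
- by move=> f g _ cf _ cg z; apply: cvgD; [exact: cf|exact: cg].
- by move=> f g _ cf _ cg z; apply: cvgM; [exact: cf|exact: cg].
- by move=> f _ cf f0 z; apply: cvgV => //; exact: cf.
- by move=> P f _ cf z; apply: continuous_comp; [exact: cf|exact: bump_continuous].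
- by move=> f _ cf z; apply: continuous_comp; [exact: cf|exact: continuous_expR].
Qed.

Lemma elementary_smooth f : elementary f -> smooth f.
Proof.
move=> ef s; suff : elementary (foldr (fun v g => 'D_v g) f s).
  move=> es; split; first exact: elementary_continuous.
  by move=> z v; have [g _ /(_ z)[]] := elementary_derive v es.
elim: s => //= v s IH; have [g eg dg] := elementary_derive v IH.
rewrite (_ : 'D_v _ = g)//; apply/funext => z.
by have [_ ->] := dg z.
Qed.

Lemma elementary_measurable f : elementary f -> measurable_fun [set: E] f.
Proof. by move=> /elementary_continuous; exact: measurable_fun_continuous_st. Qed.

End smooth_algebra.

(** * The Euclidean norm *)

Section euclidean_norm.
Context (R : realType) (n : nat).
Implicit Types (x y : 'rV[R]_n) (X : 'M[R]_n) (c e : R).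

Lemma sumsq_ge0 x : 0 <= \sum_i x ord0 i ^+ 2.
Proof. by apply: sumr_ge0 => i _; exact: sqr_ge0. Qed.

Lemma enorm_ge0 x : 0 <= enorm x. Proof. exact: sqrtr_ge0. Qed.

Lemma sqr_enorm x : enorm x ^+ 2 = \sum_i x ord0 i ^+ 2.
Proof. by rewrite sqr_sqrtr// sumsq_ge0. Qed.

Lemma enorm0 : enorm (0 : 'rV[R]_n) = 0.
Proof. by rewrite /enorm big1 ?sqrtr0// => i _; rewrite mxE expr0n. Qed.

Lemma enormZ c x : enorm (c *: x) = `|c| * enorm x.
Proof.
rewrite /enorm; under eq_bigr do rewrite mxE exprMn.
by rewrite -mulr_sumr sqrtrM ?sqr_ge0// sqrtr_sqr.
Qed.

Lemma enormN x : enorm (- x) = enorm x.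
Proof. by rewrite -scaleN1r enormZ normrN1 mul1r. Qed.

Lemma enormC x y : enorm (x - y) = enorm (y - x).
Proof. by rewrite -opprB enormN. Qed.

Lemma coord_le_enorm x i : `|x ord0 i| <= enorm x.
Proof.
rewrite -sqrtr_sqr ler_wsqrtr// (bigD1 i)//= lerDl.
by apply: sumr_ge0 => j _; exact: sqr_ge0.
Qed.

(** Cauchy-Schwarz from B (A B - <x,y>^2) = sum of (B x_i - <x,y> y_i)^2, where A and B are the
    squared norms; B = 0 forces y = 0. *)
Lemma dot_le x y : dot x y <= enorm x * enorm y.
Proof.
set A := \sum_i x ord0 i ^+ 2; set B := \sum_i y ord0 i ^+ 2.
have A0 : 0 <= A by exact: sumsq_ge0.
have B0 : 0 <= B by exact: sumsq_ge0.
have key : dot x y ^+ 2 <= A * B.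
  have : 0 <= B * (A * B - dot x y ^+ 2).
    rewrite (_ : _ * _ = \sum_i (B * x ord0 i - dot x y * y ord0 i) ^+ 2).
      by apply: sumr_ge0 => i _; exact: sqr_ge0.
    rewrite (eq_bigr (fun i => B ^+ 2 * x ord0 i ^+ 2 +
      ((- 2 * B * dot x y) * (x ord0 i * y ord0 i) + dot x y ^+ 2 * y ord0 i ^+ 2))).
      rewrite !big_split/= -!mulr_sumr -/A -/B -/(dot x y); ring.
    by move=> i _; ring.
  have [B00|B00] := eqVneq B 0; last first.
    by rewrite pmulr_rge0 ?subr_ge0// lt_neqAle eq_sym B00.
  move=> _; suff -> : dot x y = 0 by rewrite expr0n/= mulr_ge0.
  rewrite /dot big1// => i _; apply/eqP; rewrite mulf_eq0; apply/orP; right.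
  have : `|y ord0 i| <= enorm y := coord_le_enorm y i.
  by rewrite /enorm -/B B00 sqrtr0 normr_le0.
apply: le_trans (ler_norm _) _.
by rewrite -sqrtr_sqr /enorm -sqrtrM// ler_wsqrtr.
Qed.

Lemma dotNl x y : dot (- x) y = - dot x y.
Proof. by rewrite /dot -sumrN; apply: eq_bigr => i _; rewrite mxE mulNr. Qed.

Lemma enormD x y : enorm (x + y) <= enorm x + enorm y.
Proof.
rewrite -(ler_pXn2r (ltn0Sn 1)) ?nnegrE ?addr_ge0 ?enorm_ge0// sqr_enorm.
rewrite sqrrD !sqr_enorm (eq_bigr (fun i => x ord0 i ^+ 2 +
  (2 * (x ord0 i * y ord0 i) + y ord0 i ^+ 2))); last by move=> i _; rewrite mxE; ring.
rewrite !big_split/= -mulr_sumr -/(dot x y) -addrA lerD2l lerD2r.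
by rewrite -[leRHS]mulr_natl ler_wpM2l// dot_le.
Qed.

Lemma enorm_le_sum x : enorm x <= \sum_i `|x ord0 i|.
Proof.
have s0 : 0 <= \sum_i `|x ord0 i| by exact: sumr_ge0.
rewrite -(ler_pXn2r (ltn0Sn 1)) ?nnegrE ?enorm_ge0// sqr_enorm [leRHS]expr2 mulr_suml.
apply: ler_sum => i _; rewrite -real_normK ?num_real// expr2 ler_wpM2l//.
by rewrite (bigD1 i)//= lerDl sumr_ge0.
Qed.

Lemma enorm_le_coord x e : (forall i, `|x ord0 i| <= e) -> enorm x <= n%:R * e.
Proof.
move=> xe; apply: le_trans (enorm_le_sum x) _.
apply: (@le_trans _ _ (\sum_(i < n) e)); first exact: ler_sum.
by rewrite sumr_const card_ord mulr_natl.
Qed.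

Lemma enorm_distD x y z : enorm (x - z) <= enorm (x - y) + enorm (y - z).
Proof. by rewrite (_ : x - z = (x - y) + (y - z)) ?enormD// addrA subrK. Qed.

Let opnorm_set X := [set enorm (mxapp X x) | x in [set x | enorm x <= 1]].

Let opnorm_ub X : has_ubound (opnorm_set X).
Proof.
exists (\sum_i \sum_j `|X i j|) => _ [x /= x1 <-].
apply: le_trans (enorm_le_sum _) _; apply: ler_sum => i _; rewrite /mxapp mxE.
apply: le_trans (ler_norm_sum _ _ _) _; apply: ler_sum => j _.
rewrite normrM mxE mulrC -[leRHS]mulr1 ler_wpM2l//.
exact: le_trans (coord_le_enorm x j) x1.
Qed.

Lemma mxappZ X c x : mxapp X (c *: x) = c *: mxapp X x.
Proof. by rewrite /mxapp scalemxAl. Qed.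

Lemma enorm_mxapp_le X x : enorm (mxapp X x) <= opnorm X * enorm x.
Proof.
have [x0|x0] := eqVneq (enorm x) 0.
  have -> : x = 0.
    apply/rowP => i; rewrite mxE; apply/eqP; rewrite -normr_le0 -x0.
    exact: coord_le_enorm.
  by rewrite /mxapp mul0mx enorm0 mulr0.
have x1 : 0 < enorm x by rewrite lt_neqAle eq_sym x0 enorm_ge0.
rewrite -ler_pdivrMr// mulrC -[(enorm x)^-1]gtr0_norm ?invr_gt0// -enormZ -mxappZ.
apply: sup_upper_bound.
  split; last exact: opnorm_ub.
  by exists (enorm (mxapp X 0)), 0 => //=; rewrite enorm0.
exists ((enorm x)^-1 *: x) => //=.
by rewrite enormZ gtr0_norm ?invr_gt0// mulVf.
Qed.

Lemma opnorm_ge0 X : 0 <= opnorm X.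
Proof.
apply: (@le_trans _ _ (enorm (mxapp X 0))); first exact: enorm_ge0.
apply: sup_upper_bound.
  split; last exact: opnorm_ub.
  by exists (enorm (mxapp X 0)), 0 => //=; rewrite enorm0.
by exists 0 => //=; rewrite enorm0.
Qed.

Lemma enorm_sub_continuous y : continuous (fun x : 'rV[R]_n => enorm (x - y)).
Proof.
move=> x; have FF : Filter (nbhs x) by exact: nbhs_filter.
apply/(@cvgrPdist_lt _ _ _ (nbhs x) FF) => e e0.
have n1 : (0 : R) < n.+1%:R by [].
near=> x'; have xy : enorm (x - x') < e.
  apply: (@le_lt_trans _ _ (n%:R * (e / n.+1%:R))); last first.
    by rewrite mulrCA gtr_pMr// ltr_pdivrMr// mul1r ltr_nat.
  apply: enorm_le_coord => i; rewrite !mxE ltW//.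
  have : ball x (e / n.+1%:R) x' by near: x'; apply: nbhsx_ballx; exact: divr_gt0.
  by move=> -[_ /(_ ord0 i)].
have h1 := enorm_distD x x' y; have h2 := enorm_distD x' x y.
rewrite [enorm (x' - x)]enormC in h2; rewrite ltr_norml; apply/andP; split; lra.
Unshelve. all: by end_near. Qed.

Lemma open_eball y c : open [set x | enorm (x - y) < c].
Proof.
have cf := @enorm_sub_continuous y.
by apply: (@open_comp _ _ _ [set t : R | t < c]) => [x _|]; [exact: cf|exact: open_lt].
Qed.

Lemma closed_eball y c : closed [set x | enorm (x - y) <= c].
Proof.
have cf := @enorm_sub_continuous y.
by apply: (@closed_comp _ _ _ [set t : R | t <= c]) => [x _|]; [exact: cf|exact: closed_le].
Qed.

Lemma compact_eball y c : compact [set x | enorm (x - y) <= c].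
Proof.
apply: bounded_closed_compact; last exact: closed_eball.
exists (`|y| + `|c|); split; first exact: num_real.
move=> M yM x /= xy; have -> : x = (x - y) + y by rewrite subrK.
apply: le_trans (ler_normD _ _) _; rewrite addrC (le_trans _ (ltW yM))// lerD2l.
rewrite -[leLHS]/(mx_norm (x - y)) mx_normrE.
apply: bigmax_le => [|[i j] _ /=]; first exact: normr_ge0.
rewrite (ord1 i) (le_trans (coord_le_enorm _ _))// (le_trans xy)//.
exact: ler_norm.
Qed.

(** Evaluates the eigenvalue term on the barrier, whose Hessian is a nonpositive multiple of the
    identity. A positive dimension provides an eigenvector. *)
Lemma mminus_scalar c : (0 < n)%N -> c <= 0 -> mminus (c%:M : 'M[R]_n) = c.
Proof.
move=> n0 c0; have ev a : eigenvalue (c%:M : 'M[R]_n) a <-> a = c.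
  split => [/eigenvalueP[v]|->].
    rewrite mul_mx_scalar => /eqP; rewrite -subr_eq0 -scalerBl scaler_eq0 subr_eq0.
    by move=> /orP[/eqP ->//|/eqP ->]; rewrite eqxx.
  apply/eigenvalueP; exists (const_mx 1); first by rewrite mul_mx_scalar.
  apply/eqP => /rowP/(_ (Ordinal n0)); rewrite !mxE => /eqP.
  by rewrite oner_eq0.
rewrite /mminus; case: asboolP => [/(_ c)|_].
  by move=> /(_ ((ev c).2 erefl)); rewrite ltNge c0.
rewrite (_ : [set a | _] = [set c]) ?inf1//.
by apply/seteqP; split => a /= /ev.
Qed.

End euclidean_norm.

(** * Kernels carried along a tube *)

Section is_derive_more.
Context (R : realType) (V : normedModType R).

Lemma is_derive_sumf k (h : 'I_k -> V -> R) (x v : V) (dh : 'I_k -> R) :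
  (forall i, is_derive x v (h i) (dh i)) ->
  is_derive x v (fun y => \sum_i h i y) (\sum_i dh i).
Proof.
move=> hd; rewrite (_ : (fun _ => _) = \sum_i h i); first exact: is_derive_sum.
by apply/funext => y; rewrite fct_sumE.
Qed.

(** Phrased through the logarithmic derivative [g], which is multiplied by k under the k-th power;
    this suits [tube_invradius], an exponential. *)
Lemma is_derive_logpow (f : V -> R) (x v : V) (g : R) k :
  is_derive x v f (f x * g) -> is_derive x v (fun y => f y ^+ k) (k%:R * g * f x ^+ k).
Proof.
move=> hf; elim: k => [|k IH].
  by rewrite !mul0r (_ : (fun _ => _) = fun=> 1)//; exact: is_derive_cst.
rewrite (_ : (fun _ => _) = fun y => f y * f y ^+ k); last first.
  by apply/funext => y; rewrite exprS.
apply: (is_derive_eq (is_derive_mulf hf IH)).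
by rewrite exprS -[k.+1]addn1 natrD; ring.
Qed.
End is_derive_more.

(* [tube_*] describe a kernel carried along a tube: during the time window of
   length [tau] after [b0 + h0] its centre moves from [y0] to [y1] and its radius
   changes from [r] to [r * expR lam].  The density [tube_density] solves the
   continuity equation with velocity [tube_vel]; it is stationary outside that
   window. *)
Section tube_kernel.
Context (R : realType) (n : nat).
Local Notation E := (R * 'rV[R]_n)%type.
Implicit Types (z v : E).

Lemma elem_pow (f : E -> R) k : elementary f -> elementary (fun z => f z ^+ k).
Proof.
move=> ef; elim: k => [|k IH]; first exact: elem_cst.
by rewrite (_ : (fun _ => _) = fun z => f z * f z ^+ k); [exact: elem_mul|apply/funext => z; rewrite exprS].
Qed.

Lemma elem_affine_time (b h : R) : elementary (fun z : E => (z.1 - b) / h).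
Proof. by apply: elem_mul; [apply: elem_sub; [exact: elem_time|exact: elem_cst]|exact: elem_cst]. Qed.

Lemma is_derive_affine_time (b h : R) z v : is_derive z v (fun z : E => (z.1 - b) / h) (v.1 / h).
Proof.
apply: (is_derive_eq (is_derive_mulf
  (is_derive_addf (is_derive_time z v) (is_derive_cst (- b) z v)) (is_derive_cst h^-1 z v))).
by rewrite addr0 mulr0 addr0.
Qed.

(** Spares the second derivative of the step: [tube_ds] is only differentiated in space
    directions. *)
Lemma is_derive_time_const (g : R -> R) z v : v.1 = 0 -> is_derive z v (fun z : E => g z.1) 0.
Proof.
move=> v0; have lim0 : h^-1 *: (g (h *: v + z).1 - g z.1) @[h --> (0:R)^'] --> (0 : R).
  rewrite (_ : (fun _ => _) = cst 0); first exact: cvg_cst.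
  by apply/funext => h /=; rewrite v0 scaler0 add0r subrr scaler0.
apply: DeriveDef; first by apply/cvg_ex; exists 0.
exact/cvg_lim.
Qed.

(* Normalized so that its integral does not depend on [b], [h], [y], [r]. *)
Definition weight (b h : R) (y : 'rV[R]_n) (r : R) z : R :=
  dsmooth_step ((z.1 - b) / h) / h *
  (r^-1 ^+ n * profile ((\sum_i (z.2 ord0 i - y ord0 i) ^+ 2) * r^-1 ^+ 2) ^+ 2).

Lemma elementary_weight b h y r : elementary (weight b h y r).
Proof.
apply: elem_mul.
  by apply: elem_mul; [apply: elem_dsmooth_step; exact: elem_affine_time|exact: elem_cst].
apply: elem_mul; first exact: elem_cst.
apply: (@elem_pow (fun z => profile _)); apply: elem_profile; apply: elem_mul; last exact: elem_cst.
apply: elem_sum => i; apply: (@elem_pow (fun z => z.2 ord0 i - y ord0 i)).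
by apply: elem_sub; [exact: elem_space|exact: elem_cst].
Qed.

Context (b0 h0 tau h1 r lam : R) (y0 y1 : 'rV[R]_n).

Definition tube_s z : R := smooth_step ((z.1 - (b0 + h0)) / tau).
Definition tube_ds z : R := dsmooth_step ((z.1 - (b0 + h0)) / tau) / tau.
Definition tube_invradius z : R := r^-1 * expR (- (lam * tube_s z)).
Definition tube_off z i : R := z.2 ord0 i - (y0 ord0 i + tube_s z * (y1 ord0 i - y0 ord0 i)).
Definition tube_q z : R := (\sum_i tube_off z i ^+ 2) * tube_invradius z ^+ 2.
Definition tube_density z : R := tube_invradius z ^+ n * profile (tube_q z) ^+ 2.
Definition tube_cutoff z : R :=
  smooth_step ((z.1 - b0) / h0) - smooth_step ((z.1 - (b0 + h0 + tau)) / h1).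
Definition tube_dcutoff z : R :=
  dsmooth_step ((z.1 - b0) / h0) / h0 - dsmooth_step ((z.1 - (b0 + h0 + tau)) / h1) / h1.
Definition tube_vel i z : R :=
  tube_ds z * ((y1 ord0 i - y0 ord0 i) + lam * tube_off z i).
Definition tube_phi z : R := tube_cutoff z * tube_density z.
Definition tube_psi i z : R := tube_phi z * tube_vel i z.

Lemma elem_tube_s : elementary tube_s.
Proof. by apply: elem_smooth_step; exact: elem_affine_time. Qed.

Lemma elem_tube_ds : elementary tube_ds.
Proof. by apply: elem_mul; [apply: elem_dsmooth_step; exact: elem_affine_time|exact: elem_cst]. Qed.

Lemma elem_tube_off i : elementary (tube_off^~ i).
Proof.
apply: elem_sub; first exact: elem_space.
apply: elem_add; first exact: elem_cst.
by apply: elem_mul; [exact: elem_tube_s|exact: elem_cst].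
Qed.

Lemma elem_tube_invradius : elementary tube_invradius.
Proof.
apply: elem_mul; first exact: elem_cst.
by apply/elem_exp/elem_opp/elem_mul; [exact: elem_cst|exact: elem_tube_s].
Qed.

Lemma elem_tube_q : elementary tube_q.
Proof.
apply: elem_mul; last by apply: elem_pow; exact: elem_tube_invradius.
by apply: elem_sum => i; apply: (@elem_pow (tube_off^~ i)); exact: elem_tube_off.
Qed.

Lemma elem_tube_density : elementary tube_density.
Proof.
apply: elem_mul; apply: elem_pow; first exact: elem_tube_invradius.
by apply: elem_profile; exact: elem_tube_q.
Qed.

Lemma elem_tube_phi : elementary tube_phi.
Proof.
apply: elem_mul; last exact: elem_tube_density.
by apply: elem_sub; apply: elem_smooth_step; exact: elem_affine_time.
Qed.

Lemma elem_tube_psi i : elementary (tube_psi i).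
Proof.
apply: elem_mul; first exact: elem_tube_phi.
apply: elem_mul; first exact: elem_tube_ds.
apply: elem_add; first exact: elem_cst.
by apply: elem_mul; [exact: elem_cst|exact: elem_tube_off].
Qed.

Definition tube_dq v z : R :=
  2 * (\sum_i tube_off z i * (v.2 ord0 i - tube_ds z * v.1 * (y1 ord0 i - y0 ord0 i))) *
    tube_invradius z ^+ 2 - 2 * lam * tube_ds z * v.1 * tube_q z.

Definition tube_ddensity v z : R :=
  tube_invradius z ^+ n * (2 * profile (tube_q z) * dprofile (tube_q z) * tube_dq v z) -
  n%:R * lam * tube_ds z * v.1 * tube_density z.

Lemma is_derive_tube_s z v : is_derive z v tube_s (tube_ds z * v.1).
Proof.
apply: (is_derive_eq (is_derive_compf (is_derive_smooth_step _) (is_derive_affine_time _ _ z v))).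
by rewrite /tube_ds mulrA mulrAC.
Qed.

Lemma is_derive_tube_invradius z v :
  is_derive z v tube_invradius (tube_invradius z * (- lam * tube_ds z * v.1)).
Proof.
have d1 := is_derive_oppf (is_derive_mulf (is_derive_cst lam z v) (is_derive_tube_s z v)).
apply: (is_derive_eq (is_derive_mulf (is_derive_cst r^-1 z v)
  (is_derive_compf (is_derive_expR _) d1))).
by rewrite /tube_invradius /cst/=; ring.
Qed.

Lemma is_derive_tube_off i z v : is_derive z v (tube_off^~ i)
  (v.2 ord0 i - tube_ds z * v.1 * (y1 ord0 i - y0 ord0 i)).
Proof.
apply: (is_derive_eq (is_derive_addf (is_derive_space i z v) (is_derive_oppf
  (is_derive_addf (is_derive_cst (y0 ord0 i) z v)
    (is_derive_mulf (is_derive_tube_s z v) (is_derive_cst (y1 ord0 i - y0 ord0 i) z v)))))).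
by rewrite /cst/=; ring.
Qed.

Lemma is_derive_tube_q z v : is_derive z v tube_q (tube_dq v z).
Proof.
have d1 i : is_derive z v (fun z => tube_off z i ^+ 2)
    (2 * (tube_off z i * (v.2 ord0 i - tube_ds z * v.1 * (y1 ord0 i - y0 ord0 i)))).
  rewrite (_ : (fun _ => _) = fun z => tube_off z i * tube_off z i).
    apply: (is_derive_eq (is_derive_mulf (is_derive_tube_off i z v) (is_derive_tube_off i z v))).
    by ring.
  by apply/funext => ?; rewrite expr2.
apply: (is_derive_eq (is_derive_mulf (is_derive_sumf d1)
  (is_derive_logpow 2 (is_derive_tube_invradius z v)))).
by rewrite /tube_dq /tube_q -mulr_sumr; ring.
Qed.

Lemma is_derive_tube_density z v : is_derive z v tube_density (tube_ddensity v z).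
Proof.
have d1 : is_derive z v (fun z => profile (tube_q z) ^+ 2)
    (2 * profile (tube_q z) * dprofile (tube_q z) * tube_dq v z).
  have d0 := is_derive_compf (is_derive_profile _) (is_derive_tube_q z v).
  rewrite (_ : (fun _ => _) = fun z => profile (tube_q z) * profile (tube_q z)).
    by apply: (is_derive_eq (is_derive_mulf d0 d0)); ring.
  by apply/funext => ?; rewrite expr2.
apply: (is_derive_eq (is_derive_mulf (is_derive_logpow n (is_derive_tube_invradius z v)) d1)).
by rewrite /tube_ddensity /tube_density; ring.
Qed.

Lemma is_derive_tube_phi z v : is_derive z v tube_phi
  (tube_dcutoff z * v.1 * tube_density z + tube_cutoff z * tube_ddensity v z).
Proof.
have d1 : is_derive z v tube_cutoff (tube_dcutoff z * v.1).
  apply: (is_derive_eq (is_derive_addf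
    (is_derive_compf (is_derive_smooth_step _) (is_derive_affine_time b0 h0 z v))
    (is_derive_oppf (is_derive_compf (is_derive_smooth_step _)
      (is_derive_affine_time (b0 + h0 + tau) h1 z v))))).
  by rewrite /tube_dcutoff; ring.
exact: (is_derive_mulf d1 (is_derive_tube_density z v)).
Qed.

Lemma is_derive_tube_psi i z : is_derive z (dirx i) (tube_psi i)
  (tube_cutoff z * (tube_ddensity (dirx i) z * tube_vel i z + tube_density z * (lam * tube_ds z))).
Proof.
have d1 : is_derive z (dirx i) tube_ds 0.
  exact: (@is_derive_time_const (fun t => dsmooth_step ((t - (b0 + h0)) / tau) / tau)).
have d2 : is_derive z (dirx i) (tube_vel i) (lam * tube_ds z).
  apply: (is_derive_eq (is_derive_mulf d1 (is_derive_addf (is_derive_cst (y1 ord0 i - y0 ord0 i) z (dirx i))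
    (is_derive_mulf (is_derive_cst lam z (dirx i)) (is_derive_tube_off i z (dirx i)))))).
  by rewrite /cst/= mxE !eqxx /=; ring.
apply: (is_derive_eq (is_derive_mulf (is_derive_tube_phi z (dirx i)) d2)).
by rewrite /tube_phi /= mulr0; ring.
Qed.

Lemma tube_ddensity_dirx i z : tube_ddensity (dirx i) z =
  tube_invradius z ^+ n * (4 * profile (tube_q z) * dprofile (tube_q z) *
    tube_off z i * tube_invradius z ^+ 2).
Proof.
rewrite /tube_ddensity /tube_dq /= !mulr0 !mul0r !subr0 (bigD1 i)//= big1.
  by rewrite mxE !eqxx /=; ring.
by move=> j ji; rewrite mxE (negbTE ji) andbF mul0r subr0 mulr0.
Qed.

(** With centre c(t) and radius R(t), the density R^(-n) B(|x - c|^2 / R^2) is transported by the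
    velocity c' + (R'/R)(x - c), whose divergence n R'/R balances the derivative of R^(-n). Only the
    derivative of the time cut-off survives. *)
Lemma tube_continuity_equation z :
  'D_dirt tube_phi z + \sum_i 'D_(dirx i) (tube_psi i) z = tube_dcutoff z * tube_density z.
Proof.
have [_ ->] := is_derive_tube_phi z dirt.
rewrite (eq_bigr (fun i => tube_cutoff z * (tube_ddensity (dirx i) z * tube_vel i z +
    tube_density z * (lam * tube_ds z)))) => [|i _]; last by have [_ ->] := is_derive_tube_psi i z.
rewrite -mulr_sumr big_split/= sumr_const card_ord -[_ *+ n]mulr_natl.
rewrite (eq_bigr (fun i => tube_invradius z ^+ n * (4 * profile (tube_q z) * dprofile (tube_q z) *
   tube_invradius z ^+ 2 * tube_ds z) * (tube_off z i * (y1 ord0 i - y0 ord0 i) + lam * tube_off z i ^+ 2))); last first.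
  by move=> i _; rewrite tube_ddensity_dirx /tube_vel; ring.
rewrite -mulr_sumr big_split/= -mulr_sumr.
rewrite /tube_ddensity /tube_dq /dirt /= !mulr1.
rewrite (eq_bigr (fun i => - tube_ds z * (tube_off z i * (y1 ord0 i - y0 ord0 i)))); last first.
  by move=> i _; rewrite mxE; ring.
rewrite -mulr_sumr /tube_q; ring.
Qed.

(** The rising part of the cut-off acts before the kernel starts to move, the falling part after it
    has stopped; in these windows the density is the stationary initial or final one. *)
Lemma tube_dcutoff_weight z : 0 < h0 -> 0 < tau -> 0 < h1 ->
  tube_dcutoff z * tube_density z =
  weight b0 h0 y0 r z - weight (b0 + h0 + tau) h1 y1 (r * expR lam) z.
Proof.
move=> h00 tau0 h10.
rewrite /tube_dcutoff mulrBl; congr (_ - _).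
  rewrite /weight.
  have [t1|t1] := leP z.1 (b0 + h0).
    have s0 : tube_s z = 0.
      by rewrite /tube_s smooth_step0// pmulr_lle0 ?invr_gt0// subr_le0.
    rewrite /tube_density /tube_q /tube_invradius s0 mulr0 oppr0 expR0 mulr1.
    do 4 f_equal; congr (_ * _); apply: eq_bigr => i _; rewrite /tube_off s0 mul0r addr0//.
  by rewrite dsmooth_step_ge1 ?mul0r// ler_pdivlMr// mul1r lerBrDl ltW.
rewrite /weight; have [t1|t1] := leP (b0 + h0 + tau) z.1.
  have s1 : tube_s z = 1.
    by rewrite /tube_s smooth_step1// ler_pdivlMr// mul1r lerBrDl.
  rewrite /tube_density /tube_q /tube_invradius s1 mulr1 expRN -invfM.
  do 4 f_equal; congr (_ * _); apply: eq_bigr => i _; congr (_ ^+ 2); rewrite /tube_off s1; ring.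
rewrite dsmooth_step_le0 ?mul0r// pmulr_lle0 ?invr_gt0// subr_le0; exact: ltW.
Qed.

End tube_kernel.

(** * Comparison of integrals, and two scalar inequalities *)

Section integration_toolkit.
Context d (T : measurableType d) (R : realType) (mu : {measure set T -> \bar R}).
Implicit Types (D : set T) (f g : T -> R).

Lemma ae_le_integrable D f g : measurable D -> measurable_fun D f ->
  mu.-integrable D (EFin \o g) -> {ae mu, forall x, D x -> `|f x| <= g x} ->
  mu.-integrable D (EFin \o f).
Proof.
move=> mD mf ig fg; apply/integrableP; split; first exact/measurable_EFinP.
have /integrableP[mg ig'] := ig; apply: le_lt_trans ig'.
apply: ae_ge0_le_integral => //.
- by apply: measurableT_comp => //; exact/measurable_EFinP.
- exact: measurableT_comp.
- apply: filterS fg => x fgx Dx /=; rewrite lee_fin.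
  by apply: le_trans (fgx Dx) _; exact: ler_norm.
Qed.

Lemma ae_le_Rintegral D f g : measurable D ->
  mu.-integrable D (EFin \o f) -> mu.-integrable D (EFin \o g) ->
  {ae mu, forall x, D x -> f x <= g x} ->
  Rintegral mu D f <= Rintegral mu D g.
Proof.
move=> mD if_ ig fg; rewrite -subr_ge0 -RintegralB//.
have igf : mu.-integrable D (EFin \o (fun x => g x - f x)).
  by have := integrableB mD ig if_.
have mgf : measurable_fun D (fun x => g x - f x).
  by apply/measurable_EFinP; case/integrableP : igf.
rewrite /Rintegral (@ae_eq_integral _ _ _ mu D (fun x => `|g x - f x|%:E)) => [||||].
- by apply/fine_ge0/integral_ge0.
- by [].
- exact/measurable_EFinP.
- by apply/measurable_EFinP; exact: measurableT_comp.
- by apply: filterS fg => x fgx Dx /=; rewrite ger0_norm// subr_ge0; exact: fgx.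
Qed.

Lemma integrable_indic_finite S : measurable S -> (mu S < +oo)%E ->
  mu.-integrable setT (fun x => (\1_S x : R)%:E).
Proof.
move=> mS finS; apply/integrableP; split.
  by apply/measurable_EFinP; exact: measurable_indic.
rewrite (eq_integral (fun x => (\1_S x : R)%:E)) => [|x _]; last first.
  by rewrite gee0_abs// lee_fin.
by rewrite integral_indic// setIT.
Qed.

Lemma integrable_bounded_support D S f C : measurable D -> measurable S ->
  (mu S < +oo)%E -> measurable_fun D f -> (forall x, `|f x| <= C * \1_S x) ->
  mu.-integrable D (EFin \o f).
Proof.
move=> mD mS finS mf fC.
apply: (@ae_le_integrable _ _ (fun x => C * \1_S x)) => //; last first.
  by apply: nearW => x _; exact: fC.
have : mu.-integrable D (fun x => C%:E * (\1_S x)%:E)%E.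
  apply: integrableZl => //; apply: (integrableS (E := setT)) => //.
  exact: integrable_indic_finite.
by [].
Qed.

Lemma Rintegral_indic_scale D S C : measurable D -> measurable S ->
  (mu S < +oo)%E -> 0 <= C ->
  Rintegral mu D (fun x => C * \1_S x) <= C * fine (mu S).
Proof.
move=> mD mS finS C0.
rewrite RintegralZl//; last by apply: (integrableS (E := setT)) => //; exact: integrable_indic_finite.
rewrite ler_wpM2l// /Rintegral integral_indic// fine_le//.
- rewrite ge0_fin_numE//; apply: le_lt_trans finS; exact: measureIl.
- by rewrite ge0_fin_numE.
- exact: measureIl.
Qed.

End integration_toolkit.

Section young.
Context (R : realType).

(** If y^(p-1) <= L w, then y is at most the last power and the second term suffices; otherwise w <
    y^(p-1) / L and the first one does. *)
Lemma young_powR (L p y w : R) : 0 < L -> 1 < p -> 0 <= y -> 0 <= w ->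
  y * w <= L^-1 * y `^ p + w * (L * w) `^ (p - 1)^-1.
Proof.
move=> L0 p1 y0 w0; have p10 : 0 < p - 1 by rewrite subr_gt0.
have [h|h] := leP (y `^ (p - 1)) (L * w).
  rewrite -[leLHS]add0r lerD ?mulr_ge0 ?powR_ge0 ?invr_ge0 ?(ltW L0)// mulrC ler_wpM2l//.
  have -> : y = (y `^ (p - 1)) `^ (p - 1)^-1 by rewrite -powRrM mulfV ?gt_eqF// powRr1.
  by rewrite ge0_ler_powR ?nnegrE ?invr_ge0 ?powR_ge0 ?mulr_ge0 ?(ltW p10) ?(ltW L0).
have yp : y `^ p = y * y `^ (p - 1).
  transitivity (y `^ (1 + (p - 1))); first by congr powR; ring.
  have h2 : (1 + (p - 1) == 0) ==> (y != 0) by apply/implyP => /eqP; lra.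
  by rewrite (powRD h2) powRr1.
rewrite -[leLHS]addr0 lerD ?mulr_ge0 ?powR_ge0// yp mulrCA ler_wpM2l//.
by rewrite ler_pdivlMl// ltW.
Qed.

(** For b > a the factor (b/a)^(m-1) exceeds 1. Integrated with a well chosen [a], this replaces
    Hoelder's inequality for f. *)
Lemma norm_le_powR (a b m : R) : 0 < a -> 1 <= m -> 0 <= b ->
  b <= a `^ (1 - m) * b `^ m + a.
Proof.
move=> a0 m1 b0; have [ba|ab] := leP b a.
  by rewrite -[leLHS]add0r lerD ?mulr_ge0 ?powR_ge0.
rewrite -[leLHS]addr0 lerD ?(ltW a0)//.
have b0' : 0 < b by exact: lt_trans ab.
have bE : b = b `^ (1 - m) * b `^ m.
  have h2 : (1 - m + m == 0) ==> (b != 0) by apply/implyP => _; rewrite gt_eqF.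
  by rewrite -(powRD h2) subrK powRr1.
rewrite {1}bE ler_wpM2r ?powR_ge0// -[1 - m]opprB !powRN lef_pV2 ?posrE ?powR_gt0//.
by rewrite ge0_ler_powR ?nnegrE ?subr_ge0// ltW.
Qed.
End young.

(** * Pointwise bounds along the tube *)

Section tube_geometry.
Context (R : realType) (n : nat).
Local Notation E := (R * 'rV[R]_n)%type.
Local Notation mu := (lebesgue_st R n).
Context (b0 h0 tau h1 r lam : R) (y0 y1 : 'rV[R]_n).
Hypotheses (h00 : 0 < h0) (tau0 : 0 < tau) (h10 : 0 < h1) (r0 : 0 < r).
Hypothesis lam1 : `|lam| <= 1.
Local Notation ee := (expR (1 : R)).
Local Notation off := (tube_off b0 h0 tau y0 y1).
Local Notation phi := (tube_phi b0 h0 tau h1 r lam y0 y1).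
Local Notation psi := (tube_psi b0 h0 tau h1 r lam y0 y1).
Local Notation invr := (tube_invradius b0 h0 tau r lam).
Local Notation cutoff := (tube_cutoff b0 h0 tau h1).
Local Notation q := (tube_q b0 h0 tau r lam y0 y1).
Implicit Types z : E.

Lemma ee_gt0 : 0 < ee. Proof. exact: expR_gt0. Qed.

Lemma tube_s_bounds z : 0 <= tube_s b0 h0 tau z <= 1.
Proof. by rewrite smooth_step_ge0 smooth_step_le1. Qed.

Lemma invradius_bounds z : (ee * r)^-1 <= invr z <= ee / r.
Proof.
have /andP[s0 s1] := tube_s_bounds z.
have ls : `|lam * tube_s b0 h0 tau z| <= 1.
  by rewrite normrM (ger0_norm s0) -[leRHS]mulr1 ler_pM.
move: ls; rewrite ler_norml => /andP[l1 l2]; rewrite /tube_invradius.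
rewrite invfM -expRN mulrC [ee / r]mulrC !ler_pM2l ?invr_gt0// !ler_expR.
by apply/andP; split; lra.
Qed.

Lemma invradius_gt0 z : 0 < invr z.
Proof. by rewrite mulr_gt0 ?invr_gt0 ?expR_gt0. Qed.

Lemma tube_cutoff_ge0 z : 0 <= cutoff z.
Proof.
rewrite /tube_cutoff subr_ge0; have [t1|t1] := leP z.1 (b0 + h0 + tau).
  by rewrite smooth_step0 ?smooth_step_ge0// pmulr_lle0 ?invr_gt0// subr_le0.
rewrite (@smooth_step1 _ ((z.1 - b0) / h0)) ?smooth_step_le1//.
by rewrite ler_pdivlMr// mul1r; move: t1 h00 tau0; lra.
Qed.

Lemma tube_cutoff_le1 z : cutoff z <= 1.
Proof. by rewrite lerBlDr (le_trans (smooth_step_le1 _))// lerDl smooth_step_ge0. Qed.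

Lemma tube_cutoff_neq0 z : cutoff z != 0 -> b0 <= z.1 <= b0 + h0 + tau + h1.
Proof.
apply: contra_neqT; rewrite negb_and -!ltNge /tube_cutoff => /orP[t1|t1].
  rewrite !smooth_step0 ?subrr// pmulr_lle0 ?invr_gt0// subr_le0.
    by move: t1 h00 tau0; lra.
  exact: ltW.
rewrite !smooth_step1 ?subrr// ler_pdivlMr// mul1r.
  by move: t1 h00 tau0 h10; lra.
by move: t1 h00 tau0 h10; lra.
Qed.

Definition tube_offv z : 'rV[R]_n := \row_i off z i.

Lemma tube_qE z : q z = (enorm (tube_offv z) * invr z) ^+ 2.
Proof.
by rewrite exprMn sqr_enorm; congr (_ * _); apply: eq_bigr => i _; rewrite mxE.
Qed.

Lemma tube_profile_neq0 z : profile (q z) != 0 -> enorm (tube_offv z) * invr z < 1.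
Proof.
apply: contra_neqT; rewrite -leNgt => h; apply: profile0; rewrite tube_qE.
by rewrite exprn_ege1.
Qed.

Lemma tube_offv_lt z : profile (q z) != 0 -> enorm (tube_offv z) < ee * r.
Proof.
move=> /tube_profile_neq0; rewrite -ltr_pdivlMr ?invradius_gt0// => /lt_le_trans; apply.
rewrite mul1r -[leRHS]invrK lef_pV2 ?posrE ?invradius_gt0 ?invr_gt0 ?mulr_gt0 ?ee_gt0//.
by have /andP[] := invradius_bounds z.
Qed.

(** The space condition is coordinatewise, so that the slices at fixed times are cubes; their centre
    moves, but their volume is constant and the measure is exact. *)
Definition tube_support : set E := [set z | b0 <= z.1 <= b0 + h0 + tau + h1 /\
  forall i, `|off z i| <= ee * r].

Lemma tube_support_phi z : cutoff z * profile (q z) != 0 -> tube_support z.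
Proof.
rewrite mulf_eq0 negb_or => /andP[c0 P0]; split; first exact: tube_cutoff_neq0.
move=> i; have := coord_le_enorm (tube_offv z) i; rewrite mxE => /le_trans; apply.
exact/ltW/tube_offv_lt.
Qed.

Lemma tube_support_phi0 z : ~ tube_support z -> cutoff z * profile (q z) = 0.
Proof. by move=> nz; apply/eqP; apply: contrapT => /negP/tube_support_phi. Qed.

Lemma measurable_tube_support : measurable tube_support.
Proof.
have mI : measurable [set z : E | b0 <= z.1 <= b0 + h0 + tau + h1].
  rewrite (_ : [set _ | _] = fst @^-1` `[b0, b0 + h0 + tau + h1]%classic).
    by rewrite -[X in measurable X]setTI; exact: measurable_fst.
  by apply/seteqP; split => z /=; rewrite in_itv.
rewrite (_ : tube_support = [set z : E | b0 <= z.1 <= b0 + h0 + tau + h1] `&`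
   \bigcap_(i in [set: 'I_n]) ((off^~ i) @^-1` `[- (ee * r), ee * r]%classic)).
  apply: measurableI => //; apply: fin_bigcap_measurable => // i _.
  rewrite -[X in measurable X]setTI.
  by apply: (elementary_measurable (elem_tube_off b0 h0 tau y0 y1 i)).
apply/seteqP; split => z [z1 z2]; split => // i.
  by move=> _ /=; rewrite in_itv/= -ler_norml; exact: z2.
by have := z2 i I; rewrite /= in_itv/= -ler_norml.
Qed.

Lemma lebesgue_tube_support :
  mu tube_support = ((h0 + tau + h1) * (2 * (ee * r)) ^+ n)%:E.
Proof.
have er0 : 0 < ee * r by rewrite mulr_gt0 ?ee_gt0.
pose c (t : R) i : R := y0 ord0 i +
  smooth_step ((t - (b0 + h0)) / tau) * (y1 ord0 i - y0 ord0 i).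
transitivity (\int[lebesgue1]_t
   (((2 * (ee * r)) ^+ n)%:E * (\1_(`[b0, b0 + h0 + tau + h1]%classic) t)%:E))%E.
  rewrite /lebesgue_st /product_measure1; apply: eq_integral => t _ /=.
  rewrite indicE; have [|] := boolP (t \in _).
    rewrite inE /= in_itv/= => tI; rewrite mule1.
    rewrite (_ : xsection _ _ = [set x : 'rV[R]_n | forall i,
       `[c t i - ee * r, c t i + ee * r]%classic (x ord0 i)]).
      rewrite (@lebesgue_box R n (fun i => `[c t i - ee * r, c t i + ee * r]%classic))// (eq_bigr (fun=> (2 * (ee * r))%:E)).
        by rewrite prodEFin prodr_const card_ord.
      move=> i _; rewrite lebesgue_measure_itv/= lte_fin ifT; last by lra.
      by rewrite -EFinB; congr EFin; ring.
    apply/seteqP; split => x /=; rewrite /xsection/= inE.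
      move=> [_ h] i; have := h i; rewrite /tube_off in_itv/= ler_norml /c /tube_s/= => /andP[? ?].
      by apply/andP; split; lra.
    move=> h; split => // i; have := h i; rewrite /tube_off in_itv/= ler_norml /c /tube_s/= => /andP[? ?].
    by apply/andP; split; lra.
  move=> tI; rewrite mule0 (_ : xsection _ _ = set0) ?measure0//.
  apply/seteqP; split => // x; rewrite /xsection/= inE => -[h _].
  by move/negP : tI; apply; rewrite inE /= in_itv.
rewrite ge0_integralZl//; last by rewrite lee_fin exprn_ge0// mulr_ge0// ltW.
  rewrite integral_indic// setIT.
  have muI : lebesgue1 `[b0, b0 + h0 + tau + h1]%classic = (h0 + tau + h1)%:E.
    rewrite /lebesgue1 (@lebesgue_measure_itv R `[b0, b0 + h0 + tau + h1])/= lte_fin ifT; last by move: h00 tau0 h10; lra.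
    by rewrite -EFinB; congr EFin; ring.
  by rewrite (mulrC (h0 + tau + h1)) EFinM; congr (_ * _)%E; exact: muI.
by apply/measurable_EFinP; exact: measurable_indic.
Qed.

Lemma tube_amplitude z : 0 <= cutoff z * invr z ^+ n <= (ee / r) ^+ n.
Proof.
have i0 := ltW (invradius_gt0 z); have /andP[_ ib] := invradius_bounds z.
rewrite mulr_ge0 ?tube_cutoff_ge0 ?exprn_ge0//= -[leRHS]mul1r.
by rewrite ler_pM ?tube_cutoff_ge0 ?exprn_ge0 ?tube_cutoff_le1// lerXn2r ?nnegrE// (le_trans i0).
Qed.

Lemma tube_phiE z : phi z = cutoff z * invr z ^+ n * profile (q z) ^+ 2.
Proof. by rewrite /tube_phi /tube_density mulrA. Qed.

Lemma tube_phi_ge0 z : 0 <= phi z.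
Proof.
by rewrite tube_phiE mulr_ge0 ?exprn_ge0 ?profile_ge0//; case/andP: (tube_amplitude z).
Qed.

Lemma tube_phi_le z : phi z <= (ee / r) ^+ n * \1_tube_support z.
Proof.
rewrite tube_phiE indicE; have [zs|zs] := boolP (z \in tube_support).
  rewrite mulr1; have /andP[a0 a1] := tube_amplitude z.
  rewrite -[leRHS]mulr1 ler_pM ?exprn_ge0 ?profile_ge0//.
  by rewrite exprn_ile1 ?profile_ge0 ?profile_le1.
rewrite mulr0; have := tube_support_phi0 (fun h => negP zs (mem_set h)) => h.
rewrite (_ : _ * _ = cutoff z * profile (q z) * (invr z ^+ n * profile (q z))); last by ring.
by rewrite h mul0r.
Qed.

Variables (Lam p L L' : R).
Hypotheses (Lam0 : 0 < Lam) (p2 : 2 < p).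
Hypothesis Lb : forall t : R, dsmooth_step t <= L.
Hypothesis L'b : forall t : R, `|dprofile t| <= L'.

(** The first term bounds the transport velocity. The second is the contribution of [A], which
    enters like a velocity of order 1/r through the gradient of the kernel. *)
Definition tube_speed : R :=
  L / tau * (enorm (y1 - y0) + ee * r) + 4 * Lam * L' * (ee / r).

Definition tube_error : R := tube_speed * (Lam * tube_speed) `^ (p - 1)^-1.

Lemma tube_speed_ge0 : 0 <= tube_speed.
Proof.
have L0 : 0 <= L by apply: le_trans (Lb 0); exact: dsmooth_step_ge0.
have L'0 : 0 <= L' by apply: le_trans (L'b 0).
rewrite addr_ge0 ?mulr_ge0 ?addr_ge0 ?invr_ge0 ?enorm_ge0//;
  by rewrite ?mulr_ge0 ?(ltW ee_gt0) ?(ltW r0) ?(ltW tau0) ?(ltW Lam0).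
Qed.

(** The kernel contains the square P^2 of the profile, so its gradient still contains a factor P.
    Both gradient terms are thus bounded by |G| P times a speed and are absorbed by |G|^p P^2
    through Young's inequality. *)
Lemma tube_pointwise z (G : 'rV[R]_n) (X : 'M[R]_n) : opnorm X <= Lam ->
  \sum_i G ord0 i * psi i z - Lam^-1 * enorm G `^ p * phi z
    - dot (mxapp X G) (grad phi z) <= (ee / r) ^+ n * tube_error * \1_tube_support z.
Proof.
move=> XL; set c := cutoff z * invr z ^+ n; set P := profile (q z).
have /andP[c0 c1] := tube_amplitude z; rewrite -/c in c0 c1.
have P0 : 0 <= P := profile_ge0 _; have P1 : P <= 1 := profile_le1 _.
have L0 : 0 <= L by apply: le_trans (Lb 0); exact: dsmooth_step_ge0.
have L'0 : 0 <= L' by apply: le_trans (L'b 0).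
set V : 'rV[R]_n := \row_i tube_vel b0 h0 tau lam y0 y1 i z.
have E1 : \sum_i G ord0 i * psi i z = c * P ^+ 2 * dot G V.
  rewrite /dot mulr_sumr; apply: eq_bigr => i _.
  by rewrite mxE /tube_psi tube_phiE -/c -/P; ring.
have E2 : grad phi z = (c * (4 * P * dprofile (q z) * invr z ^+ 2)) *: tube_offv z.
  apply/rowP => i; rewrite !mxE.
  have [_ ->] := is_derive_tube_phi b0 h0 tau h1 r lam y0 y1 z (dirx i).
  by rewrite tube_ddensity_dirx /= mulr0 mul0r add0r -/P /c; ring.
have [cP0|cP0] := eqVneq (c * P) 0.
  rewrite E1 E2 tube_phiE -/c -/P.
  rewrite (_ : c * P ^+ 2 = c * P * P); last by ring.
  rewrite (_ : c * (4 * P * dprofile (q z) * invr z ^+ 2) =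
    c * P * (4 * dprofile (q z) * invr z ^+ 2)); last by ring.
  have dot0 x : dot x (0 : 'rV[R]_n) = 0 by rewrite /dot big1// => i _; rewrite mxE mulr0.
  rewrite cP0 !mul0r mulr0 scale0r dot0 !subr0.
  rewrite mulr_ge0 ?indic_ge0// mulr_ge0 ?exprn_ge0 ?divr_ge0 ?(ltW ee_gt0) ?(ltW r0)//.
  by rewrite mulr_ge0 ?tube_speed_ge0 ?powR_ge0.
have zs : tube_support z.
  by apply: tube_support_phi; apply: contra_neq cP0; rewrite /c => h;
    rewrite mulrAC -/P h mul0r.
rewrite indicE mem_set// mulr1.
have Pn0 : P != 0 by apply: contra_neq cP0 => ->; rewrite mulr0.
have off1 := tube_profile_neq0 Pn0; have off2 := tube_offv_lt Pn0.
have i0 := invradius_gt0 z; have /andP[_ ib] := invradius_bounds z.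
set N := enorm G; have N0 : 0 <= N := enorm_ge0 _.
set w := enorm V + 4 * Lam * L' * invr z.
have a4 : 0 <= 4 * Lam * L' by apply: mulr_ge0 => //; apply: mulr_ge0 => //; exact: ltW.
have w0 : 0 <= w by apply: addr_ge0; [exact: enorm_ge0|exact: mulr_ge0 a4 (ltW i0)].
have Vb : enorm V <= L / tau * (enorm (y1 - y0) + ee * r).
  rewrite (_ : V = tube_ds b0 h0 tau z *: ((y1 - y0) + lam *: tube_offv z)); last first.
    by apply/rowP => i; rewrite !mxE /tube_vel.
  rewrite enormZ; apply: ler_pM => //; first exact: enorm_ge0.
    have ds0 : 0 <= tube_ds b0 h0 tau z by apply: divr_ge0; [exact: dsmooth_step_ge0|exact: ltW].
    by rewrite (ger0_norm ds0) ler_pM2r ?invr_gt0.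
  apply: le_trans (enormD _ _) _; rewrite lerD2l enormZ.
  by apply: le_trans (ltW off2); rewrite -[leRHS]mul1r ler_wpM2r ?enorm_ge0.
have wW : w <= tube_speed.
  by apply: lerD => //; rewrite ler_wpM2l.
(* Chosen so that y^p = N^p P^2 is the coercive term, while N P <= y because P <= 1 and 2/p < 1. *)
set y := N * P `^ (2 / p).
have p0 : 0 < p by move: p2; lra.
have y0' : 0 <= y by rewrite /y mulr_ge0 ?powR_ge0.
have NPy : N * P <= y.
  rewrite ler_wpM2l// -{1}[P]powRr1//.
  apply: ger_powR; first by rewrite lt_neqAle eq_sym Pn0 P0 P1.
  by rewrite ler_pdivrMr// mul1r ltW.
have ypE : y `^ p = N `^ p * P ^+ 2.
  by rewrite powRM ?powR_ge0// -powRrM divfK ?gt_eqF// powR_mulrn.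
have B1 : c * P ^+ 2 * dot G V <= c * (y * enorm V).
  rewrite -mulrA ler_wpM2l//.
  apply: (@le_trans _ _ (P ^+ 2 * (N * enorm V))).
    by rewrite ler_wpM2l ?exprn_ge0// dot_le.
  rewrite mulrA ler_wpM2r ?enorm_ge0// (le_trans _ NPy)// mulrC ler_wpM2l//.
  by rewrite expr2 -[leRHS]mulr1 ler_wpM2l.
have B2 : - dot (mxapp X G) (grad phi z) <= c * (y * (4 * Lam * L' * invr z)).
  rewrite -dotNl; apply: le_trans (dot_le _ _) _; rewrite enormN E2 enormZ.
  rewrite [`|c * _|]normrM (ger0_norm c0).
  rewrite (_ : _ * (_ * enorm (tube_offv z)) = c * (enorm (mxapp X G) *
    (`|4 * P * dprofile (q z) * invr z ^+ 2| * enorm (tube_offv z)))); last by ring.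
  apply: ler_wpM2l => //.
  have -> : `|4 * P * dprofile (q z) * invr z ^+ 2| = 4 * P * `|dprofile (q z)| * invr z ^+ 2.
    rewrite [LHS]normrM [`|4 * P * _|]normrM (@ger0_norm _ (4 * P)) ?mulr_ge0//.
    by rewrite (@ger0_norm _ (invr z ^+ 2))// exprn_ge0// ltW.
  apply: (@le_trans _ _ ((Lam * N) * (4 * P * L' * invr z))); last first.
    rewrite (_ : _ * _ = (4 * Lam * L' * invr z) * (N * P)); last by ring.
    by rewrite [X in _ <= X]mulrC ler_wpM2l// (mulr_ge0 a4 (ltW i0)).
  apply: ler_pM.
  - exact: enorm_ge0.
  - apply: mulr_ge0; last exact: enorm_ge0.
    apply: mulr_ge0; last exact/exprn_ge0/ltW.
    by apply: mulr_ge0 => //; exact: mulr_ge0.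
  - by apply: le_trans (enorm_mxapp_le _ _) _; rewrite ler_wpM2r.
  - rewrite (_ : _ * enorm _ = 4 * P * `|dprofile (q z)| * (invr z * (enorm (tube_offv z) * invr z))); last by ring.
    have P4 : 0 <= 4 * P by exact: mulr_ge0.
    apply: ler_pM.
    + exact: mulr_ge0.
    + by apply: mulr_ge0; [exact: ltW|apply: mulr_ge0; [exact: enorm_ge0|exact: ltW]].
    + exact: ler_wpM2l.
    + by rewrite -[leRHS]mulr1; apply: ler_wpM2l; exact: ltW.
have Y := young_powR Lam0 (ltac:(move: p2; lra) : 1 < p) y0' w0.
have p10 : 0 <= (p - 1)^-1 by rewrite invr_ge0; move: p2; lra.
have YW : w * (Lam * w) `^ (p - 1)^-1 <= tube_error.
  apply: ler_pM => //; first exact: powR_ge0.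
  by rewrite ge0_ler_powR ?nnegrE ?mulr_ge0 ?tube_speed_ge0 ?(ltW Lam0)// ler_wpM2l// ltW.
have E3 : Lam^-1 * N `^ p * phi z = c * (Lam^-1 * y `^ p).
  by rewrite tube_phiE -/c -/P ypE; ring.
rewrite E1 E3.
apply: (@le_trans _ _ (c * (y * w - Lam^-1 * y `^ p))).
  by rewrite /w; move: B1 B2; set a1 := c * P ^+ 2 * _; set a2 := dot (mxapp _ _) _; nra.
apply: (@le_trans _ _ (c * tube_error)).
  by rewrite ler_wpM2l//; lra.
by rewrite ler_wpM2r// mulr_ge0 ?tube_speed_ge0 ?powR_ge0.
Qed.

End tube_geometry.

(** * The integral inequality between two averages *)

Section compact_support.
Context (R : realType) (n : nat).
Local Notation E := (R * 'rV[R]_n)%type.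
Local Notation mu := (lebesgue_st R n).
Implicit Types (K : set E) (f : E -> R).

Lemma compact_closed_st K : compact K -> closed K.
Proof. by move=> cK; apply: compact_closed => //; exact: norm_hausdorff. Qed.

Lemma compact_measurable_st K : compact K -> measurable K.
Proof.
move=> /compact_closed_st/closed_openC/open_measurable_st/measurableC.
by rewrite setCK.
Qed.

Lemma lebesgue_st_ball_fin (e : R) : (mu (ball (0%R : E) e) < +oo)%E.
Proof.
have [e0|e0] := ltP 0 e; last first.
  rewrite (_ : ball _ _ = set0) ?measure0//; apply/seteqP; split => // w [b1 _].
  by have := le_lt_trans (normr_ge0 _) (lt_le_trans (b1 : `|(0:E).1 - w.1| < e) e0); rewrite ltxx.
rewrite ball_box// (@lebesgue_st_box R n (ball (0:R) e) (fun i => ball ((0:E).2 ord0 i) e))//.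
- rewrite lebesgue_measure_ball ?ltW//.
  under eq_bigr do rewrite lebesgue_measure_ball ?ltW//.
  by rewrite prodEFin -EFinM ltry.
- exact: measurable_ball.
- by move=> i; exact: measurable_ball.
Qed.

Lemma compact_fin_st K : compact K -> (mu K < +oo)%E.
Proof.
move=> cK; have [M [_ KM]] := compact_bounded cK.
apply: (@le_lt_trans _ _ (mu (ball (0%R : E) (M + 2)%R))); last exact: lebesgue_st_ball_fin.
apply: le_measure; rewrite ?inE; [exact: compact_measurable_st|exact: measurable_stball|].
move=> z Kz; rewrite -ball_normE /= sub0r normrN.
have M1 : M < M + 1 by rewrite ltrDl.
apply: le_lt_trans (KM _ M1 z Kz) _; lra.
Qed.

Lemma continuous_bounded_support K f : compact K -> continuous f ->
  (forall z, ~ K z -> f z = 0) ->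
  exists2 C, 0 <= C & forall z, `|f z| <= C * \1_K z.
Proof.
move=> cK cf f0.
have : compact (f @` K).
  by apply: continuous_compact => //; exact: continuous_subspaceT.
move=> /compact_bounded[M [_ fM]]; exists (`|M| + 1); first by rewrite addr_ge0.
move=> z; rewrite indicE; have [zK|zK] := boolP (z \in K).
  rewrite mulr1; apply: (fM (`|M| + 1)); last by exists z => //; exact: set_mem.
  by rewrite ltr_pwDr// ler_norm.
by rewrite mulr0 f0 ?normr0// => Kz; move/negP : zK; apply; rewrite inE.
Qed.

Lemma derive_support K f v z : closed K -> (forall z, ~ K z -> f z = 0) ->
  ~ K z -> 'D_v f z = 0.
Proof.
move=> cK f0 Kz; rewrite (@near_eq_derive _ _ _ f (cst 0)) ?derive_cst//.
have : nbhs z (~` K) by apply: open_nbhs_nbhs; split => //; exact: closed_openC.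
by apply: filterS => y /f0.
Qed.

Lemma elementary_test K Q f : compact K -> K `<=` Q -> elementary f ->
  (forall z, ~ K z -> f z = 0) -> test_function Q f.
Proof. by move=> cK KQ ef f0; split; [exact: elementary_smooth|exists K; split]. Qed.

Lemma elementary_D f v : elementary f -> elementary ('D_v f).
Proof.
move=> ef; have [g eg dg] := elementary_derive v ef.
rewrite (_ : 'D_v f = g)//; apply/funext => z; by have [_ ->] := dg z.
Qed.

End compact_support.

(** * Integrability of the terms of the equation *)

Section subsolution_data.
Context (R : realType) (n : nat).
Local Notation E := (R * 'rV[R]_n)%type.
Local Notation mu := (lebesgue_st R n).

(** The divergence-form half of the hypotheses on the open cylinder, with the norms unfolded into
    integrals and almost everywhere bounds. *)
Record subsolution (Lam p m U T : R) (Omega : set 'rV[R]_n)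
    (f : E -> R) (A : E -> 'M[R]_n) (u : E -> R) (G : E -> 'rV[R]_n) : Prop := Subsolution {
  sub_open : open Omega;
  sub_u_meas : measurable_fun (`]0, T[ `*` Omega) u;
  sub_u_bound : {ae mu, forall z, (`]0, T[ `*` Omega) z -> `|u z| <= U};
  sub_G_meas : measurable_fun (`]0, T[ `*` Omega) G;
  sub_G_fin : (\int[mu]_(z in `]0%R, T[ `*` Omega) (enorm (G z) `^ p)%:E < +oo)%E;
  sub_f_meas : measurable_fun (`]0, T[ `*` Omega) f;
  sub_f_bound : (\int[mu]_(z in `]0%R, T[ `*` Omega) (`|f z| `^ m)%:E <= (Lam `^ m)%:E)%E;
  sub_A_meas : forall i j, measurable_fun (`]0, T[ `*` Omega) (fun z => A z i j);
  sub_A_bound : {ae mu, forall z, (`]0, T[ `*` Omega) z -> opnorm (A z) <= Lam};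
  sub_wgrad : weak_gradient (`]0, T[ `*` Omega) u G;
  sub_ineq : distributional_subsolution (`]0, T[ `*` Omega) Lam^-1 p A f u G }.

Context (Lam p m U T : R) (Omega : set 'rV[R]_n)
    (f : E -> R) (A : E -> 'M[R]_n) (u : E -> R) (G : E -> 'rV[R]_n).
Hypotheses (Lam0 : 0 < Lam) (p2 : 2 < p) (m1 : 1 < m).
Hypothesis S : subsolution Lam p m U T Omega f A u G.
Local Notation Q := (`]0, T[ `*` Omega : set E).

Lemma open_cylinder : open Q.
Proof.
rewrite openE => -[t x] [/= tT Ox]; exists (`]0, T[%classic, Omega) => //.
split => /=; apply: open_nbhs_nbhs; split; [exact: interval_open|exact: tT|exact: (sub_open S)|exact: Ox].
Qed.

Lemma measurable_cylinder : measurable Q.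
Proof. by apply: open_measurable_st; exact: open_cylinder. Qed.

(** One class containing every coefficient that is paired with a test function. The summand 1 need
    not be integrable on [Q]; it becomes so after multiplication by a bounded function of compact
    support. *)
Definition dominated (F : E -> R) : Prop := measurable_fun Q F /\
  exists2 C : R, 0 <= C & {ae mu, forall z, Q z ->
    `|F z| <= C * (enorm (G z) `^ p + `|f z| `^ m + 1)}.

Lemma measurable_G_coord i : measurable_fun Q (fun z => G z ord0 i).
Proof. exact: (measurableT_comp (measurable_coord i) (sub_G_meas S)). Qed.

Lemma measurable_enorm_G : measurable_fun Q (fun z => enorm (G z)).
Proof.
have ms : measurable_fun [set: R] (@Num.sqrt R).
  by apply: continuous_measurable_fun; exact: sqrt_continuous.
apply: (measurableT_comp ms (g := fun z => \sum_i G z ord0 i ^+ 2)).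
by apply: measurable_sum => i; apply: measurable_funX; exact: measurable_G_coord.
Qed.

Lemma measurable_G_pow : measurable_fun Q (fun z => enorm (G z) `^ p).
Proof. by apply: (measurableT_comp (measurable_powR p)); exact: measurable_enorm_G. Qed.

Lemma measurable_f_pow : measurable_fun Q (fun z => `|f z| `^ m).
Proof.
apply: (measurableT_comp (measurable_powR m)).
by apply: measurableT_comp => //; exact: sub_f_meas S.
Qed.

Lemma integrable_G_pow : mu.-integrable Q (EFin \o (fun z => enorm (G z) `^ p)).
Proof.
apply/integrableP; split; first by apply/measurable_EFinP; exact: measurable_G_pow.
rewrite (eq_integral (fun z => (enorm (G z) `^ p)%:E)); first exact: sub_G_fin S.
by move=> z _; rewrite gee0_abs// lee_fin powR_ge0.
Qed.

Lemma integrable_f_pow : mu.-integrable Q (EFin \o (fun z => `|f z| `^ m)).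
Proof.
apply/integrableP; split; first by apply/measurable_EFinP; exact: measurable_f_pow.
rewrite (eq_integral (fun z => (`|f z| `^ m)%:E)).
  by apply: le_lt_trans (sub_f_bound S) _; rewrite ltry.
by move=> z _; rewrite gee0_abs// lee_fin powR_ge0.
Qed.

Lemma dominated_u : dominated u.
Proof.
split; first exact: sub_u_meas S.
exists `|U|; first exact: normr_ge0.
apply: filterS (sub_u_bound S) => z uU Qz; apply: le_trans (uU Qz) _.
apply: le_trans (ler_norm _) _; rewrite -[leLHS]mulr1 ler_wpM2l// lerDr.
by rewrite addr_ge0 ?powR_ge0.
Qed.

Lemma norm_G_le z : enorm (G z) <= enorm (G z) `^ p + `|f z| `^ m + 1.
Proof.
have p1 : 1 <= p by move: p2; lra.
have := @norm_le_powR R 1 (enorm (G z)) p ltr01 p1 (enorm_ge0 _).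
rewrite powR1 mul1r => /le_trans; apply.
by rewrite -addrA lerD2l lerDr powR_ge0.
Qed.

Lemma dominated_G i : dominated (fun z => G z ord0 i).
Proof.
split; first exact: measurable_G_coord.
exists 1 => //; apply: nearW => z _; rewrite mul1r.
by apply: le_trans (norm_G_le z); exact: coord_le_enorm.
Qed.

Lemma dominated_G_pow : dominated (fun z => enorm (G z) `^ p).
Proof.
split; first exact: measurable_G_pow.
exists 1 => //; apply: nearW => z _; rewrite mul1r ger0_norm ?powR_ge0//.
by rewrite -addrA lerDl addr_ge0 ?powR_ge0.
Qed.

Lemma dominated_f : dominated f.
Proof.
split; first exact: sub_f_meas S.
exists 1 => //; apply: nearW => z _; rewrite mul1r.
have := @norm_le_powR R 1 `|f z| m ltr01 (ltW m1) (normr_ge0 _).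
rewrite powR1 mul1r => /le_trans; apply.
by rewrite -addrA lerDr powR_ge0.
Qed.

Lemma dominated_AG i : dominated (fun z => mxapp (A z) (G z) ord0 i).
Proof.
split.
  rewrite (_ : (fun _ => _) = fun z => \sum_j G z ord0 j * A z i j).
    apply: measurable_sum => j; apply: measurable_funM; first exact: measurable_G_coord.
    exact: sub_A_meas S i j.
  by apply/funext => z; rewrite mxE; apply: eq_bigr => j _; rewrite mxE.
exists Lam; first exact: ltW.
apply: filterS (sub_A_bound S) => z AL Qz; apply: le_trans (coord_le_enorm _ _) _.
apply: le_trans (enorm_mxapp_le _ _) _.
apply: ler_pM; [exact: opnorm_ge0|exact: enorm_ge0|exact: AL|exact: norm_G_le].
Qed.

Lemma dominated_integrable F g (K : set E) : dominated F -> compact K ->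
  elementary g -> (forall z, ~ K z -> g z = 0) ->
  mu.-integrable Q (EFin \o (fun z => F z * g z)).
Proof.
move=> [mF [C C0 FC]] cK eg g0; have mQ := measurable_cylinder.
have [D D0 gD] := continuous_bounded_support cK (elementary_continuous eg) g0.
have mK := compact_measurable_st cK; have finK := compact_fin_st cK.
apply: (@ae_le_integrable _ _ _ mu Q _
  (fun z => C * D * (enorm (G z) `^ p + `|f z| `^ m) + C * D * \1_K z)) => //.
- by apply: measurable_funM => //; apply: measurable_funTS; exact: elementary_measurable.
- have i1 := integrableD mQ integrable_G_pow integrable_f_pow.
  have i2 := integrableZl mQ (C * D) i1.
  have iK : mu.-integrable Q (EFin \o (\1_K : E -> R)).
    exact: (integrableS measurableT mQ (@subsetT _ _) (integrable_indic_finite mK finK)).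
  exact: (integrableD mQ i2 (integrableZl mQ (C * D) iK)).
- apply: filterS FC => z Fz Qz; rewrite normrM.
  apply: le_trans (ler_pM (normr_ge0 _) (normr_ge0 _) (Fz Qz) (gD z)) _.
  rewrite indicE; set H := enorm _ `^ _ + _.
  have H0 : 0 <= H by rewrite addr_ge0 ?powR_ge0.
  by case: (z \in K); rewrite /= ?mulr1 ?mulr0 ?addr0; [rewrite le_eqVlt; apply/orP; left; apply/eqP; ring|rewrite !mulr_ge0].
Qed.

End subsolution_data.

Lemma weight_support (R : realType) n b h (y : 'rV[R]_n) r (z : R * 'rV[R]_n) :
  0 < h -> 0 < r -> weight b h y r z != 0 ->
  b < z.1 < b + h /\ enorm (z.2 - y) < r.
Proof.
move=> h0 r0 nz; split.
  have d0 : dsmooth_step ((z.1 - b) / h) != 0.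
    by apply: contra_neq nz => d0; rewrite /weight d0 !mul0r.
  apply/andP; split; rewrite ltNge; apply: contra_neqN d0 => t0.
    by rewrite dsmooth_step_le0// pmulr_lle0 ?invr_gt0// subr_le0.
  by rewrite dsmooth_step_ge1// ler_pdivlMr// mul1r lerBrDl.
have p0 : profile ((\sum_i (z.2 ord0 i - y ord0 i) ^+ 2) * r^-1 ^+ 2) != 0.
  by apply: contra_neq nz => p0; rewrite /weight p0 expr0n/= !mulr0.
rewrite ltNge; apply: contra_neqN p0 => ry; apply: profile0.
rewrite (_ : \sum_i _ = enorm (z.2 - y) ^+ 2); last first.
  by rewrite sqr_enorm; apply: eq_bigr => i _; rewrite !mxE.
by rewrite -exprMn exprn_ege1// ler_pdivlMr// mul1r.
Qed.

Section step_inequality.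
Context (R : realType) (n : nat).
Local Notation E := (R * 'rV[R]_n)%type.
Local Notation mu := (lebesgue_st R n).
Context (Lam p m U T : R) (Omega : set 'rV[R]_n)
    (f : E -> R) (A : E -> 'M[R]_n) (u : E -> R) (G : E -> 'rV[R]_n).
Hypotheses (Lam0 : 0 < Lam) (p2 : 2 < p) (m1 : 1 < m).
Hypothesis S : subsolution Lam p m U T Omega f A u G.
Local Notation Q := (`]0, T[ `*` Omega : set E).
Context (b0 h0 tau h1 r lam : R) (y0 y1 : 'rV[R]_n).
Hypotheses (h00 : 0 < h0) (tau0 : 0 < tau) (h10 : 0 < h1) (r0 : 0 < r).
Hypothesis lam1 : `|lam| <= 1.
Variables (L L' : R).
Hypothesis Lb : forall t : R, dsmooth_step t <= L.
Hypothesis L'b : forall t : R, `|dprofile t| <= L'.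
Local Notation ee := (expR (1 : R)).
Hypotheses (b00 : 0 < b0) (b1T : b0 + h0 + tau + h1 < T).
Hypothesis BO : forall x, enorm (x - y0) <= enorm (y1 - y0) + ee * r -> Omega x.
Local Notation phi := (tube_phi b0 h0 tau h1 r lam y0 y1).
Local Notation psi := (tube_psi b0 h0 tau h1 r lam y0 y1).
Local Notation TS := (tube_support b0 h0 tau h1 r y0 y1).

(** A fixed compact set containing the whole moving tube, hence the supports of [phi], of every
    [psi i] and of both weights. *)
Let K : set E := `[b0, b0 + h0 + tau + h1] `*`
  [set x | enorm (x - y0) <= enorm (y1 - y0) + ee * r].

Let cK : compact K.
Proof. by apply: compact_setX; [exact: segment_compact|exact: compact_eball]. Qed.

Let KQ : K `<=` Q.
Proof.
move=> [t x] [/= tI xI]; split => /=; last exact: BO.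
by move: tI; rewrite !in_itv/= => /andP[t1 t2]; apply/andP; split;
  [exact: lt_le_trans t1|exact: le_lt_trans b1T].
Qed.

Let phi0 z : ~ K z -> phi z = 0.
Proof.
apply: contra_notP => /eqP pz.
have : tube_cutoff b0 h0 tau h1 z * profile (tube_q b0 h0 tau r lam y0 y1 z) != 0.
  apply: contra_neq pz => h.
  rewrite tube_phiE (_ : _ * _ ^+ 2 = tube_cutoff b0 h0 tau h1 z *
    profile (tube_q b0 h0 tau r lam y0 y1 z) * (tube_invradius b0 h0 tau r lam z ^+ n *
    profile (tube_q b0 h0 tau r lam y0 y1 z))); last by ring.
  by rewrite h mul0r.
rewrite mulf_eq0 negb_or => /andP[c0 P0]; split => /=.
  by rewrite in_itv/=; exact: (tube_cutoff_neq0 h00 tau0 h10 c0).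
have o1 := ltW (tube_offv_lt r0 lam1 P0).
rewrite (_ : z.2 - y0 = tube_s b0 h0 tau z *: (y1 - y0) + tube_offv b0 h0 tau y0 y1 z); last first.
  by apply/rowP => i; rewrite !mxE /tube_off; ring.
apply: le_trans (enormD _ _) _; apply: lerD => //; rewrite enormZ.
by rewrite ger0_norm ?smooth_step_ge0// -[leRHS]mul1r ler_wpM2r ?enorm_ge0 ?smooth_step_le1.
Qed.

Let psi0 i z : ~ K z -> psi i z = 0.
Proof. by move=> /phi0 h; rewrite /tube_psi h mul0r. Qed.

Let tphi : test_function Q phi.
Proof. by exact: (elementary_test cK KQ (elem_tube_phi _ _ _ _ _ _ _ _) phi0). Qed.

Let tpsi i : test_function Q (psi i).
Proof. by exact: (elementary_test cK KQ (elem_tube_psi _ _ _ _ _ _ _ _ i) (@psi0 i)). Qed.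

Let ephi := elem_tube_phi b0 h0 tau h1 r lam y0 y1.
Let epsi := elem_tube_psi b0 h0 tau h1 r lam y0 y1.
Let mQ := measurable_cylinder S.

Let D0 (g : E -> R) v z : (forall z, ~ K z -> g z = 0) -> ~ K z -> 'D_v g z = 0.
Proof. by move=> g0; apply: derive_support => //; exact: compact_closed_st. Qed.

Let iu g : elementary g -> (forall z, ~ K z -> g z = 0) ->
  mu.-integrable Q (EFin \o (fun z => u z * g z)).
Proof. by move=> eg g0; apply: (dominated_integrable S (dominated_u S) cK eg g0). Qed.

Let w0 := weight b0 h0 y0 r : E -> R.
Let w1 := weight (b0 + h0 + tau) h1 y1 (r * expR lam) : E -> R.

Let J z : R := - (u z * dt phi z) + Lam^-1 * enorm (G z) `^ p * phi z
        + dot (mxapp (A z) (G z)) (grad phi z).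

Let iJ : mu.-integrable Q (EFin \o J).
Proof.
have i1 : mu.-integrable Q (EFin \o (fun z => u z * dt phi z)).
  by apply: iu; [exact: elementary_D|move=> z; exact: D0].
have i2 := dominated_integrable S (dominated_G_pow S) cK ephi phi0.
have i3 i : mu.-integrable Q (EFin \o (fun z => mxapp (A z) (G z) ord0 i * 'D_(dirx i) phi z)).
  apply: (dominated_integrable S (dominated_AG Lam0 p2 S i) cK); first exact: elementary_D.
  by move=> z; exact: D0.
have i4 : mu.-integrable Q (EFin \o (fun z => dot (mxapp (A z) (G z)) (grad phi z))).
  have := integrable_sum mQ (index_enum 'I_n) (P := xpredT) (fun i _ => i3 i).
  apply: eq_integrable => // z _; rewrite /= sumEFin; congr EFin.
  by apply: eq_bigr => i _; congr (_ * _); rewrite mxE.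
have := integrableD mQ (integrableD mQ (integrableN i1) (integrableZl mQ Lam^-1 i2)) i4.
by apply: eq_integrable => // z _; rewrite /J /= -[Lam^-1 * _ * phi z]mulrA.
Qed.

(** Its integral vanishes: this is the weak gradient tested with each [psi i]. Subtracting it trades
    the divergence of the flux, multiplied by u, for gradient terms. *)
Let B z : R := \sum_i (u z * 'D_(dirx i) (psi i) z + G z ord0 i * psi i z).

Let iBi i : mu.-integrable Q (EFin \o (fun z => u z * 'D_(dirx i) (psi i) z + G z ord0 i * psi i z)).
Proof.
have i1 : mu.-integrable Q (EFin \o (fun z => u z * 'D_(dirx i) (psi i) z)).
  by apply: iu; [exact: elementary_D|move=> z; apply: D0; exact: psi0].
have i2 := dominated_integrable S (dominated_G p2 S i) cK (epsi i) (@psi0 i).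
exact: (integrableD mQ i1 i2).
Qed.

Let iB : mu.-integrable Q (EFin \o B).
Proof.
have := integrable_sum mQ (index_enum 'I_n) (P := xpredT) (fun i _ => iBi i).
by apply: eq_integrable => // z _; rewrite /= sumEFin.
Qed.

Let intB : Rintegral mu Q B = 0.
Proof.
rewrite /Rintegral (_ : \int[mu]_(z in Q) (B z)%:E = \sum_i \int[mu]_(z in Q) (u z * 'D_(dirx i) (psi i) z + G z ord0 i * psi i z)%:E)%E; last first.
  rewrite -(integral_sum mQ iBi).
  by apply: eq_integral => z _; rewrite sumEFin.
rewrite big1// => i _.
have i1 : mu.-integrable Q (EFin \o (fun z => u z * 'D_(dirx i) (psi i) z)).
  by apply: iu; [exact: elementary_D|move=> z; apply: D0; exact: psi0].
have i2 := dominated_integrable S (dominated_G p2 S i) cK (epsi i) (@psi0 i).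
have h : Rintegral mu Q (fun z => u z * 'D_(dirx i) (psi i) z + G z ord0 i * psi i z) = 0.
  by rewrite RintegralD// (sub_wgrad S i (tpsi i)) addNr.
rewrite -[LHS]fineK; last exact: (integrable_fin_num mQ (iBi i)).
by move: h; rewrite /Rintegral => ->.
Qed.

Let iu0 : mu.-integrable Q (EFin \o (fun z => u z * w0 z)).
Proof.
apply: iu; first exact: elementary_weight.
move=> z; apply: contra_notP => /eqP/weight_support[//|//|/andP[t1 t2] x1]; split => /=.
  by rewrite in_itv/=; apply/andP; split; move: tau0 h10; lra.
apply: le_trans (ltW x1) _; rewrite -[leLHS]add0r lerD ?enorm_ge0//.
by rewrite -[leLHS]mul1r ler_pM2r// -expR0 ler_expR.
Qed.

Let iu1 : mu.-integrable Q (EFin \o (fun z => u z * w1 z)).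
Proof.
have rl0 : 0 < r * expR lam by rewrite mulr_gt0 ?expR_gt0.
apply: iu; first exact: elementary_weight.
move=> z; apply: contra_notP => /eqP/weight_support[//|//|/andP[t1 t2] x1]; split => /=.
  by rewrite in_itv/=; apply/andP; split; move: tau0 h00; lra.
apply: le_trans (enorm_distD _ y1 _) _; rewrite addrC lerD2l (le_trans (ltW x1))//.
rewrite mulrC ler_pM2r// ler_expR; apply: le_trans lam1; exact: ler_norm.
Qed.

Local Notation V := ((h0 + tau + h1) * (2 * (ee * r)) ^+ n).

Let V0 : 0 < V.
Proof. by rewrite mulr_gt0 ?exprn_gt0 ?mulr_gt0 ?expR_gt0 ?addr_gt0. Qed.

Let mTS : measurable TS. Proof. exact: measurable_tube_support. Qed.

Let finTS : (mu TS < +oo)%E.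
Proof. by rewrite lebesgue_tube_support// ltry. Qed.

Let iTS c : mu.-integrable Q (EFin \o (fun z => c * \1_TS z)).
Proof.
have i1 := integrable_indic_finite mTS finTS.
exact: (integrableZl mQ c (integrableS measurableT mQ (@subsetT _ _) i1)).
Qed.

Let intf : Rintegral mu Q (fun z => f z * phi z) <=
  (ee / r) ^+ n * (2 * Lam * V `^ (1 - m^-1)).
Proof.
(* This value makes the two terms of [norm_le_powR], once integrated, equal to Lam V^(1 - 1/m),
   which explains the factor 2. *)
set a := Lam * V `^ (- m^-1).
have m0 : 0 < m by apply: lt_trans m1.
have a0 : 0 < a by rewrite mulr_gt0 ?powR_gt0.
have e1 : a * V = Lam * V `^ (1 - m^-1).
  rewrite /a -mulrA; congr (_ * _); rewrite -{2}[V]powRr1 ?(ltW V0)// -powRD; last first.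
    by apply/implyP => _; rewrite gt_eqF.
  by congr powR; ring.
have e2 : a `^ (1 - m) * Lam `^ m = Lam * V `^ (1 - m^-1).
  rewrite /a powRM ?powR_ge0 ?(ltW Lam0)// mulrAC -powRD; last by apply/implyP => _; rewrite gt_eqF.
  rewrite subrK powRr1 ?(ltW Lam0)// -powRrM; congr (_ * powR _ _).
  by field; rewrite gt_eqF.
clearbody a.
have er0 : 0 <= (ee / r) ^+ n by rewrite exprn_ge0// divr_ge0 ?expR_ge0// ltW.
have ifm := integrable_f_pow S.
have i1 : mu.-integrable Q (EFin \o (fun z => f z * phi z)).
  exact: (dominated_integrable S (dominated_f m1 S) cK ephi phi0).
have i2 : mu.-integrable Q (EFin \o (fun z => (ee / r) ^+ n * a `^ (1 - m) * `|f z| `^ m)).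
  exact: (integrableZl mQ ((ee / r) ^+ n * a `^ (1 - m)) ifm).
have i3 := iTS ((ee / r) ^+ n * a).
apply: (@le_trans _ _ (Rintegral mu Q (fun z => (ee / r) ^+ n * a `^ (1 - m) * `|f z| `^ m +
    (ee / r) ^+ n * a * \1_TS z))).
  apply: le_Rintegral => //; first exact: (integrableD mQ i2 i3).
  move=> z _; apply: (@le_trans _ _ (`|f z| * ((ee / r) ^+ n * \1_TS z))).
    apply: (@le_trans _ _ (`|f z| * phi z)).
      by rewrite ler_wpM2r ?ler_norm//; exact: tube_phi_ge0.
    by rewrite ler_wpM2l//; exact: tube_phi_le.
  have := norm_le_powR a0 (ltW m1) (normr_ge0 (f z)) => h.
  have am0 : 0 <= a `^ (1 - m) * `|f z| `^ m by rewrite mulr_ge0 ?powR_ge0.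
  rewrite indicE; case: (z \in TS); rewrite /= ?mulr1 ?mulr0; last first.
    by rewrite addr0 -mulrA mulr_ge0.
  by rewrite mulrC -mulrA -mulrDr ler_wpM2l.
rewrite RintegralD// RintegralZl// -/(Rintegral mu Q _).
have h1' : Rintegral mu Q (fun z => `|f z| `^ m) <= Lam `^ m.
  have := sub_f_bound S; rewrite -lee_fin /Rintegral fineK//.
  exact: (integrable_fin_num mQ ifm).
have h2' : Rintegral mu Q (fun z => (ee / r) ^+ n * a * \1_TS z) <= (ee / r) ^+ n * a * V.
  have c0 : 0 <= (ee / r) ^+ n * a by rewrite mulr_ge0// ltW.
  have := Rintegral_indic_scale mQ mTS finTS c0.
  by rewrite lebesgue_tube_support.
apply: le_trans (lerD (ler_wpM2l _ h1') h2') _; first by rewrite mulr_ge0 ?powR_ge0.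
rewrite -!mulrA -mulrDr ler_wpM2l//.
rewrite e1 e2 le_eqVlt; apply/orP; left; apply/eqP; ring.
Qed.

(* The equation is tested with [tube_phi] and the definition of the weak gradient
   with [tube_psi]; by the continuity equation the terms in [u] combine to the
   difference of the two averages, and the terms in [G] are absorbed by
   [|G|^p / Lam] through Young's inequality. *)
Lemma step_inequality :
  Rintegral mu Q (fun z => u z * weight (b0 + h0 + tau) h1 y1 (r * expR lam) z) -
  Rintegral mu Q (fun z => u z * weight b0 h0 y0 r z) <=
  (ee / r) ^+ n * tube_error tau r y0 y1 Lam p L L' * V +
  (ee / r) ^+ n * (2 * Lam * V `^ (1 - m^-1)).
Proof.
rewrite -/w0 -/w1 -RintegralB//.
set c := (ee / r) ^+ n * tube_error tau r y0 y1 Lam p L L'.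
have c0 : 0 <= c.
  rewrite mulr_ge0 ?exprn_ge0 ?divr_ge0 ?expR_ge0 ?(ltW r0)//.
  by rewrite mulr_ge0 ?powR_ge0//; exact: tube_speed_ge0.
have iJB : mu.-integrable Q (EFin \o (fun z => J z - B z)) by exact: (integrableB mQ iJ iB).
apply: (@le_trans _ _ (Rintegral mu Q (fun z => (J z - B z) + c * \1_TS z))).
  apply: ae_le_Rintegral => //.
  - exact: (integrableB mQ iu1 iu0).
  - exact: (integrableD mQ iJB (iTS c)).
  - apply: filterS (sub_A_bound S) => z AL Qz.
    have pw := @tube_pointwise R n b0 h0 tau h1 r lam y0 y1 h00 tau0 h10 r0 lam1
      Lam p L L' Lam0 p2 Lb L'b z (G z) (A z) (AL Qz).
    have ce := tube_continuity_equation b0 h0 tau h1 r lam y0 y1 z.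
    rewrite tube_dcutoff_weight// -/w0 -/w1 in ce.
    have -> : u z * w1 z - u z * w0 z = - (u z * dt phi z) -
        u z * \sum_i 'D_(dirx i) (psi i) z.
      rewrite /dt -[u z * w1 z - _]mulrBr -[w1 z - w0 z]opprB -ce; ring.
    rewrite /B big_split/= -mulr_sumr /J.
    move: pw; rewrite -/c; set S1 := \sum_i G z ord0 i * _; set dd := dot _ _.
    set Gp := Lam^-1 * _ * _; set uD := u z * \sum_i _; set ud := u z * dt _ _.
    by move=> pw; lra.
rewrite (RintegralD mQ iJB (iTS c)) (RintegralB mQ iJ iB) (intB : Rintegral mu Q B = 0) subr0.
have h1' : Rintegral mu Q J <= Rintegral mu Q (fun z => f z * phi z).
  by apply: (sub_ineq S tphi) => z; exact: tube_phi_ge0.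
have h2' : Rintegral mu Q (fun z => c * \1_TS z) <= c * V.
  have := Rintegral_indic_scale mQ mTS finTS c0.
  by rewrite lebesgue_tube_support.
rewrite addrC; apply: lerD => //; exact: le_trans h1' intf.
Qed.

End step_inequality.

(** * The cost of one step in powers of the radius *)

Section step_bound.
Context (R : realType) (n : nat) (Lam p m q kappa L L' : R).
Hypotheses (Lam0 : 0 < Lam) (p2 : 2 < p) (m1 : 1 < m) (q2 : 2 <= q) (qp : q < p).
Hypotheses (qn : n%:R < q * (m - 1)) (kappa1 : 1 <= kappa) (L0 : 0 < L) (L'0 : 0 < L').
Local Notation ee := (expR (1 : R)).

Definition conj_exp : R := p / (p - 1).
(** The powers of r left by the velocity r^(1-q) and by f. They are positive because q < p and n < q
    (m - 1), and positivity makes dyadic errors summable. *)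
Definition chain_exp : R := Num.min ((p - q) / (p - 1)) ((q * (m - 1) - n%:R) / m).

Lemma conj_exp_gt1 : 1 < conj_exp.
Proof. by rewrite /conj_exp ltr_pdivlMr ?mul1r; move: p2; lra. Qed.

Lemma conj_expE : conj_exp = 1 + (p - 1)^-1.
Proof.
have p10 : p - 1 != 0 by apply/eqP; move: p2; lra.
by rewrite /conj_exp; field.
Qed.

Lemma chain_exp_gt0 : 0 < chain_exp.
Proof.
rewrite lt_min; apply/andP; split; rewrite divr_gt0//; move: p2 q2 qp qn m1; lra.
Qed.

Lemma powRD_le (a b c : R) : 0 <= a -> 0 <= b -> 0 <= c ->
  (a + b) `^ c <= 2 `^ c * (a `^ c + b `^ c).
Proof.
move=> a0 b0 c0; wlog ab : a b a0 b0 / a <= b.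
  move=> wl; have [ab|/ltW ba] := leP a b; first exact: wl.
  by rewrite addrC [a `^ c + _]addrC; exact: wl.
apply: (@le_trans _ _ ((2 * b) `^ c)).
  by rewrite ge0_ler_powR ?nnegrE ?addr_ge0// ?mulr_ge0//; lra.
by rewrite powRM// ler_wpM2l ?powR_ge0// lerDr powR_ge0.
Qed.

(** The powers of r in the kernel height and in the support volume cancel up to the duration, of
    order r^q. What remains is r^q W^p' for the gradient and r^(-n) r^((q+n)(1 - 1/m)) for f. *)
Lemma step_bound : exists2 C : R, 0 < C & forall r tau D Delta : R,
  0 < r -> r <= 1 -> r `^ q <= tau -> 0 < D -> D <= kappa * r `^ q -> 0 <= Delta ->
  let W := L / tau * (Delta + ee * r) + 4 * Lam * L' * (ee / r) in
  (ee / r) ^+ n * (W * (Lam * W) `^ (p - 1)^-1) * (D * (2 * (ee * r)) ^+ n) +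
  (ee / r) ^+ n * (2 * Lam * (D * (2 * (ee * r)) ^+ n) `^ (1 - m^-1)) <=
  C * (Delta `^ conj_exp * r `^ (q * (1 - conj_exp)) + r `^ chain_exp).
Proof.
have ee0 : 0 < ee := expR_gt0 _.
have ee1 : 1 <= ee by rewrite -expR0 ler_expR.
have m0 : 0 < m by apply: lt_trans m1.
have pc0 : 0 <= conj_exp by apply: ltW; apply: lt_trans conj_exp_gt1.
have k0 : 0 < kappa by apply: lt_le_trans kappa1.
pose C1 : R := L * ee + 4 * Lam * L' * ee.
have C10 : 0 < C1 by rewrite addr_gt0// !mulr_gt0.
pose K1 : R := kappa * (2 * ee ^+ 2) ^+ n * (Lam `^ (p - 1)^-1 * (C1 `^ conj_exp * 2 `^ conj_exp)).
pose K2 : R := ee ^+ n * (2 * Lam * (kappa * (2 * ee) ^+ n) `^ (1 - m^-1)).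
have K10 : 0 < K1 by rewrite /K1 !mulr_gt0 ?powR_gt0 ?exprn_gt0// mulr_gt0// exprn_gt0.
have K20 : 0 < K2 by rewrite /K2 !mulr_gt0 ?powR_gt0 ?exprn_gt0 ?mulr_gt0// exprn_gt0// mulr_gt0.
exists (K1 + K2); first exact: addr_gt0.
move=> r tau D Delta r0 r1 rtau D0 Dr Delta0 /=.
set W := L / tau * (Delta + ee * r) + _.
have rq0 : 0 < r `^ q by exact: powR_gt0.
have tau0 : 0 < tau by exact: lt_le_trans rtau.
have rn0 x : (r != 0) || x by rewrite gt_eqF.
have rpow x y : r `^ x * r `^ y = r `^ (x + y).
  by rewrite powRD//; apply/implyP => _; rewrite gt_eqF.
have rle x y : y <= x -> r `^ x <= r `^ y.
  by move=> yx; apply: ger_powR => //; rewrite r0 r1.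
(* The velocity in its natural size; 1/r is at most r^(1-q) because q >= 2 and r <= 1. *)
set X := Delta * r `^ (- q) + r `^ (1 - q).
have X0 : 0 <= X by rewrite addr_ge0 ?mulr_ge0 ?powR_ge0.
have W0 : 0 <= W.
  rewrite addr_ge0// ?mulr_ge0 ?addr_ge0 ?invr_ge0 ?(ltW L0) ?(ltW tau0) ?(ltW r0) ?(ltW Lam0) ?(ltW L'0) ?(ltW ee0)//.
  by rewrite mulr_ge0 ?(ltW r0) ?(ltW ee0).
have WX : W <= C1 * X.
  rewrite /C1 mulrDl; apply: lerD.
    apply: (@le_trans _ _ (L * r `^ (- q) * (ee * (Delta + r)))).
      apply: ler_pM.
      - by rewrite divr_ge0// ltW.
      - by rewrite addr_ge0// mulr_ge0// ltW.
      - by rewrite ler_pM2l// powRN lef_pV2.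
      - by rewrite mulrDr lerD2r -[leLHS]mul1r ler_wpM2r.
    rewrite /X (_ : r `^ (1 - q) = r * r `^ (- q)); last first.
      by rewrite -rpow powRr1// ltW.
    by rewrite le_eqVlt; apply/orP; left; apply/eqP; ring.
  rewrite [leLHS]mulrA.
  rewrite ler_wpM2l ?mulr_ge0 ?(ltW ee0) ?(ltW Lam0) ?(ltW L'0)//.
  apply: (@le_trans _ _ (r `^ (1 - q))); last by rewrite lerDr mulr_ge0// powR_ge0.
  by rewrite -powR_inv1 ?(ltW r0)//; apply: rle; move: q2; lra.
have T1 : W * (Lam * W) `^ (p - 1)^-1 <=
    Lam `^ (p - 1)^-1 * (C1 `^ conj_exp * 2 `^ conj_exp) *
    (Delta `^ conj_exp * r `^ (- q * conj_exp) + r `^ ((1 - q) * conj_exp)).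
  have e0 : 0 <= (p - 1)^-1 by rewrite invr_ge0; move: p2; lra.
  apply: (@le_trans _ _ (Lam `^ (p - 1)^-1 * W `^ conj_exp)).
    rewrite powRM ?(ltW Lam0)// mulrCA ler_wpM2l ?powR_ge0// conj_expE.
    rewrite powRD ?powRr1//; apply/implyP => /eqP h.
    by apply/eqP => _; move: e0 h; lra.
  rewrite -!mulrA ler_wpM2l ?powR_ge0//.
  apply: (@le_trans _ _ ((C1 * X) `^ conj_exp)).
    by rewrite ge0_ler_powR ?nnegrE// mulr_ge0// ltW.
  rewrite powRM ?(ltW C10)// ler_wpM2l ?powR_ge0//.
  apply: le_trans (powRD_le _ _ pc0) _; rewrite ?mulr_ge0 ?powR_ge0//.
  by rewrite powRM ?powR_ge0// -!powRrM.
have rn n' : r ^+ n' = r `^ n'%:R by rewrite powR_mulrn// ltW.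
have V1 : (ee / r) ^+ n * (D * (2 * (ee * r)) ^+ n) <= kappa * (2 * ee ^+ 2) ^+ n * r `^ q.
  rewrite (_ : _ * _ = D * (2 * ee ^+ 2) ^+ n); last first.
    rewrite mulrCA -exprMn; congr (_ * _ ^+ n); field; by rewrite gt_eqF.
  by rewrite mulrAC ler_wpM2r// exprn_ge0// mulr_ge0// exprn_ge0// ltW.
apply: (@le_trans _ _ (K1 * (Delta `^ conj_exp * r `^ (q * (1 - conj_exp)) + r `^ chain_exp)
   + K2 * r `^ chain_exp)); last first.
  by rewrite mulrDl lerD2l ler_wpM2l ?(ltW K20)// lerDr mulr_ge0// powR_ge0.
apply: lerD.
  rewrite mulrAC; apply: (@le_trans _ _ (kappa * (2 * ee ^+ 2) ^+ n * r `^ q *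
     (Lam `^ (p - 1)^-1 * (C1 `^ conj_exp * 2 `^ conj_exp) *
    (Delta `^ conj_exp * r `^ (- q * conj_exp) + r `^ ((1 - q) * conj_exp))))).
    apply: ler_pM => //.
      by rewrite !mulr_ge0 ?exprn_ge0 ?divr_ge0 ?mulr_ge0 ?(ltW D0) ?(ltW ee0) ?(ltW r0).
    by rewrite mulr_ge0 ?powR_ge0.
  rewrite (_ : _ * _ = K1 * (Delta `^ conj_exp * (r `^ q * r `^ (- q * conj_exp)) +
     r `^ q * r `^ ((1 - q) * conj_exp))); last by rewrite /K1; ring.
  rewrite ler_wpM2l ?(ltW K10)// !rpow; apply: lerD.
    rewrite ler_wpM2l ?powR_ge0// le_eqVlt; apply/orP; left; apply/eqP; congr powR; ring.
  apply: rle; apply: (@le_trans _ _ ((p - q) / (p - 1))); first by rewrite ge_min lexx.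
  rewrite le_eqVlt; apply/orP; left; apply/eqP; rewrite /conj_exp.
  have p10 : p - 1 != 0 by apply/eqP; move: p2; lra.
  by field.
have mm0 : 0 <= 1 - m^-1 by rewrite subr_ge0 invf_le1// ltW.
have V2 : (D * (2 * (ee * r)) ^+ n) `^ (1 - m^-1) <=
   (kappa * (2 * ee) ^+ n) `^ (1 - m^-1) * r `^ ((q + n%:R) * (1 - m^-1)).
  rewrite [r `^ _]powRrM -powRM ?powR_ge0//; last first.
    by rewrite mulr_ge0 ?exprn_ge0 ?mulr_ge0 ?(ltW k0) ?(ltW ee0).
  rewrite ge0_ler_powR ?nnegrE//.
  - by rewrite mulr_ge0 ?exprn_ge0 ?mulr_ge0 ?(ltW D0) ?(ltW ee0) ?(ltW r0).
  - by rewrite mulr_ge0 ?powR_ge0 ?mulr_ge0 ?exprn_ge0 ?mulr_ge0 ?(ltW k0) ?(ltW ee0).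
  rewrite -rpow -rn [2 * (ee * r)]mulrA [(2 * ee * r) ^+ n]exprMn.
  rewrite (_ : kappa * _ * _ = kappa * r `^ q * ((2 * ee) ^+ n * r ^+ n)); last by ring.
  by rewrite ler_wpM2r// ?mulr_ge0 ?exprn_ge0 ?mulr_ge0 ?(ltW ee0) ?(ltW r0).
apply: (@le_trans _ _ ((ee / r) ^+ n * (2 * Lam * ((kappa * (2 * ee) ^+ n) `^ (1 - m^-1) *
   r `^ ((q + n%:R) * (1 - m^-1)))))).
  rewrite ler_wpM2l ?exprn_ge0 ?divr_ge0 ?(ltW ee0) ?(ltW r0)// ler_wpM2l// mulr_ge0//.
  exact: ltW.
rewrite exprMn exprVn rn -powRN.
rewrite (_ : _ * _ = K2 * (r `^ (- n%:R) * r `^ ((q + n%:R) * (1 - m^-1)))); last by rewrite /K2; ring.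
rewrite ler_wpM2l ?(ltW K20)// rpow; apply: rle.
apply: (@le_trans _ _ ((q * (m - 1) - n%:R) / m)); first by rewrite ge_min lexx orbT.
rewrite le_eqVlt; apply/orP; left; apply/eqP.
by field; rewrite gt_eqF.
Qed.

End step_bound.

(** * Averages at different places and scales *)

Section weight_mass.
Context (R : realType) (n : nat).
Local Notation E := (R * 'rV[R]_n)%type.
Local Notation mu := (lebesgue_st R n).
Implicit Types (b h r : R) (y : 'rV[R]_n).

Lemma weight_ge0 b h y r (z : E) : 0 < h -> 0 < r -> 0 <= weight b h y r z.
Proof.
move=> h0 r0; rewrite /weight mulr_ge0//.
  by rewrite divr_ge0 ?dsmooth_step_ge0// ltW.
by rewrite mulr_ge0// ?exprn_ge0 ?profile_ge0// invr_ge0 ltW.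
Qed.

Lemma weight_cell b h y r (z : E) : 0 < h -> 0 < r -> weight b h y r z != 0 ->
  cell b h y r z.
Proof.
move=> h0 r0 /(weight_support h0 r0)[/andP[t1 t2] x1]; split; first by rewrite ltW.
move=> i; have := le_lt_trans (coord_le_enorm (z.2 - y) i) x1.
by rewrite !mxE ltr_norml => /andP[x2 x3]; apply/andP; split; [apply: ltW|]; lra.
Qed.

Lemma weight_le L b h y r (z : E) : 0 < h -> 0 < r ->
  (forall t : R, dsmooth_step t <= L) ->
  weight b h y r z <= L * (h * r ^+ n)^-1 * \1_(cell b h y r) z.
Proof.
move=> h0 r0 Lb; rewrite indicE; case: (boolP (z \in _)) => zc; last first.
  rewrite mulr0 le_eqVlt; apply/orP; left; apply: contraNT zc => nz.
  by rewrite inE; exact: weight_cell.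
have rn0 : 0 < r ^+ n by exact: exprn_gt0.
rewrite mulr1 /weight invfM exprVn [leRHS]mulrA; apply: ler_pM.
- by rewrite divr_ge0 ?dsmooth_step_ge0// ltW.
- by rewrite mulr_ge0 ?exprn_ge0 ?profile_ge0// invr_ge0 ltW.
- by rewrite ler_pM2r ?invr_gt0.
- rewrite -[leRHS]mulr1 ler_wpM2l ?invr_ge0 ?(ltW rn0)//.
  by rewrite exprn_ile1 ?profile_ge0 ?profile_le1.
Qed.

Lemma weight_affine b h y r (z : E) : 0 < h -> 0 < r ->
  weight b h y r (st_affine b h y r z) = (h * r ^+ n)^-1 * weight 0 1 0 1 z.
Proof.
move=> h0 r0; have hn : h != 0 by rewrite gt_eqF.
have rn : r != 0 by rewrite gt_eqF.
rewrite /weight /st_affine/= invr1 !expr1n !mulr1 mul1r.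
rewrite (_ : (b + h * z.1 - b) / h = z.1 - 0 :> R); last by field.
rewrite (_ : (\sum_i _) * _ = \sum_i (z.2 ord0 i - (0 : 'rV[R]_n) ord0 i) ^+ 2); last first.
  by rewrite mulr_suml; apply: eq_bigr => i _; rewrite !mxE; field.
by rewrite invfM exprVn; ring.
Qed.

Lemma measurable_weight b h y r : measurable_fun [set: E] (weight b h y r).
Proof. by apply: elementary_measurable; exact: elementary_weight. Qed.

Definition weight_mass : R := Rintegral mu setT (weight 0 1 0 1).

Lemma integrable_weight b h y r Q : measurable Q -> 0 < h -> 0 < r ->
  mu.-integrable Q (EFin \o weight b h y r).
Proof.
move=> mQ h0 r0; have [L L0 Lb] := dsmooth_step_bound R.
apply: (@integrable_bounded_support _ _ _ mu Q (cell b h y r) _ (L * (h * r ^+ n)^-1)) => //.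
- exact: measurable_cell.
- by rewrite lebesgue_cell// ltry.
- by apply: measurable_funTS; exact: measurable_weight.
- by move=> z; rewrite ger0_norm ?weight_ge0//; exact: weight_le.
Qed.

(** The affine change of variables maps every weight to the one with b = 0, h = 1, y = 0, r = 1, the
    Jacobian cancelling the normalization. *)
Lemma Rintegral_weight b h y r Q : measurable Q -> 0 < h -> 0 < r ->
  cell b h y r `<=` Q -> Rintegral mu Q (weight b h y r) = weight_mass.
Proof.
move=> mQ h0 r0 cQ; rewrite /weight_mass /Rintegral; congr fine.
have c0 : 0 < h * r ^+ n by rewrite mulr_gt0// exprn_gt0.
transitivity (\int[mu]_z (weight b h y r z)%:E)%E.
  rewrite integral_mkcond; apply: eq_integral => z _; rewrite patchE.
  case: ifPn => //; rewrite notin_setE => zQ; congr EFin; apply/esym/eqP.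
  by apply: contra_notT zQ => /(weight_cell h0 r0)/cQ.
have mF := measurable_st_affine b h y r.
have mw : measurable_fun [set: E] (EFin \o weight b h y r).
  by apply/measurable_EFinP; exact: measurable_weight.
pose m2 : {measure set E -> \bar R} := mscale (NngNum (ltW c0)) (pushforward mu (st_affine b h y r)).
rewrite [LHS](@eq_measure_integral _ _ _ setT (m2 mF)); last first.
  by move=> B mB _; rewrite (lebesgue_st_affine b y h0 r0 mB).
rewrite ge0_integral_mscale//; last by move=> z _; rewrite lee_fin weight_ge0.
rewrite ge0_integral_pushforward//; last by move=> z _; rewrite lee_fin weight_ge0.
rewrite preimage_setT -ge0_integralZl//.
- apply: eq_integral => z _ /=; rewrite weight_affine// -EFinM; congr EFin.
  by rewrite mulrA divff ?mul1r// gt_eqF.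
- by apply: measurableT_comp.
- by move=> z _; rewrite lee_fin weight_ge0.
Qed.

Lemma weight_mass_gt0 : 0 < weight_mass.
Proof.
pose z0 : E := (2^-1, 0).
have w0 : 0 < weight 0 1 0 1 z0.
  rewrite /weight mulr_gt0//.
    by rewrite divr1 dsmooth_step_gt0//= subr0 divr1; apply/andP; split; lra.
  rewrite mulr_gt0 ?exprn_gt0 ?invr_gt0// profile_gt0// big1 ?mul0r//.
  by move=> i _; rewrite !mxE subrr expr0n.
set c := weight 0 1 0 1 z0 / 2.
have c0 : 0 < c by rewrite divr_gt0.
have cw : {for z0, continuous (weight 0 1 (0 : 'rV[R]_n) 1)}.
  by apply: elementary_continuous; exact: elementary_weight.
have : \forall z \near z0, c < weight 0 1 0 1 z.
  have : c < weight 0 1 0 1 z0 by rewrite /c; move: w0; lra.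
  by move=> cl; exact: (cvgr_gt _ cw).
move=> /nbhs_ballP[e /= e0 be].
have mB : measurable (ball z0 e : set E) by exact: measurable_stball.
have fB : (mu (ball z0 e : set E) < +oo)%E.
  rewrite ball_box// (@lebesgue_st_box R n (ball z0.1 e) (fun i => ball (z0.2 ord0 i) e))//.
  - rewrite lebesgue_measure_ball ?ltW//.
    under eq_bigr do rewrite lebesgue_measure_ball ?ltW//.
    by rewrite prodEFin -EFinM ltry.
  - exact: measurable_ball.
  - by move=> i; exact: measurable_ball.
have iB := integrableZl measurableT c (integrable_indic_finite mB fB).
apply: (@lt_le_trans _ _ (Rintegral mu setT (fun z => c * \1_(ball z0 e) z))).
  rewrite RintegralZl//; last exact: integrable_indic_finite.
  rewrite mulr_gt0// /Rintegral integral_indic// setIT fine_gt0//.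
  by rewrite fB andbT; exact: stball_gt0.
apply: le_Rintegral => //; first exact: integrable_weight.
move=> z _; rewrite indicE; case: (boolP (z \in _)) => zb.
  by rewrite mulr1 ltW//; apply: be; exact: set_mem.
by rewrite mulr0 weight_ge0.
Qed.

Lemma integrable_mul_weight (Q : set E) (u : E -> R) (U b h r : R) y :
  measurable Q -> measurable_fun Q u -> {ae mu, forall z, Q z -> `|u z| <= U} ->
  0 < h -> 0 < r -> mu.-integrable Q (EFin \o (fun z => u z * weight b h y r z)).
Proof.
move=> mQ mu_ uU h0 r0; have iw := @integrable_weight b h y r Q mQ h0 r0.
apply: (@ae_le_integrable _ _ _ mu Q _ (fun z => U * weight b h y r z)) => //.
- by apply: measurable_funM => //; apply: measurable_funTS; exact: measurable_weight.
- exact: (integrableZl mQ U iw).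
- apply: filterS uU => z uz Qz; rewrite normrM [`|weight _ _ _ _ _|]ger0_norm ?weight_ge0//.
  by rewrite ler_wpM2r ?weight_ge0// uz.
Qed.

(** Off [B] the excess u - a is at most U + |a|, the weight at most L / (h r^n), and the measure at
    most e h (2 r)^n. The factors h r^n cancel, so the error does not depend on the size of the
    cell. *)
Lemma average_le (Q B : set E) (u : E -> R) (U a e L b h : R) y r :
  measurable Q -> measurable B -> measurable_fun Q u -> 0 <= U -> 0 <= e ->
  {ae mu, forall z, Q z -> `|u z| <= U} ->
  (forall z, Q z -> B z -> u z <= a) ->
  0 < h -> 0 < r -> (forall t : R, dsmooth_step t <= L) ->
  cell b h y r `<=` Q ->
  (mu (cell b h y r `\` B) <= e%:E * mu (cell b h y r))%E ->
  Rintegral mu Q (fun z => u z * weight b h y r z) <=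
    a * weight_mass + (U + `|a|) * (L * 2 ^+ n) * e.
Proof.
move=> mQ mB mu_ U0 e0 uU uB h0 r0 Lb cQ.
set C := cell b h y r => CB.
have mC : measurable C by exact: measurable_cell.
have mCB : measurable (C `\` B) by exact: measurableD.
have Cv : mu C = (h * (2 * r) ^+ n)%:E by exact: lebesgue_cell.
have hr0 : 0 < h * r ^+ n by rewrite mulr_gt0// exprn_gt0.
have fCB : (mu (C `\` B) < +oo)%E by apply: le_lt_trans CB _; rewrite Cv -EFinM ltry.
have L0 : 0 <= L by apply: le_trans (Lb 0); exact: dsmooth_step_ge0.
have iw := @integrable_weight b h y r Q mQ h0 r0.
set k := (U + `|a|) * (L * (h * r ^+ n)^-1).
have k0 : 0 <= k.
  by rewrite mulr_ge0 ?addr_ge0// mulr_ge0// invr_ge0 ltW.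
have iuw := integrable_mul_weight b y mQ mu_ uU h0 r0.
have i1 : mu.-integrable Q (EFin \o (fun z => a * weight b h y r z)).
  exact: (integrableZl mQ a iw).
have i2 : mu.-integrable Q (EFin \o (fun z => k * \1_(C `\` B) z)).
  exact: (integrableZl mQ k (integrableS measurableT mQ (@subsetT _ _)
    (integrable_indic_finite mCB fCB))).
apply: (@le_trans _ _ (Rintegral mu Q (fun z => a * weight b h y r z + k * \1_(C `\` B) z))).
  apply: ae_le_Rintegral => //; first exact: (integrableD mQ i1 i2).
  apply: filterS uU => z uz Qz.
  have [->|nz] := eqVneq (weight b h y r z) 0.
    by rewrite !mulr0 add0r mulr_ge0.
  have Cz : C z by exact: weight_cell.
  have w0 := @weight_ge0 b h y r z h0 r0.
  have [Bz|nBz] := pselect (B z).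
    apply: (@le_trans _ _ (a * weight b h y r z)); first by rewrite ler_wpM2r// uB.
    by rewrite lerDl mulr_ge0.
  have -> : \1_(C `\` B) z = 1 :> R by rewrite indicE mem_set.
  rewrite mulr1 -lerBlDl -mulrBl.
  have := weight_le b y z h0 r0 Lb; rewrite -/C indicE mem_set// mulr1 => wl.
  apply: (@le_trans _ _ ((U + `|a|) * weight b h y r z)); last by rewrite ler_wpM2l ?addr_ge0.
  rewrite ler_wpM2r// lerD//; first exact: le_trans (ler_norm _) (uz Qz).
  by rewrite -normrN ler_norm.
rewrite RintegralD// RintegralZl// Rintegral_weight// lerD2l.
apply: le_trans (Rintegral_indic_scale mQ mCB fCB k0) _.
rewrite -/C Cv -EFinM in CB.
have {}CB : fine (mu (C `\` B)) <= e * (h * (2 * r) ^+ n).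
  by rewrite -lee_fin fineK// ge0_fin_numE.
apply: le_trans (ler_wpM2l k0 CB) _.
rewrite le_eqVlt; apply/orP; left; apply/eqP; rewrite /k exprMn.
have := gt_eqF h0; have := gt_eqF (exprn_gt0 n r0).
by move=> /negbT rn /negbT hn; field; rewrite rn hn.
Qed.

Lemma average_ge (Q B : set E) (u : E -> R) (U a e L b h : R) y r :
  measurable Q -> measurable B -> measurable_fun Q u -> 0 <= U -> 0 <= e ->
  {ae mu, forall z, Q z -> `|u z| <= U} ->
  (forall z, Q z -> B z -> a <= u z) ->
  0 < h -> 0 < r -> (forall t : R, dsmooth_step t <= L) ->
  cell b h y r `<=` Q ->
  (mu (cell b h y r `\` B) <= e%:E * mu (cell b h y r))%E ->
  a * weight_mass - (U + `|a|) * (L * 2 ^+ n) * e <=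
    Rintegral mu Q (fun z => u z * weight b h y r z).
Proof.
move=> mQ mB mu_ U0 e0 uU uB h0 r0 Lb cQ CB.
have mNu : measurable_fun Q (fun z => - u z) by apply: measurableT_comp.
have NuU : {ae mu, forall z, Q z -> `|- u z| <= U}.
  by apply: filterS uU => z uz Qz; rewrite normrN; exact: uz.
have NuB z : Q z -> B z -> - u z <= - a by move=> Qz Bz; rewrite lerN2; exact: uB.
have := average_le mQ mB mNu U0 e0 NuU NuB h0 r0 Lb cQ CB.
rewrite normrN (_ : Rintegral _ _ _ = - Rintegral mu Q (fun z => u z * weight b h y r z)).
  by rewrite mulNr; lra.
rewrite -mulN1r -RintegralZl//; last exact: integrable_mul_weight uU h0 r0.
by congr Rintegral; apply/funext => z; rewrite mulN1r mulNr.
Qed.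

End weight_mass.

Section averages.
Context (R : realType) (n : nat).
Local Notation E := (R * 'rV[R]_n)%type.
Local Notation mu := (lebesgue_st R n).
Local Notation ee := (expR (1 : R)).

(** The duration of the window is tied to the radius as r^q, the scaling under which the errors are
    summable. *)
Definition avg (T : R) (Omega : set 'rV[R]_n) (q : R) (u : E -> R) (b : R)
    (y : 'rV[R]_n) (r : R) : R :=
  Rintegral mu (`]0, T[ `*` Omega) (fun z => u z * weight b (r `^ q) y r z).

Context (Lam p m q : R).
Hypotheses (Lam0 : 0 < Lam) (p2 : 2 < p) (m1 : 1 < m) (q2 : 2 <= q) (qp : q < p).
Hypothesis (qn : n%:R < q * (m - 1)).

Lemma avg_step : exists2 C : R, 0 < C &
  forall U T Omega f A u G, subsolution Lam p m U T Omega f A u G ->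
  forall (b r tau lam : R) (y0 y1 : 'rV[R]_n),
  `|lam| <= 1 -> 0 < r -> r <= 1 -> r `^ q <= tau -> tau <= 64 * r `^ q -> 0 < b ->
  expR lam <= 2 -> b + r `^ q + tau + (r * expR lam) `^ q < T ->
  (forall x, enorm (x - y0) <= enorm (y1 - y0) + ee * r -> Omega x) ->
  avg T Omega q u (b + r `^ q + tau) y1 (r * expR lam) <= avg T Omega q u b y0 r +
  C * (enorm (y1 - y0) `^ conj_exp p * r `^ (q * (1 - conj_exp p)) + r `^ chain_exp n p m q).
Proof.
have [L L0 Lb] := dsmooth_step_bound R.
have [L' L'0 L'b] := dprofile_bound R.
(* The total duration is at most r^q + 64 r^q + (2 r)^q: initial window, transport, final window. *)
have k1 : 1 <= 65 + 2 `^ q by have := powR_ge0 2 q; lra.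
have [C C0 HC] := step_bound n Lam0 p2 m1 q2 k1 L0 L'0.
exists C => // U T Omega f A u G S b r tau lam y0 y1 lam1 r0 r1 rtau taur b0 lam2 bT BO.
have rq0 : 0 < r `^ q by exact: powR_gt0.
have tau0 : 0 < tau by exact: lt_le_trans rtau.
have r'0 : 0 < r * expR lam by rewrite mulr_gt0 ?expR_gt0.
have h10 : 0 < (r * expR lam) `^ q by exact: powR_gt0.
have h1 : (r * expR lam) `^ q <= 2 `^ q * r `^ q.
  rewrite -powRM ?(ltW r0)// ge0_ler_powR ?nnegrE ?mulr_ge0 ?expR_ge0 ?(ltW r0)//.
    by move: q2; lra.
  by rewrite mulrC ler_pM2r.
rewrite -lerBlDl.
apply: le_trans (step_inequality Lam0 p2 m1 S rq0 tau0 h10 r0 lam1 Lb L'b b0 bT BO) _.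
apply: (HC r tau (r `^ q + tau + (r * expR lam) `^ q)) => //; rewrite ?enorm_ge0//.
- by rewrite !addr_gt0.
- by rewrite mulrDl; move: h1 taur; lra.
Qed.

Context (T : R) (Omega : set 'rV[R]_n) (u : E -> R) (C : R).
Hypothesis (C0 : 0 < C).
Hypothesis step : forall (b r tau lam : R) (y0 y1 : 'rV[R]_n),
  `|lam| <= 1 -> 0 < r -> r <= 1 -> r `^ q <= tau -> tau <= 64 * r `^ q -> 0 < b ->
  expR lam <= 2 -> b + r `^ q + tau + (r * expR lam) `^ q < T ->
  (forall x, enorm (x - y0) <= enorm (y1 - y0) + ee * r -> Omega x) ->
  avg T Omega q u (b + r `^ q + tau) y1 (r * expR lam) <= avg T Omega q u b y0 r +
  C * (enorm (y1 - y0) `^ conj_exp p * r `^ (q * (1 - conj_exp p)) + r `^ chain_exp n p m q).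
Local Notation av := (avg T Omega q u).
Local Notation al := (chain_exp n p m q).

(** The sum of the geometric series of errors. Since C r^al = C' (r^al - (r/2)^al), the errors of a
    dyadic chain telescope. *)
Let C' : R := C / (1 - 2^-1 `^ al).

Let al0 : 0 < al.
Proof. exact: chain_exp_gt0. Qed.

Let half_al : 2^-1 `^ al < 1 :> R.
Proof.
have := @gt0_ltr_powR R al al0 2^-1 1; rewrite powR1; apply; rewrite ?nnegrE ?invr_ge0//.
by rewrite invf_lt1// ltr1n.
Qed.

Let C'_gt0 : 0 < C'.
Proof. by rewrite divr_gt0// subr_gt0 half_al. Qed.

Let ln2_le1 : ln (2 : R) <= 1.
Proof. by rewrite -ler_expR lnK ?posrE//; apply: le_trans (expR_ge1Dx _); lra. Qed.

Let ln2_ge0 : 0 <= ln (2 : R).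
Proof. by rewrite ln_ge0// ler1n. Qed.

Let step_const (b r tau lam : R) (y : 'rV[R]_n) :
  `|lam| <= 1 -> 0 < r -> r <= 1 -> r `^ q <= tau -> tau <= 64 * r `^ q -> 0 < b ->
  expR lam <= 2 -> b + r `^ q + tau + (r * expR lam) `^ q < T ->
  (forall x, enorm (x - y) <= ee * r -> Omega x) ->
  av (b + r `^ q + tau) y (r * expR lam) <= av b y r + C * r `^ al.
Proof.
move=> lam1 r0 r1 t1 t2 b0 l2 bT BO.
have y0 : enorm (y - y) = 0 by rewrite subrr enorm0.
have := @step b r tau lam y y lam1 r0 r1 t1 t2 b0 l2 bT; rewrite y0 powR0; last first.
  by rewrite gt_eqF//; apply: lt_trans (conj_exp_gt1 p2).
rewrite mul0r !add0r => h.
by apply: h.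
Qed.

Let pow_half (r : R) : 0 < r -> r `^ al <= C' / C * (r `^ al - (r / 2) `^ al).
Proof.
move=> r0; rewrite powRM ?(ltW r0)//.
rewrite (_ : C' / C * _ = r `^ al)// /C'.
field.
by rewrite !gt_eqF ?subr_gt0.
Qed.

Let quarter (r : R) : 0 < r -> 4 * (r / 2) `^ q <= r `^ q.
Proof.
move=> r0; have -> : r `^ q = (r / 2) `^ q * 2 `^ q.
  by rewrite -powRM ?divfK// divr_ge0// ltW.
rewrite mulrC ler_wpM2l ?powR_ge0//.
rewrite (_ : 4 = 2 `^ 2%:R :> R); last by rewrite powR_mulrn// -natrX.
by apply: ler_powR => //; rewrite ler1n.
Qed.

Let radius_bound (r : R) (j : nat) : 0 < r -> 0 < r * 2^-1 ^+ j <= r.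
Proof.
move=> r0; rewrite mulr_gt0 ?exprn_gt0 ?invr_gt0//= -[leRHS]mulr1 ler_pM2l//.
by rewrite exprn_ile1// invf_le1// ler1n.
Qed.

Let pow_le (r r' : R) : 0 < r -> r <= r' -> r `^ q <= r' `^ q.
Proof.
move=> r0 rr'; apply: ge0_ler_powR; rewrite ?nnegrE//; first by move: q2; lra.
- exact: ltW.
- by apply: le_trans rr'; exact: ltW.
Qed.

(* Along dyadic radii the error [s^al] of one step is summable, so passing from
   radius [r 2^-j] to [r] costs only a multiple of [r^al], whatever [j] is. *)
Lemma chain_up (r b : R) (y : 'rV[R]_n) (j : nat) : 0 < r -> r <= 1 ->
  (forall x, enorm (x - y) <= ee * r -> Omega x) -> 0 < b ->
  b + 4 * (r `^ q - (r * 2^-1 ^+ j) `^ q) + r `^ q < T ->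
  exists b' : R, b <= b' <= b + 4 * (r `^ q - (r * 2^-1 ^+ j) `^ q) /\
    av b' y r <= av b y (r * 2^-1 ^+ j) + C' * (r `^ al - (r * 2^-1 ^+ j) `^ al).
Proof.
(* Linear facts on times, where x, S, Q stand for (s/2)^q, s^q, r^q. As q >= 2 gives 4 x <= S, the
   duration 2 x of one doubling is below 4 (S - x), so the durations telescope too. *)
have a1 (c x : R) : 0 < x -> 0 < c -> 0 < c + x + x by lra.
have a2 (c x S Q : R) : 0 < x -> 4 * x <= S -> c + 4 * (Q - x) + Q < T ->
  c + x + x + 4 * (Q - S) + Q < T by lra.
have a3 (c c' x S Q : R) : 0 < x -> 4 * x <= S -> c + x + x <= c' <= c + x + x + 4 * (Q - S) ->
  c <= c' <= c + 4 * (Q - x).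
  by move=> ? ? /andP[? ?]; apply/andP; split; lra.
have a4 (c x S Q : R) : 0 < x -> 4 * x <= S -> S <= Q -> c + 4 * (Q - x) + Q < T ->
  c + x + x + S < T by lra.
have a5 (x : R) : 0 < x -> x <= 64 * x by lra.
have a6 (X Y Z c d e : R) : X <= Y + c -> c <= C' * (d - e) ->
  X + C' * (Z - d) <= Y + C' * (Z - e) by rewrite !mulrBr; lra.
move=> r0 r1 BO; elim: j b => [|j IH] b b0.
  rewrite expr0 mulr1 !subrr !mulr0 !addr0 => bT; exists b; split; first by rewrite lexx.
  by [].
have /andP[] := radius_bound j.+1 r0; have /andP[] := radius_bound j r0.
have rE : r * 2^-1 ^+ j.+1 = r * 2^-1 ^+ j / 2 by rewrite exprSr mulrA.
set s := r * 2^-1 ^+ j; rewrite -/s in rE IH; rewrite rE => s0 sr s20 s2r.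
clearbody s.
have qs := quarter s0; have ps := pow_half s0.
have sq := pow_le s0 sr; have sq0 : 0 < (s / 2) `^ q by exact: powR_gt0.
move=> bT; have s2 : s / 2 * expR (ln 2) = s by rewrite lnK ?posrE// divfK.
have l1 : `|ln (2 : R)| <= 1 by rewrite ger0_norm.
have := @step_const b (s / 2) ((s / 2) `^ q) (ln 2) y l1 s20 _ _ _ b0.
rewrite s2 lnK ?posrE// => st.
have [b' [bb' avb]] := IH _ (a1 _ _ sq0 b0) (a2 _ _ _ _ sq0 qs bT).
exists b'; split; first exact: a3 bb'.
apply: le_trans avb _.
have : av (b + (s / 2) `^ q + (s / 2) `^ q) y s <= av b y (s / 2) + C * (s / 2) `^ al.
  apply: st => //.
  - by apply: le_trans r1.
  - exact: a5.
  - exact: a4 bT.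
  - move=> x xs; apply: BO; apply: le_trans xs _; rewrite ler_pM2l ?expR_gt0//.
move=> h; apply: a6 h _.
apply: (@le_trans _ _ (C * (C' / C * (s `^ al - (s / 2) `^ al)))).
  rewrite ler_pM2l//; apply: le_trans ps.
  rewrite ge0_ler_powR ?nnegrE ?(ltW al0) ?(ltW s20) ?(ltW s0)//.
  by rewrite ler_pdivrMr// ler_peMr ?ler1n// ltW.
by rewrite mulrA [C * _]mulrC divfK// gt_eqF.
Qed.

(** Counterpart of [chain_up] with halving radii, built backwards from the final time [b]. The upper
    bound on [b'] keeps the large window of duration r^q, which starts at [b'], before T. *)
Lemma chain_down (r b : R) (y : 'rV[R]_n) (j : nat) : 0 < r -> r <= 1 ->
  (forall x, enorm (x - y) <= ee * r -> Omega x) ->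
  0 < b - 4 * (r `^ q - (r * 2^-1 ^+ j) `^ q) ->
  b + (r * 2^-1 ^+ j) `^ q < T ->
  exists b' : R, b - 4 * (r `^ q - (r * 2^-1 ^+ j) `^ q) <= b' <= b - (r `^ q - (r * 2^-1 ^+ j) `^ q) /\
    av b y (r * 2^-1 ^+ j) <= av b' y r + C' * (r `^ al - (r * 2^-1 ^+ j) `^ al).
Proof.
have a1 (c x S Q : R) : 0 < x -> 4 * x <= S -> 0 < c - 4 * (Q - x) ->
  0 < c - 2 * S - 4 * (Q - S) by lra.
have a2 (c x S : R) : 0 < x -> 4 * x <= S -> c + x < T -> c - 2 * S + S < T by lra.
have a3 (c c' x S Q : R) : 0 < x -> 4 * x <= S -> c - 2 * S - 4 * (Q - S) <= c' <= c - 2 * S - (Q - S) ->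
  c - 4 * (Q - x) <= c' <= c - (Q - x).
  by move=> ? ? /andP[? ?]; apply/andP; split; lra.
have a4 (c x S Q : R) : 0 < x -> 4 * x <= S -> S <= Q -> 0 < c - 4 * (Q - x) ->
  0 < c - 2 * S by lra.
have a5 (x S : R) : 0 < x -> 4 * x <= S -> S <= 64 * S by lra.
have a6 (X Y Z c d e : R) : Y <= X + C' * (Z - d) -> c <= C' * (d - e) ->
  Y + c <= X + C' * (Z - e) by rewrite !mulrBr; lra.
move=> r0 r1 BO; elim: j b => [|j IH] b.
  rewrite expr0 mulr1 !subrr !mulr0 !subr0 => b0 bT; exists b; split; first by rewrite lexx.
  by rewrite addr0.
have /andP[] := radius_bound j.+1 r0; have /andP[] := radius_bound j r0.
have rE : r * 2^-1 ^+ j.+1 = r * 2^-1 ^+ j / 2 by rewrite exprSr mulrA.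
set s := r * 2^-1 ^+ j; rewrite -/s in rE IH; rewrite rE => s0 sr s20 s2r.
clearbody s.
have qs := quarter s0; have ps := pow_half s0.
have sq := pow_le s0 sr; have sq0 : 0 < (s / 2) `^ q by exact: powR_gt0.
move=> b0 bT; have s2 : s * expR (- ln 2) = s / 2 by rewrite expRN lnK ?posrE.
have l1 : `|- ln (2 : R)| <= 1 by rewrite normrN ger0_norm.
have [b' [bb' avb]] := IH _ (a1 _ _ _ _ sq0 qs b0) (a2 _ _ _ sq0 qs bT).
exists b'; split; first exact: a3 bb'.
have := @step_const (b - 2 * s `^ q) s (s `^ q) (- ln 2) y l1 s0 _ _ _ _.
rewrite s2 (_ : b - 2 * s `^ q + s `^ q + s `^ q = b); last by ring.
move=> st; have : av b y (s / 2) <= av (b - 2 * s `^ q) y s + C * s `^ al.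
  apply: st => //.
  - by apply: le_trans r1.
  - exact: a5 qs.
  - exact: a4 b0.
  - by rewrite expRN lnK ?posrE// (@le_trans _ _ 1) ?invf_le1 ?ler1n.
  - move=> x xs; apply: BO; apply: le_trans xs _; rewrite ler_pM2l ?expR_gt0//.
move=> h; apply: le_trans h _; apply: a6 avb _.
apply: (@le_trans _ _ (C * (C' / C * (s `^ al - (s / 2) `^ al)))).
  by rewrite ler_pM2l.
by rewrite mulrA [C * _]mulrC divfK// gt_eqF.
Qed.

(** A single step at constant radius, the only one that moves the centre. The kernel travels during
    the time left after the initial window, b' - b - r^q. *)
Lemma chain_middle (r b b' D : R) (y y' : 'rV[R]_n) : 0 < r -> r <= 1 ->
  2 * r `^ q <= b' - b -> b' - b <= 65 * r `^ q -> 0 < b -> b' + r `^ q < T ->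
  enorm (y' - y) <= D -> (forall x, enorm (x - y) <= D + ee * r -> Omega x) ->
  av b' y' r <= av b y r + C * (D `^ conj_exp p * r `^ (q * (1 - conj_exp p)) + r `^ al).
Proof.
have a1 (c c' Q : R) : 2 * Q <= c' - c -> Q <= c' - c - Q by lra.
have a2 (c c' Q : R) : 0 < Q -> c' - c <= 65 * Q -> c' - c - Q <= 64 * Q by lra.
move=> r0 r1 bb bb' b0 bT yD BO.
have rq0 : 0 < r `^ q by exact: powR_gt0.
have l0 : `|(0 : R)| <= 1 by rewrite normr0.
have := @step b r (b' - b - r `^ q) 0 y y' l0 r0 r1 _ _ b0.
rewrite expR0 mulr1 (_ : b + r `^ q + _ = b'); last by ring.
move=> st; apply: (le_trans (st _ _ _ _ _)).
- exact: a1.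
- exact: a2.
- exact: ler1n.
- by [].
- by move=> x /le_trans xs; apply: BO; apply: xs; rewrite lerD2r.
rewrite lerD2l ler_pM2l// lerD2r ler_wpM2r ?powR_ge0//.
rewrite ge0_ler_powR ?nnegrE ?enorm_ge0//; last by apply: le_trans yD; exact: enorm_ge0.
by apply: ltW; apply: lt_trans (conj_exp_gt1 p2).
Qed.

(** Enlarge the radius at [y0], move, then shrink it at [y1]. Enlarging and shrinking take at most 4
    r^q each, and the move needs at least 2 r^q, whence 10; the largest travel time 64 r^q plus one
    window gives 65. *)
Lemma chain (r b0 b1 D : R) (y0 y1 : 'rV[R]_n) (i j : nat) : 0 < r -> r <= 1 ->
  10 * r `^ q <= b1 - b0 -> b1 - b0 <= 65 * r `^ q -> 0 < b0 ->
  b1 + (r * 2^-1 ^+ j) `^ q < T ->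
  enorm (y1 - y0) <= D -> (forall x, enorm (x - y0) <= D + ee * r -> Omega x) ->
  av b1 y1 (r * 2^-1 ^+ j) <= av b0 y0 (r * 2^-1 ^+ i) +
   (C + 2 * C') * (D `^ conj_exp p * r `^ (q * (1 - conj_exp p)) + r `^ al).
Proof.
have a1 (c c' x x' Q : R) : 0 < x -> 0 < x' -> 0 < Q -> 10 * Q <= c' - c -> c' + x' < T ->
  c + 4 * (Q - x) + Q < T by lra.
have a2 (c c' x Q : R) : 0 < x -> 0 < Q -> 10 * Q <= c' - c -> 0 < c -> 0 < c' - 4 * (Q - x) by lra.
have a3 (c c' d d' x x' Q : R) : 0 < x -> 0 < x' -> 10 * Q <= c' - c ->
  d <= c + 4 * (Q - x) -> c' - 4 * (Q - x') <= d' -> 2 * Q <= d' - d by lra.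
have a4 (c c' d d' x Q : R) : x <= Q -> c' - c <= 65 * Q ->
  c <= d -> d' <= c' - (Q - x) -> d' - d <= 65 * Q by lra.
have a6 (X Y W c c' Z : R) : X <= Y + C * Z -> Y <= W + c -> c <= C' * Z -> c' <= C' * Z ->
  X + c' <= W + (C + 2 * C') * Z by rewrite !mulrDl; lra.
have a5 (c d x Q : R) : d <= c - (Q - x) -> c + x < T -> d + Q < T by lra.
move=> r0 r1 bb bb' b00 bT yD BO.
have rq0 : 0 < r `^ q by exact: powR_gt0.
have D0 : 0 <= D by apply: le_trans yD; exact: enorm_ge0.
have ri k : 0 < (r * 2^-1 ^+ k) `^ q <= r `^ q.
  by have /andP[k1 k2] := radius_bound k r0; rewrite powR_gt0//= pow_le.
have /andP[ri0 rir] := ri i; have /andP[rj0 rjr] := ri j.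
have BO0 x : enorm (x - y0) <= ee * r -> Omega x.
  by move=> /le_trans xs; apply: BO; apply: xs; rewrite lerDr.
have BO1 x : enorm (x - y1) <= ee * r -> Omega x.
  move=> xs; apply: BO; apply: le_trans (enorm_distD _ y1 _) _.
  by rewrite addrC lerD.
have [|b0' [/andP[u1 u2] up]] := chain_up (j := i) r0 r1 BO0 b00.
  exact: a1 bb bT.
have [| |b1' [/andP[d1 d2] dn]] := chain_down (j := j) (b := b1) r0 r1 BO1.
- exact: a2 bb b00.
- by [].
apply: le_trans dn _.
have mid : av b1' y1 r <= av b0' y0 r +
    C * (D `^ conj_exp p * r `^ (q * (1 - conj_exp p)) + r `^ al).
  apply: chain_middle => //.
  - exact: a3 bb u2 d1.
  - exact: a4 bb' u1 d2.
  - exact: lt_le_trans u1.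
  - exact: a5 d2 bT.
have C0' := ltW C'_gt0.
have X0 : 0 <= D `^ conj_exp p * r `^ (q * (1 - conj_exp p)) by rewrite mulr_ge0 ?powR_ge0.
have k1 k : C' * (r `^ al - (r * 2^-1 ^+ k) `^ al) <=
    C' * (D `^ conj_exp p * r `^ (q * (1 - conj_exp p)) + r `^ al).
  rewrite ler_wpM2l// (@le_trans _ _ (r `^ al))//; first by rewrite lerBlDr lerDl powR_ge0.
  by rewrite lerDr.
exact: a6 mid up (k1 i) (k1 j).
Qed.
End averages.

(** * From averages to values at density points *)

Section subsolution_gap.
Context (R : realType) (n : nat).
Local Notation E := (R * 'rV[R]_n)%type.
Local Notation mu := (lebesgue_st R n).
Local Notation ee := (expR (1 : R)).
Context (Lam p m q : R).
Hypotheses (Lam0 : 0 < Lam) (p2 : 2 < p) (m1 : 1 < m) (q2 : 2 <= q) (qp : q < p).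
Hypothesis (qn : n%:R < q * (m - 1)).

Lemma cvg_geometric_half (r : R) : (r * 2^-1 ^+ j) @[j --> \oo] --> (0 : R).
Proof. by apply: cvg_geometric; rewrite ger0_norm// invf_lt1// ltr1n. Qed.

Lemma powR_expr (x y : R) j : 0 <= x -> (x ^+ j) `^ y = (x `^ y) ^+ j.
Proof. by move=> x0; rewrite -[x ^+ j]powR_mulrn// -powRrM mulrC powRrM powR_mulrn// powR_ge0. Qed.

(** Each of the two sets nearly fills some cell of shape (l^q, l), so averages there nearly see the
    values a and b. The two cells may belong to unrelated dyadic generations, which is why the
    constant of [chain] depends neither on [i] nor on [j]. *)
Lemma subsolution_gap : exists2 C : R, 0 < C &
  forall U T Omega f A u G, subsolution Lam p m U T Omega f A u G -> 0 <= U ->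
  forall (r D a b T1 : R) (O0 O1 : set E),
  let Q := `]0, T[ `*` Omega in
  0 < r -> r <= 1 -> open O0 -> open O1 -> O0 `<=` Q -> O1 `<=` Q ->
  T1 < T -> (forall z, O1 z -> z.1 < T1) ->
  (forall z0 z1, O0 z0 -> O1 z1 ->
    [/\ 10 * r `^ q <= z1.1 - z0.1, z1.1 - z0.1 <= 65 * r `^ q & enorm (z1.2 - z0.2) <= D]) ->
  (forall z x, O0 z -> enorm (x - z.2) <= D + ee * r -> Omega x) ->
  (0 < mu (O0 `&` (Q `&` [set z | (u z <= a)%R])))%E ->
  (0 < mu (O1 `&` (Q `&` [set z | (b <= u z)%R])))%E ->
  b - a <= C * (D `^ conj_exp p * r `^ (q * (1 - conj_exp p)) + r `^ chain_exp n p m q).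
Proof.
have [C C0 step] := avg_step n Lam0 p2 m1 q2.
have [L L0 Lb] := dsmooth_step_bound R.
have M0 : 0 < weight_mass R n := weight_mass_gt0 R n.
set al := chain_exp n p m q.
set C2 := C + 2 * (C / (1 - 2^-1 `^ al)).
have al0 : 0 < al := chain_exp_gt0 p2 m1 q2 qp qn.
have C20 : 0 < C2.
  rewrite addr_gt0// mulr_gt0// divr_gt0// subr_gt0.
  have := @gt0_ltr_powR R al al0 2^-1 1; rewrite powR1; apply; rewrite ?nnegrE ?invr_ge0//.
  by rewrite invf_lt1// ltr1n.
exists (C2 / weight_mass R n); first by rewrite divr_gt0.
have arith (M U a b K Y a0 b0 e : R) : b * M - (U + b0) * K * e <= Y + (a * M + (U + a0) * K * e) ->
   (b - a) * M <= Y + (2 * U + a0 + b0) * K * e.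
  by rewrite mulrBl !mulrDl; lra.
move=> U T Omega f A u G S U0 r D a b T1 O0 O1 Q r0 r1 oO0 oO1 O0Q O1Q T1T O1T gap BO pos0 pos1.
have mQ : measurable Q := measurable_cylinder S.
have mu_ : measurable_fun Q u := sub_u_meas S.
have uU := sub_u_bound S.
set B0 := Q `&` [set z | u z <= a]; set B1 := Q `&` [set z | b <= u z].
have mB0 : measurable B0.
  rewrite /B0 (_ : [set z | _] = u @^-1` `]-oo, a]); first exact: mu_.
  by apply/seteqP; split => z /=; rewrite in_itv.
have mB1 : measurable B1.
  rewrite /B1 (_ : [set z | _] = u @^-1` `[b, +oo[); first exact: mu_.
  by apply/seteqP; split => z /=; rewrite in_itv/= andbT.
pose l j : R := r * 2^-1 ^+ j; pose h j : R := l j `^ q.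
have l0 j : 0 < l j by rewrite mulr_gt0// exprn_gt0// invr_gt0.
have h0 j : 0 < h j by exact: powR_gt0.
have lc : l @ \oo --> 0 by exact: cvg_geometric_half.
have hc : h @ \oo --> 0.
  have hE j : h j = r `^ q * (2^-1 `^ q) ^+ j.
    rewrite /h /l powRM ?exprn_ge0 ?invr_ge0 ?(ltW r0)//.
    by rewrite powR_expr ?invr_ge0.
  rewrite (_ : h = fun j => r `^ q * (2^-1 `^ q) ^+ j); last exact/funext.
  apply: cvg_geometric; rewrite ger0_norm ?powR_ge0//.
  have q0 : 0 < q by apply: lt_le_trans q2.
  have := @gt0_ltr_powR R q q0 2^-1 1; rewrite powR1; apply; rewrite ?nnegrE ?invr_ge0//.
  by rewrite invf_lt1// ltr1n.
set X := D `^ _ * _ + _.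
(* Here [e] is the fraction of bad points allowed in the cells; the bound is affine in it, so it may
   tend to 0. *)
suff key (e : R) : 0 < e -> (b - a) * weight_mass R n <= C2 * X +
   (2 * U + `|a| + `|b|) * (L * 2 ^+ n) * e.
  rewrite mulrAC ler_pdivlMr//; apply/ler_addgt0Pr => e e0.
  set K := (2 * U + `|a| + `|b|) * (L * 2 ^+ n) in key.
  have K0 : 0 <= K.
    by rewrite mulr_ge0 ?addr_ge0 ?mulr_ge0 ?exprn_ge0// ltW.
  have K1 : 0 < K + 1 by rewrite ltr_wpDl.
  apply: le_trans (key (e / (K + 1)) _) _; first by rewrite divr_gt0.
  rewrite lerD2l mulrCA -[leRHS]mulr1 ler_wpM2l ?(ltW e0)// ler_pdivrMr// mul1r.
  by rewrite lerDl.
move=> e0.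
have [i [b0 [y0 [c0O c0B]]]] := density_cell oO0 mB0 pos0 h0 l0 hc lc e0.
have [j [b1 [y1 [c1O c1B]]]] := density_cell oO1 mB1 pos1 h0 l0 hc lc e0.
have cc (k : nat) (c : R) (y : 'rV[R]_n) (t : R) : c <= t -> t < c + h k ->
    cell c (h k) y (l k) (t, y).
  move=> ct tc; split => /=; first by rewrite ct.
  by move=> i'; move: (l0 k); lra.
have p0 : O0 (b0, y0) by apply/c0O/cc => //; rewrite ltrDl.
have p1 : O1 (b1, y1) by apply/c1O/cc => //; rewrite ltrDl.
have [g1 g2 g3] := gap _ _ p0 p1.
have /= b00 : 0 < b0 by have [/=] := O0Q _ p0; rewrite in_itv/= => /andP[].
(* The cell is half-open in time and lies in [O1], hence before [T1]; its end is then at most [T1],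
   strictly before T. *)
have b1T : b1 + h j < T.
  apply: le_lt_trans T1T; rewrite leNgt; apply/negP => lt1.
  pose t := Num.max b1 T1.
  have tc : t < b1 + h j by rewrite gt_max lt1 ltrDl h0.
  have /O1T/= : O1 (t, y1) by apply/c1O/cc => //; rewrite le_max lexx.
  by rewrite ltNge le_max lexx orbT.
have ch : avg T Omega q u b1 y1 (l j) <= avg T Omega q u b0 y0 (l i) + C2 * X.
  apply: (chain p2 m1 q2 qp qn C0 (step _ _ _ _ _ _ _ S) i r0 r1 g1 g2 b00 b1T g3).
  by move=> x; exact: BO p0.
have av0 := average_le mQ mB0 mu_ U0 (ltW e0) uU _ (h0 i) (l0 i) Lb (subset_trans c0O O0Q) c0B.
have {}av0 := av0 a (fun z _ => @proj2 _ _).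
have av1 := average_ge mQ mB1 mu_ U0 (ltW e0) uU _ (h0 j) (l0 j) Lb (subset_trans c1O O1Q) c1B.
have {}av1 := av1 b (fun z _ => @proj2 _ _).
apply: arith; apply: le_trans av1 _; apply: le_trans ch _.
by rewrite addrC lerD2l.
Qed.

End subsolution_gap.

(** * Barriers for the viscosity inequality *)

Section lsc_contact.
Context (R : realType) (X : topologicalType).
Implicit Types (w : X -> \bar R) (phi : X -> R) (K : set X).

(** The shift [m] is the largest one that keeps phi below w on K. Without contact, semicontinuity
    and compactness would allow a slightly larger shift; at [y] phi exceeds w, hence m < 0. *)
Lemma lsc_contact K w phi (c : R) (y : X) : compact K -> K y -> (w y < (phi y)%:E)%E ->
  continuous phi ->
  (forall z, K z -> (c%:E <= w z)%E) ->
  (forall z (a : R), K z -> (a%:E < w z)%E -> \forall x \near z, (a%:E < w x)%E) ->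
  exists m z, [/\ m < 0, K z, w z = (m + phi z)%:E &
    forall x, K x -> ((m + phi x)%:E <= w x)%E].
Proof.
move=> cK Ky wy cphi cw lscw.
pose S : set R := [set b | forall x, K x -> ((b + phi x)%:E <= w x)%E].
have phib : exists M, forall x, K x -> phi x <= M.
  have : compact (phi @` K) by apply: continuous_compact => //; exact: continuous_subspaceT.
  move=> /compact_bounded[M [_ phiM]]; exists (`|M| + 1) => x Kx.
  apply: le_trans (ler_norm _) _; apply: (phiM (`|M| + 1)); last by exists x.
  by rewrite ltr_pwDr// ler_norm.
have [M phiM] := phib.
have S0 : S !=set0.
  exists (c - M) => x Kx; apply: le_trans (cw x Kx); rewrite lee_fin.
  by have := phiM x Kx; lra.
have Sub : ubound S 0.
  move=> b /(_ y Ky) by_; have := le_lt_trans by_ wy.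
  by rewrite lte_fin => ?; lra.
have hS : has_sup S by split => //; exists 0.
set m := sup S.
have Sm : S m.
  move=> x Kx; apply/lee_addgt0Pr => e e0.
  have [b Sb be] := sup_adherent e0 hS.
  have := Sb x Kx => /(leeD2r e%:E) /(le_trans _); apply.
  by rewrite lee_fin; move: be; rewrite -/m; lra.
have m0 : m < 0.
  by have := le_lt_trans (Sm y Ky) wy; rewrite lte_fin; lra.
have [[z [Kz wz]]|nz] := pselect (exists z, K z /\ w z = (m + phi z)%:E).
  by exists m, z; split.
have wm z : K z -> ((m + phi z)%:E < w z)%E.
  move=> Kz; rewrite lt_neqAle Sm// andbT; apply/eqP => wz.
  by apply: nz; exists z.
have cov := (compact_near_coveringP K).1 cK.
have : \forall b \near m^'+, K `<=` (fun x => ((b + phi x)%:E < w x)%E).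
  apply: cov => z Kz.
  have [e e0 we] : exists2 e : R, 0 < e & ((m + phi z + 2 * e)%:E < w z)%E.
    have := wm z Kz; case: (w z) => [r| |//].
    - rewrite lte_fin => h; exists ((r - (m + phi z)) / 4); first by lra.
      by rewrite lte_fin; lra.
    - by move=> _; exists 1 => //; rewrite ltry.
  near=> x b => /=.
  have px : phi x < phi z + e.
    near: x; apply: (cvgr_lt (phi z)); first exact: cphi.
    by rewrite ltrDl.
  have bm : b < m + e by near: b; apply: nbhs_right_lt; rewrite ltrDl.
  apply: (@lt_trans _ _ (m + phi z + 2 * e)%:E); first by rewrite lte_fin; lra.
  by near: x; exact: lscw.
move=> Hb; near (m^'+) => b.
have : b <= m.
  apply: sup_upper_bound => // x Kx; apply: ltW.
  by move: x Kx; near: b.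
by rewrite leNgt => /negP[]; near: b; exact: nbhs_right_gt.
Unshelve. all: by end_near. Qed.

End lsc_contact.

Section barrier.
Context (R : realType) (n : nat).
Local Notation E := (R * 'rV[R]_n)%type.
Context (c a k e N : R) (y : 'rV[R]_n).

Definition barrier (z : E) : R :=
  c - a * (\sum_i (z.2 ord0 i - y ord0 i) ^+ 2) - k * z.1 - e * expR (N * z.1).

Lemma elementary_barrier : elementary barrier.
Proof.
apply: elem_sub; last first.
  apply: elem_mul; first exact: elem_cst.
  by apply: elem_exp; apply: elem_mul; [exact: elem_cst|exact: elem_time].
apply: elem_sub; last by apply: elem_mul; [exact: elem_cst|exact: elem_time].
apply: elem_sub; first exact: elem_cst.
apply: elem_mul; first exact: elem_cst.
apply: elem_sum => i; apply: (@elem_pow R n (fun z => z.2 ord0 i - y ord0 i)).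
by apply: elem_sub; [exact: elem_space|exact: elem_cst].
Qed.

Lemma elementary_C12 (Q : set E) f : elementary f -> C12 Q f.
Proof.
move=> /elementary_smooth sf z _; split.
- by split; [have [_] := sf [::]; exact|have [+ _] := sf [:: dirt]; exact].
- move=> i; split; [have [_] := sf [::]; exact|].
  by have [+ _] := sf [:: dirx i]; exact.
- move=> i j; split; first by have [_] := sf [:: dirx j]; exact.
  by have [+ _] := sf [:: dirx i; dirx j]; exact.
Qed.

Lemma is_derive_barrier (z v : E) : is_derive z v barrier
  (- (a * (\sum_i 2 * (z.2 ord0 i - y ord0 i) * v.2 ord0 i)) - k * v.1
   - e * (expR (N * z.1) * (N * v.1))).
Proof.
have d1 := is_derive_time z v.
have cst_mul (b : R) (f : E -> R) df : is_derive z v f df -> is_derive z v (fun z => b * f z) (b * df).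
  move=> hf; apply: (is_derive_eq (is_derive_mulf (is_derive_cst b z v) hf)).
  by rewrite mul0r add0r.
have d2 : is_derive z v (fun z : E => \sum_i (z.2 ord0 i - y ord0 i) ^+ 2)
    (\sum_i 2 * (z.2 ord0 i - y ord0 i) * v.2 ord0 i).
  apply: is_derive_sumf => i.
  have h := is_derive_addf (is_derive_space i z v) (is_derive_cst (- y ord0 i) z v).
  apply: (is_derive_eq (is_derive_mulf h h)).
  by rewrite /cst addr0; ring.
have d3 : is_derive z v (fun z : E => expR (N * z.1)) (expR (N * z.1) * (N * v.1)).
  by apply: is_derive_compf; exact: cst_mul.
apply: (is_derive_eq (is_derive_addf (is_derive_addf (is_derive_addf (is_derive_cst c z v)
  (is_derive_oppf (cst_mul a _ _ d2))) (is_derive_oppf (cst_mul k _ _ d1)))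
  (is_derive_oppf (cst_mul e _ _ d3)))).
by rewrite add0r.
Qed.

Lemma dt_barrier z : dt barrier z = - k - e * (expR (N * z.1) * N).
Proof.
have [_] := is_derive_barrier z dirt; rewrite /dt => ->.
by rewrite big1 => [|i _]; rewrite /= ?mxE ?mulr0 ?oppr0 ?add0r ?mulr1.
Qed.

Lemma D_barrier i : 'D_(dirx i) barrier = fun z => - (2 * a) * (z.2 ord0 i - y ord0 i).
Proof.
apply/funext => z; have [_] := is_derive_barrier z (dirx i); rewrite /= => ->.
rewrite (bigD1 i)//= big1 => [|j ji]; rewrite /= !mxE ?eqxx /=.
  by rewrite !mulr0 !mulr1 !addr0 !subr0; ring.
by rewrite (negbTE ji) mulr0.
Qed.

Lemma grad_barrier z : grad barrier z = - (2 * a) *: (z.2 - y).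
Proof. 
apply/rowP => i; rewrite /grad [LHS]mxE.
by have /= -> := congr1 (@^~ z) (D_barrier i); rewrite !mxE.
Qed.

Lemma hess_barrier z : hess barrier z = (- (2 * a))%:M.
Proof.
apply/matrixP => i j; rewrite mxE D_barrier.
have h := is_derive_addf (is_derive_space j z (dirx i)) (is_derive_cst (- y ord0 j) z (dirx i)).
have [_ ->] := is_derive_mulf (is_derive_cst (- (2 * a)) z (dirx i)) h.
by rewrite /= !mxE eqxx/= mul0r add0r addr0 mulr_natr eq_sym.
Qed.

End barrier.

Lemma lee_shift (R : realDomainType) (a b : R) (x : \bar R) :
  ((a + b)%:E <= x)%E -> (a%:E <= x - b%:E)%E.
Proof.
case: x => [x| |]; rewrite /= ?lee_fin ?leey//.
by rewrite lerBrDr.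
Qed.

Section viscosity_growth.
Context (R : realType) (n : nat).
Local Notation E := (R * 'rV[R]_n)%type.
Context (Lam Lam0 p : R) (Q : set E) (w : E -> \bar R).
Hypotheses (n0 : (0 < n)%N) (L0 : 0 < Lam) (L00 : 0 <= Lam0) (p0 : 0 <= p).
Hypothesis visc : viscosity_supersolution Q
  (fun xi X => Lam * enorm xi `^ p - Lam0 * mminus X) (- Lam) w.

(* If the estimate failed at [z], a barrier with a paraboloid profile, lowered
   linearly in time and exponentially just after the time of [z], would touch [w]
   from below at an interior point and violate the inequality there. *)
Lemma viscosity_growth (ts tau rho mu d : R) (xs : 'rV[R]_n) :
  0 < tau -> 0 < rho -> 0 < d ->
  (forall z : E, ts - tau < z.1 < ts -> enorm (z.2 - xs) < rho -> Q z /\ (mu%:E <= w z)%E) ->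
  (forall z : E, ts - tau < z.1 < ts - tau / 2 -> enorm (z.2 - xs) < rho ->
    ((mu + d)%:E <= w z)%E) ->
  tau * (Lam * (3 * d / rho) `^ p) < d / 12 -> 48 * tau * Lam0 < rho ^+ 2 ->
  12 * tau * Lam < d ->
  forall z : E, ts - tau / 4 < z.1 < ts -> enorm (z.2 - xs) < rho / 4 ->
    ((mu + d / 2)%:E <= w z)%E.
Proof.
have e8 : (8 : R) <= 1 + 7 by lra.
have e27 (x : R) : 0 < x -> 2 / 27 * x <= x / 12 by lra.
have e83 : 8 / 3 <= 3 :> R by lra.
move=> tau0 rho0 d0 wmu wd c1 c2 c3 z /andP[zt1 zt2] zx.
rewrite leNgt; apply/negP => wz.
have [lscw touch] := visc.
have [rb rbE] : exists rb, rb = 3 * rho / 4 by exists (3 * rho / 4).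
pose ti := ts - 3 * tau / 4; pose te := (z.1 + ts) / 2.
have rb0 : 0 < rb by rewrite rbE; lra.
have zte : z.1 < te by rewrite /te; lra.
have tets : te < ts by rewrite /te; lra.
have tiz : ti < z.1 by rewrite /ti; lra.
have tits : ts - tau < ti by rewrite /ti; lra.
have tits2 : ti < ts - tau / 2 by rewrite /ti; lra.
have rbrho : rb < rho by rewrite rbE; lra.
have rho4 : rho / 4 < rb by rewrite rbE; lra.
(* Between the time of [z] and [te] the normalized exponential grows from 1 to exp 7 >= 8, so that
   with coefficient d/8 it costs at least d on the top. *)
pose N := 7 / (te - z.1).
(* At [z] the slope [k] costs at most 3d/16, the paraboloid d/9 and the exponential d/8, in all less
   than d/2. On the lateral boundary the paraboloid alone costs d. *)
have [k kE] : exists k, k = d / (4 * tau) by exists (d / (4 * tau)).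
have [a aE] : exists a, a = d / rb ^+ 2 by exists (d / rb ^+ 2).
have N0 : 0 < N by rewrite divr_gt0// subr_gt0.
have k0 : 0 < k by rewrite kE divr_gt0// mulr_gt0.
have a0 : 0 < a by rewrite aE divr_gt0// exprn_gt0.
have ktau : k * tau = d / 4 by rewrite kE; field; rewrite gt_eqF.
pose phi := barrier (mu + d + k * ti) a k (d / 8 * expR (- (N * z.1))) N xs : E -> R.
have phiE x : phi x = mu + d - d * (enorm (x.2 - xs) / rb) ^+ 2 - k * (x.1 - ti) -
    d / 8 * expR (N * (x.1 - z.1)).
  rewrite /phi /barrier (_ : \sum_i _ = enorm (x.2 - xs) ^+ 2); last first.
    by rewrite sqr_enorm; apply: eq_bigr => i _; rewrite !mxE.
  rewrite (_ : N * (x.1 - z.1) = - (N * z.1) + N * x.1); last by ring.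
  by rewrite expRD aE; field; rewrite gt_eqF.
have phiz : mu + d / 2 <= phi z.
  rewrite phiE subrr mulr0 expR0 mulr1.
  have h1 : (enorm (z.2 - xs) / rb) ^+ 2 <= 1 / 9.
    rewrite (_ : 1 / 9 = (1 / 3) ^+ 2 :> R); last by field.
    apply: lerXn2r; rewrite ?nnegrE ?divr_ge0 ?enorm_ge0 ?(ltW rb0)//.
    by rewrite ler_pdivrMr//; apply: ltW; apply: lt_le_trans zx _; rewrite rbE; lra.
  have h2 : k * (z.1 - ti) <= 3 / 16 * d.
    rewrite (_ : 3 / 16 * d = k * (3 * tau / 4)); last by move: ktau; lra.
    by rewrite ler_pM2l// /ti; lra.
  have h3 : d * (enorm (z.2 - xs) / rb) ^+ 2 <= d * (1 / 9) by rewrite ler_pM2l.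
  by clear -h2 h3 d0; lra.
pose K : set E := `[ti, te] `*` [set x | enorm (x - xs) <= rb].
have cK : compact K by apply: compact_setX; [exact: segment_compact|exact: compact_eball].
have KP (x : E) : K x -> ts - tau < x.1 < ts /\ enorm (x.2 - xs) < rho.
  move=> [/=]; rewrite in_itv/= => /andP[x1 x2] x3; split; last exact: le_lt_trans rbrho.
  by rewrite (lt_le_trans tits x1) (le_lt_trans x2 tets).
have Kw x : K x -> Q x /\ (mu%:E <= w x)%E by move=> /KP[]; exact: wmu.
have Kz : K z.
  split => /=; last by rewrite ltW// (lt_trans zx).
  by rewrite in_itv/= (ltW tiz) (ltW zte).
have ephi : elementary phi by exact: elementary_barrier.
have [||||m [z0 [m0 Kz0 wz0 mw]]] := @lsc_contact R _ K w phi mu z cK Kz.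
- by apply: lt_le_trans wz _; rewrite lee_fin.
- exact: elementary_continuous.
- by move=> x /Kw[].
- by move=> x b /Kw[Qx _]; exact: lscw.
have exp0 x : 0 < d / 8 * expR (N * (x - z.1)) by rewrite mulr_gt0 ?expR_gt0// divr_gt0.
have sq0 x : 0 <= d * (enorm (x - xs) / rb) ^+ 2 by rewrite mulr_ge0 ?sqr_ge0// ltW.
have [Qz0 wmu0] := Kw _ Kz0.
have [] := Kz0; rewrite /= in_itv/= => /andP[t1 t2] x2.
have k1 : 0 <= k * (z0.1 - ti) by rewrite mulr_ge0 ?subr_ge0// ltW.
have phimu : mu < phi z0.
  by move: wmu0; rewrite wz0 lee_fin => h; clear -h m0; lra.
(* Contact is excluded on the bottom, where w >= mu + d is above the barrier, and on the top and the
   sides, where the barrier is at most mu. *)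
have t1' : ti < z0.1.
  rewrite lt_neqAle t1 andbT; apply/eqP => tz0.
  have [h1 h2] := KP _ Kz0.
  have : ((mu + d)%:E <= w z0)%E by apply: wd => //; rewrite -tz0 tits tits2.
  rewrite wz0 lee_fin; apply/negP; rewrite -ltNge phiE.
  by move: (exp0 z0.1) (sq0 z0.2) k1 m0; clear; lra.
have t2' : z0.1 < te.
  rewrite lt_neqAle t2 andbT; apply/eqP => tz0.
  have {}e8 : 8 <= expR (N * (z0.1 - z.1)).
    rewrite tz0 /N divfK ?gt_eqF ?subr_gt0//; exact: le_trans (expR_ge1Dx _).
  have h : d / 8 * 8 <= d / 8 * expR (N * (z0.1 - z.1)) by rewrite ler_pM2l// divr_gt0.
  by move: phimu; rewrite phiE; move: h (sq0 z0.2) k1; clear; lra.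
have x2' : enorm (z0.2 - xs) < rb.
  rewrite lt_neqAle x2 andbT; apply/eqP => xz0.
  move: phimu; rewrite phiE xz0 divff ?gt_eqF// expr1n.
  by move: (exp0 z0.1) k1; clear; lra.
have near_le : \forall x \near z0, (w z0 - (phi z0)%:E <= w x - (phi x)%:E)%E.
  have : nbhs z0 (`]ti, te[ `*` [set x | enorm (x - xs) < rb] : set E).
    exists (`]ti, te[%classic, [set x | enorm (x - xs) < rb]) => //; split => /=.
    - by apply: open_nbhs_nbhs; split; [exact: interval_open|rewrite /= in_itv/= t1' t2'].
    - by apply: open_nbhs_nbhs; split; [exact: open_eball|].
  apply: filterS => x [/=]; rewrite in_itv/= => /andP[x1 x3] x4.
  have h : (w z0 - (phi z0)%:E)%E = m%:E by rewrite wz0 -EFinB addrK.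
  rewrite h; apply: lee_shift; apply: mw; split => /=; last exact: ltW.
  by rewrite in_itv/= (ltW x1) (ltW x3).
have := touch phi z0 (elementary_C12 ephi) Qz0 near_le.
rewrite dt_barrier grad_barrier hess_barrier mminus_scalar//; last first.
  by rewrite oppr_le0; apply: mulr_ge0 => //; exact: ltW.
have g1 : enorm (- (2 * a) *: (z0.2 - xs)) `^ p <= (3 * d / rho) `^ p.
  rewrite enormZ normrN ger0_norm ?mulr_ge0 ?(ltW a0)//.
  apply: ge0_ler_powR => //; rewrite ?nnegrE.
  - by apply: mulr_ge0; [apply: mulr_ge0 => //; exact: ltW|exact: enorm_ge0].
  - by apply: divr_ge0; [apply: mulr_ge0 => //|]; exact: ltW.
  apply: (@le_trans _ _ (2 * a * rb)); first by rewrite ler_pM2l// mulr_gt0.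
  rewrite (_ : 2 * a * rb = 8 / 3 * d / rho); last by rewrite aE rbE; field; rewrite gt_eqF.
  by rewrite ler_pM2r ?invr_gt0// ler_pM2r.
have g2 : tau * (Lam * enorm (- (2 * a) *: (z0.2 - xs)) `^ p) < d / 12.
  apply: le_lt_trans c1; apply: ler_wpM2l; first exact: ltW.
  by apply: ler_wpM2l; [exact: ltW|exact: g1].
have g3 : 0 < d / 8 * expR (- (N * z.1)) * (expR (N * z0.1) * N).
  apply: mulr_gt0; first by apply: mulr_gt0; [exact: divr_gt0|exact: expR_gt0].
  by apply: mulr_gt0 => //; exact: expR_gt0.
have g4 : tau * (Lam0 * (2 * a)) < d / 12.
  rewrite (_ : _ * _ = 48 * tau * Lam0 * (2 * d / 27 / rho ^+ 2)); last first.
    by rewrite aE rbE; field; rewrite gt_eqF.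
  apply: (@lt_le_trans _ _ (rho ^+ 2 * (2 * d / 27 / rho ^+ 2))).
    by rewrite ltr_pM2r// divr_gt0 ?exprn_gt0// divr_gt0// mulr_gt0.
  rewrite (_ : _ * _ = 2 / 27 * d); last by field; rewrite gt_eqF.
  exact: e27.
move: g2 g3 g4; set P := _ `^ p; set X := _ * (_ * N) => g2 g3 g4 h.
have {}h : k <= Lam + Lam * P + Lam0 * (2 * a) by move: h g3; clear; lra.
(* The left-hand side is d/4, while each of the three terms on the right is below d/12. *)
have : tau * k <= tau * (Lam + Lam * P + Lam0 * (2 * a)) by rewrite ler_pM2l.
rewrite mulrC ktau !mulrDr; move: g2 g4 c3; clear; lra.
Qed.
End viscosity_growth.

(** * The essential lower envelope *)

Section lsc_envelope_facts.
Context (R : realType) (n : nat).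
Local Notation E := (R * 'rV[R]_n)%type.
Local Notation mu := (lebesgue_st R n).
Implicit Types (u : E -> R) (z : E) (O : set E).

Lemma lsc_envelope_ge u z O (a : R) : nbhs z O ->
  {ae mu, forall y, O y -> a <= u y} -> (a%:E <= lsc_envelope u z)%E.
Proof.
move=> /nbhs_ballP[r /= r0 rO] ua; apply: le_trans (ereal_sup_ubound _); last by exists r.
apply/ess_infP; apply: filterS ua => y uy; rewrite /patch; case: ifPn => [|_]; last exact: leey.
by rewrite inE => yr; rewrite lee_fin; apply/uy/rO.
Qed.

Lemma lsc_envelope_gt u z (a : R) : (a%:E < lsc_envelope u z)%E ->
  exists2 O, nbhs z O & {ae mu, forall y, O y -> a < u y}.
Proof.
move=> /ereal_sup_gt[_ [r /= r0 <-] ar]; exists (ball z r); first exact: nbhsx_ballx.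
have := ess_inf_le mu (patch (cst +oo%E) (ball z r) (EFin \o u)).
apply: filterS => y uy yr; have := lt_le_trans ar uy.
by rewrite /patch mem_set// lte_fin.
Qed.

Lemma nbhs_not_ae_false z O : nbhs z O -> ~ {ae mu, forall y, O y -> False}.
Proof.
move=> /nbhs_ballP[r /= r0 rO] [N [mN N0 ON]].
have : (mu (ball z r) <= mu N)%E.
  apply: le_measure; rewrite ?inE//; first exact: measurable_stball.
  by move=> y yr; apply: ON => /= h; apply/h/rO.
by rewrite [X in (_ <= X)%E](N0 : mu N = 0%E) leNgt stball_gt0.
Qed.

(** Otherwise u > b and u <= b would both hold almost everywhere near [z], although neighbourhoods
    are not null. *)
Lemma lsc_envelope_le u z O (b : R) : nbhs z O ->
  {ae mu, forall y, O y -> u y <= b} -> (lsc_envelope u z <= b%:E)%E.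
Proof.
move=> zO ub; rewrite leNgt; apply/negP => /lsc_envelope_gt[W zW bu].
apply: (@nbhs_not_ae_false z (O `&` W)); first exact: filterI.
by apply: filterS2 ub bu => y h1 h2 [/h1 h3 /h2]; rewrite ltNge h3.
Qed.

Lemma not_ae_measure_gt0 (B : set E) : measurable B ->
  ~ {ae mu, forall z, ~ B z} -> (0 < mu B)%E.
Proof.
move=> mB nB; rewrite lt_neqAle measure_ge0 andbT; apply/eqP => B0; apply: nB.
exists B; split => // z /=; exact: contrapT.
Qed.

End lsc_envelope_facts.

Section small_powers.
Context (R : realType).

(** Lets one small parameter be chosen to satisfy several smallness conditions at once. *)
Lemma near_small_power (C e a : R) : 0 < e -> 0 < a ->
  \forall x \near (0 : R)^'+, C * x `^ e < a.
Proof.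
move=> e0 a0; have C1 : 0 < `|C| + 1 by rewrite ltr_wpDl.
have d0 : 0 < a / (`|C| + 1) by exact: divr_gt0.
near=> x.
have x0 : 0 < x by near: x; exact: nbhs_right_gt.
have xd : x < (a / (`|C| + 1)) `^ e^-1 by near: x; apply: nbhs_right_lt; exact: powR_gt0.
have : x `^ e < a / (`|C| + 1).
  have := @gt0_ltr_powR R e e0 x ((a / (`|C| + 1)) `^ e^-1).
  rewrite -powRrM mulVf ?gt_eqF// powRr1 ?(ltW d0)//.
  by apply => //; rewrite nnegrE ?powR_ge0// ltW.
rewrite ltr_pdivlMr// mulrC; apply: le_lt_trans.
by rewrite ler_wpM2r ?powR_ge0// (le_trans (ler_norm _))// lerDl.
Unshelve. all: by end_near. Qed.

End small_powers.

(** * Decay of the oscillation *)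

Section oscillation.
Context (R : realType) (n : nat).
Local Notation E := (R * 'rV[R]_n)%type.
Local Notation mu := (lebesgue_st R n).
Local Notation ee := (expR (1 : R)).

Definition cyl (a b : R) (x : 'rV[R]_n) (r : R) : set E :=
  [set z : E | a < z.1 < b /\ enorm (z.2 - x) < r].

Lemma open_cyl a b x r : open (cyl a b x r).
Proof.
rewrite openE => -[t y] [/= tI yI]; exists (`]a, b[%classic, [set y | enorm (y - x) < r]).
  by split => /=; apply: open_nbhs_nbhs; split; [exact: interval_open|rewrite /= in_itv/= tI|
    exact: open_eball|].
by move=> [t' y'] [/=]; rewrite in_itv/=.
Qed.

Lemma cylW a a' b x r r' : a' <= a -> r <= r' -> cyl a b x r `<=` cyl a' b x r'.
Proof.
move=> aa rr z [/andP[z1 z2] z3]; split; last exact: lt_le_trans rr.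
by rewrite z2 (le_lt_trans aa z1).
Qed.

(* The lower bound is asked of the envelope everywhere, as the viscosity argument
   needs it, the upper bound of [u] almost everywhere, as the integral one gives it. *)
Definition oscillates (u : E -> R) (w : E -> \bar R) (D : set E) (c M : R) : Prop :=
  (forall z, D z -> (c%:E <= w z)%E) /\ {ae mu, forall z, D z -> u z <= c + M}.

Context (Lam Lam0 p m q C c del : R).
Hypotheses (n0 : (0 < n)%N) (L0 : 0 < Lam) (L00 : 0 <= Lam0) (p2 : 2 < p) (m1 : 1 < m).
Hypotheses (q2 : 2 <= q) (qp : q < p) (qn : n%:R < q * (m - 1)).
Hypotheses (C0 : 0 < C) (c0 : 0 < c) (del0 : 0 < del) (del4 : del <= 4^-1).
(** Fixes [c] so that moving by twice the radius costs exactly M/8. The condition on [del] that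
    follows makes the barrier flat enough at the radius determined by this [c]. *)
Hypothesis (cE : C * (2 `^ conj_exp p * 64 `^ (p - 1)^-1 * c) = 8^-1).
Hypothesis (delE : Lam * (3 `^ p * c `^ (1 - p) * del `^ (p - 1)) < 12^-1).
Local Notation al := (chain_exp n p m q).

Context (U T : R) (Omega : set 'rV[R]_n) (u : E -> R).
Local Notation Q := (`]0, T[ `*` Omega : set E).
Local Notation w := (lsc_envelope u).
Hypothesis mQ : measurable Q.
Hypothesis mu_ : measurable_fun Q u.
Hypothesis gap : forall (r D a b T1 : R) (O0 O1 : set E),
  0 < r -> r <= 1 -> open O0 -> open O1 -> O0 `<=` Q -> O1 `<=` Q ->
  T1 < T -> (forall z, O1 z -> z.1 < T1) ->
  (forall z0 z1, O0 z0 -> O1 z1 ->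
    [/\ 10 * r `^ q <= z1.1 - z0.1, z1.1 - z0.1 <= 65 * r `^ q & enorm (z1.2 - z0.2) <= D]) ->
  (forall z x, O0 z -> enorm (x - z.2) <= D + ee * r -> Omega x) ->
  (0 < mu (O0 `&` (Q `&` [set z | (u z <= a)%R])))%E ->
  (0 < mu (O1 `&` (Q `&` [set z | (b <= u z)%R])))%E ->
  b - a <= C * (D `^ conj_exp p * r `^ (q * (1 - conj_exp p)) + r `^ al).
Hypothesis visc : viscosity_supersolution Q
  (fun xi X => Lam * enorm xi `^ p - Lam0 * mminus X) (- Lam) w.

(* The radius for which the first error term of [gap] is [M / 8]. *)
Definition osc_radius (M tau : R) : R := (c * M) `^ ((p - 1) / p) * tau `^ p^-1.
(** A time in the first half of the cylinder and one in its last quarter differ by between tau/4 =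
    16 r^q and tau = 64 r^q, within the range from 10 r^q to 65 r^q that [gap] asks for. *)
Definition osc_step_size (tau : R) : R := (tau / 64) `^ q^-1.

Let p0 : 0 < p. Proof. by move: p2; lra. Qed.
Let p10 : 0 < p - 1. Proof. by move: p2; lra. Qed.
Let q0 : 0 < q. Proof. exact: lt_le_trans q2. Qed.

Lemma osc_radius_gt0 M tau : 0 < M -> 0 < tau -> 0 < osc_radius M tau.
Proof. by move=> M0 t0; rewrite mulr_gt0 ?powR_gt0// mulr_gt0. Qed.

Lemma osc_radius_pow M tau e : 0 < M -> 0 < tau ->
  osc_radius M tau `^ e = (c * M) `^ ((p - 1) / p * e) * tau `^ (p^-1 * e).
Proof. by move=> M0 t0; rewrite /osc_radius powRM ?powR_ge0// -!powRrM. Qed.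

(** The power p' of the radius is proportional to c M tau^(1/(p-1)), and the step size contributes
    tau^(-1/(p-1)): the duration cancels and so does q. *)
Lemma osc_error M tau : 0 < M -> 0 < tau ->
  C * ((2 * osc_radius M tau) `^ conj_exp p * osc_step_size tau `^ (q * (1 - conj_exp p))) = M / 8.
Proof.
move=> M0 t0; have r0 := osc_radius_gt0 M0 t0.
have t640 : 0 < tau / 64 by exact: divr_gt0.
rewrite powRM ?(ltW r0)// osc_radius_pow// /osc_step_size -powRrM.
have -> : q^-1 * (q * (1 - conj_exp p)) = - (p - 1)^-1.
  by rewrite conj_expE//; field; rewrite !gt_eqF.
have -> : (p - 1) / p * conj_exp p = 1 by rewrite /conj_exp; field; rewrite !gt_eqF.
have -> : p^-1 * conj_exp p = (p - 1)^-1 by rewrite /conj_exp; field; rewrite !gt_eqF.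
rewrite powRr1 ?mulr_ge0 ?(ltW c0) ?(ltW M0)//.
rewrite powRM ?(ltW t0)// -(powR_inv1 (_ : 0 <= 64))// -powRrM mulN1r opprK.
have tt : tau `^ (p - 1)^-1 * tau `^ (- (p - 1)^-1) = 1.
  by rewrite powRN divff// gt_eqF// powR_gt0.
transitivity (C * (2 `^ conj_exp p * 64 `^ (p - 1)^-1 * c) * M *
   (tau `^ (p - 1)^-1 * tau `^ (- (p - 1)^-1))); first by ring.
by rewrite cE tt mulr1 mulrC.
Qed.

(** The p-th power of the radius is (c M)^(p-1) tau, so tau and M^(p-1) cancel and only c^(1-p)
    del^(p-1) multiplies del M. *)
Lemma osc_slope M tau : 0 < M -> 0 < tau ->
  tau * (Lam * (3 * (del * M) / osc_radius M tau) `^ p) < del * M / 12.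
Proof.
move=> M0 t0; have r0 := osc_radius_gt0 M0 t0.
have -> : (3 * (del * M) / osc_radius M tau) `^ p =
    3 `^ p * c `^ (1 - p) * del `^ (p - 1) * (del * M) / tau.
  rewrite powRM ?mulr_ge0 ?invr_ge0 ?(ltW M0) ?(ltW del0) ?(ltW r0)//.
  rewrite -(powR_inv1 (ltW r0)) -powRrM mulN1r osc_radius_pow//.
  rewrite powRM ?mulr_ge0 ?(ltW M0) ?(ltW del0)// [(del * M) `^ p]powRM ?(ltW M0) ?(ltW del0)//.
  have -> : (p - 1) / p * - p = 1 - p by field; rewrite gt_eqF.
  have -> : p^-1 * - p = -1 by field; rewrite gt_eqF.
  rewrite (powR_inv1 (ltW t0)) powRM ?(ltW M0) ?(ltW c0)//.
  have split x : 0 < x -> x `^ p = x `^ (p - 1) * x.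
    move=> x0; rewrite -{3}(powRr1 (ltW x0)) -powRD ?subrK//.
    by apply/implyP => _; rewrite gt_eqF.
  have MM : M `^ (p - 1) * M `^ (1 - p) = 1.
    by rewrite -opprB powRN mulVf// gt_eqF// powR_gt0.
  rewrite (split del)// (split M)//.
  transitivity (3 `^ p * c `^ (1 - p) * del `^ (p - 1) * (del * M) / tau *
     (M `^ (p - 1) * M `^ (1 - p))); first by ring.
  by rewrite MM mulr1.
rewrite (_ : tau * _ = Lam * (3 `^ p * c `^ (1 - p) * del `^ (p - 1)) * (del * M)); last first.
  by field; rewrite gt_eqF.
by rewrite mulrC ltr_pM2l// mulr_gt0.
Qed.

(* Either [u >= c1 + del M] a.e. in the early half of the cylinder, and the viscosity
   inequality propagates half of this gain; or [u] is small there on a set of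
   positive measure, and then [gap] keeps [u] below [c1 + (1 - del / 2) M] later. *)
Lemma oscillation_step (ts tau M c1 : R) (xs : 'rV[R]_n) :
  0 < M -> 0 < tau -> tau <= 1 -> 0 <= ts - tau -> ts < T ->
  let rho := osc_radius M tau in
  (forall x, enorm (x - xs) <= 3 * rho + ee * osc_step_size tau -> Omega x) ->
  8 * C * osc_step_size tau `^ al <= M -> 48 * tau * Lam0 < rho ^+ 2 ->
  12 * tau * Lam < del * M ->
  oscillates u w (cyl (ts - tau) ts xs rho) c1 M ->
  exists c2, oscillates u w (cyl (ts - tau / 4) ts xs (rho / 4)) c2 ((1 - del / 2) * M).
Proof.
have a1 (d N e f : R) : d <= 4^-1 -> 0 < N -> e = N / 8 -> 8 * f <= N ->
   c1 + (1 - d / 2) * N - (c1 + d * N) <= e + f -> False.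
  move=> d4 N0 -> fN h.
  have : d * N <= 4^-1 * N by rewrite ler_pM2r.
  by move: fN h N0; rewrite mulrBl; lra.
have a2 (t s s' : R) : 0 < t -> ts - t < s -> s < ts - t / 2 -> ts - t / 4 < s' -> s' < ts ->
   10 * (t / 64) <= s' - s /\ s' - s <= 65 * (t / 64).
  by split; lra.
have b1 (x : R) : 0 < x -> x <= 3 * x by lra.
have b2 (t s : R) : 0 < t -> s < ts - t / 2 -> s < ts by lra.
have b3 (t : R) : 0 < t -> ts - t <= ts - t / 4 by lra.
have b5 (x : R) : 0 < x -> x / 4 <= x by lra.
have b6 (x y r : R) : x < r -> y < r -> x + y <= 2 * r by lra.
have b7 (x y r e : R) : x <= 2 * r + e -> y < r -> x + y <= 3 * r + e by lra.
move=> M0 t0 t1 tst tsT rho BO hA hB hC [wc uc].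
have r0 : 0 < rho by exact: osc_radius_gt0.
have h0 : 0 < osc_step_size tau by rewrite powR_gt0// divr_gt0.
have d0 : 0 < del * M by rewrite mulr_gt0.
have cylQ z : cyl (ts - tau) ts xs rho z -> Q z.
  move=> [/andP[z1 z2] z3]; split => /=.
    by rewrite in_itv/= (le_lt_trans tst z1) (lt_trans z2 tsT).
  apply: BO; apply: le_trans (ltW z3) _; rewrite -[leLHS]addr0; apply: lerD.
    exact: b1.
  by rewrite mulr_ge0 ?expR_ge0// ltW.
set O0 := cyl (ts - tau) (ts - tau / 2) xs rho.
set O1 := cyl (ts - tau / 4) ts xs rho.
have O0c : O0 `<=` cyl (ts - tau) ts xs rho.
  by move=> z [/andP[z1 z2] z3]; split => //; rewrite z1 (b2 tau).
have O1c : O1 `<=` cyl (ts - tau) ts xs rho.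
  by apply: cylW => //; exact: b3.
have [early|early] := pselect {ae mu, forall z, O0 z -> c1 + del * M <= u z}.
  exists (c1 + del * M / 2); split.
    move=> z [z1 z2]; apply: (viscosity_growth n0 L0 (ltW p0) visc t0 r0 d0 _ _ _ hB hC z1 z2).
    - by move=> y y1 y2; split; [apply: cylQ|apply: wc]; split.
    - move=> y y1 y2; apply: (lsc_envelope_ge (O := O0)) => //.
      by apply: open_nbhs_nbhs; split; [exact: open_cyl|].
    - exact: osc_slope.
  apply: filterS uc => z uz zc; have {}uz : u z <= c1 + M.
    by apply: uz; apply: cylW zc; [exact: b3|exact: b5].
  by apply: le_trans uz _; rewrite le_eqVlt; apply/orP; left; apply/eqP; field.
exists c1; split.
  by move=> z zc; apply: wc; apply: cylW zc; [exact: b3|exact: b5].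
(* If u exceeded its new bound on a set of positive measure, [gap] would bound (1 - 3 del/2) M, at
   least 5M/8, by the sum of two errors of at most M/8 each. *)
apply: contrapT => late.
apply: (@a1 del M (C * ((2 * rho) `^ conj_exp p * osc_step_size tau `^ (q * (1 - conj_exp p))))
  (C * osc_step_size tau `^ al)) => //; [exact: osc_error|by rewrite mulrA|].
rewrite -mulrDr.
have hq : osc_step_size tau `^ q = tau / 64.
  by rewrite /osc_step_size -powRrM mulVf ?gt_eqF// powRr1// divr_ge0// ltW.
have pos (O : set E) (P : set R) : open O -> O `<=` Q -> measurable P ->
   ~ {ae mu, forall z, O z -> ~ P (u z)} -> (0 < mu (O `&` (Q `&` [set z | P (u z)])))%E.
  move=> oO OQ mP nae; apply: not_ae_measure_gt0.
    by apply: measurableI; [exact: open_measurable_st|exact: mu_].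
  move=> h; apply: nae; apply: filterS h => z hz Oz Pz; apply: hz; split => //.
  by split => //; exact: OQ.
apply: (gap (T1 := ts) (O0 := O0) (O1 := O1)) => //.
- have -> : 1 = 1 `^ q^-1 :> R by rewrite powR1.
  apply: ge0_ler_powR; rewrite ?nnegrE ?invr_ge0 ?divr_ge0 ?(ltW q0) ?(ltW t0)//.
  by rewrite ler_pdivrMr// mul1r (le_trans t1)// ler1n.
- exact: open_cyl.
- exact: open_cyl.
- by move=> z /O0c/cylQ.
- by move=> z /O1c/cylQ.
- by move=> z [/andP[]].
- move=> z0 z1 [/andP[s1 s2] s3] [/andP[s4 s5] s6]; rewrite hq.
  have [e1 e2] := a2 _ _ _ t0 s1 s2 s4 s5; split => //.
  apply: le_trans (enorm_distD _ xs _) _; rewrite [enorm (xs - _)]enormC.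
  by rewrite addrC; exact: b6.
- move=> z x [_ z3] xz; apply: BO; apply: le_trans (enorm_distD _ z.2 _) _.
  exact: b7.
- apply: (pos O0 [set t | t <= c1 + del * M]).
  + exact: open_cyl.
  + by move=> z /O0c/cylQ.
  + by rewrite (_ : [set _ | _] = `]-oo, c1 + del * M]%classic).
  + move=> h; apply: early; apply: filterS h => z hz /hz /negP.
    by rewrite -ltNge => /ltW.
- apply: (pos O1 [set t | c1 + (1 - del / 2) * M <= t]).
  + exact: open_cyl.
  + by move=> z /O1c/cylQ.
  + rewrite (_ : [set _ | _] = `[c1 + (1 - del / 2) * M, +oo[%classic)//.
    by apply/seteqP; split => t; rewrite /= in_itv/= andbT.
  + move=> h; apply: late; apply: filterS h => z hz zc.
    have /hz/negP : O1 z by apply: cylW zc => //; exact: b5.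
    by rewrite -ltNge => /ltW.
Qed.

(** The conditions of [oscillation_step], gathered as an invariant of the iteration: room inside the
    domain, then smallness of the error from f, of the Hessian term and of the zeroth-order term. *)
Definition admissible (ts : R) (xs : 'rV[R]_n) (M tau : R) : Prop :=
  [/\ [/\ 0 < M, 0 < tau, tau <= 1 & 0 <= ts - tau],
      forall x, enorm (x - xs) <= 3 * osc_radius M tau + ee * osc_step_size tau -> Omega x,
      8 * C * osc_step_size tau `^ al <= M,
      48 * tau * Lam0 < osc_radius M tau ^+ 2 &
      12 * tau * Lam < del * M].

Context (lam sg : R).
Local Notation th := (lam `^ ((p - 1) / p) * sg `^ p^-1).
Hypotheses (lamE : lam = 1 - del / 2) (sg0 : 0 < sg) (sg4 : sg <= 4^-1).
Hypotheses (sgth : sg <= th) (sgth2 : sg <= th ^+ 2) (th4 : th <= 4^-1).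
Hypotheses (sglam : sg <= lam) (sgal : sg `^ (al / q) <= lam).

Let lam0 : 0 < lam. Proof. by apply: lt_le_trans sglam. Qed.
Let th0 : 0 < th. Proof. by rewrite mulr_gt0 ?powR_gt0. Qed.

Lemma osc_radius_scale M tau : 0 < M -> 0 < tau ->
  osc_radius (lam * M) (sg * tau) = th * osc_radius M tau.
Proof.
move=> M0 t0; rewrite /osc_radius mulrCA [(lam * _) `^ _]powRM ?mulr_ge0 ?(ltW lam0) ?(ltW c0) ?(ltW M0)//.
by rewrite [(sg * tau) `^ _]powRM ?(ltW sg0) ?(ltW t0)//; ring.
Qed.

Lemma osc_step_size_scale tau : 0 < tau ->
  osc_step_size (sg * tau) = sg `^ q^-1 * osc_step_size tau.
Proof.
by move=> t0; rewrite /osc_step_size -mulrA powRM ?(ltW sg0) ?divr_ge0 ?(ltW t0).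
Qed.

(** Replacing M by lam M and tau by sg tau multiplies the radius by th. The last three conditions
    persist thanks to [sgal], [sgth2] and [sglam] respectively. *)
Lemma admissible_step ts xs M tau : admissible ts xs M tau ->
  admissible ts xs (lam * M) (sg * tau).
Proof.
move=> [[M0 t0 t1 tst] BO hA hB hC].
have sg1 : sg <= 1 by apply: le_trans sg4 _; rewrite invf_le1 ?ler1n.
have th1 : th <= 1 by apply: le_trans th4 _; rewrite invf_le1 ?ler1n.
have st : sg * tau <= tau by rewrite -[leRHS]mul1r ler_pM2r.
have r0 := osc_radius_gt0 M0 t0.
have h0 : 0 < osc_step_size tau by rewrite powR_gt0// divr_gt0.
have sgq : sg `^ q^-1 <= 1.
  have -> : 1 = 1 `^ q^-1 :> R by rewrite powR1.
  by apply: ge0_ler_powR; rewrite ?nnegrE ?invr_ge0 ?(ltW q0) ?(ltW sg0).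
split.
- split; [exact: mulr_gt0|exact: mulr_gt0|exact: le_trans t1|].
  by apply: le_trans tst _; rewrite lerD2l lerN2.
- move=> x xx; apply: BO; apply: le_trans xx _.
  rewrite osc_radius_scale// osc_step_size_scale//; apply: lerD.
    by rewrite ler_pM2l// -[leRHS]mul1r ler_pM2r.
  by rewrite ler_pM2l ?expR_gt0// -[leRHS]mul1r ler_pM2r.
- rewrite osc_step_size_scale// powRM ?powR_ge0// -powRrM [q^-1 * _]mulrC mulrCA.
  by apply: ler_pM; rewrite ?powR_ge0// ?mulr_ge0 ?powR_ge0 ?(ltW C0).
- rewrite osc_radius_scale// [ltRHS]exprMn.
  rewrite (_ : 48 * _ * _ = sg * (48 * tau * Lam0)); last by ring.
  apply: (@le_lt_trans _ _ (th ^+ 2 * (48 * tau * Lam0))).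
    by rewrite ler_wpM2r// ?mulr_ge0 ?(ltW t0).
  by rewrite ltr_pM2l// exprn_gt0.
- rewrite (_ : 12 * _ * _ = sg * (12 * tau * Lam)); last by ring.
  rewrite (_ : del * _ = lam * (del * M)); last by ring.
  apply: (@le_lt_trans _ _ (lam * (12 * tau * Lam))).
    by rewrite ler_wpM2r// ?mulr_ge0 ?(ltW t0) ?(ltW L0).
  by rewrite ltr_pM2l.
Qed.

(** The true radii shrink by the factor th >= sg. Keeping only sg^k makes durations and radii shrink
    alike, as a Hoelder bound in the space-time distance requires. *)
Lemma oscillation_iterate ts xs M tau c1 k : admissible ts xs M tau -> ts < T ->
  oscillates u w (cyl (ts - tau) ts xs (osc_radius M tau)) c1 M ->
  exists c2, oscillates u w (cyl (ts - sg ^+ k * tau) ts xs (sg ^+ k * osc_radius M tau)) c2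
    (lam ^+ k * M).
Proof.
move=> adm tsT osc0.
suff [adm' sgr [c2 [osc1 osc2]]] : [/\ admissible ts xs (lam ^+ k * M) (sg ^+ k * tau),
    sg ^+ k * osc_radius M tau <= osc_radius (lam ^+ k * M) (sg ^+ k * tau) &
    exists c2, oscillates u w (cyl (ts - sg ^+ k * tau) ts xs
      (osc_radius (lam ^+ k * M) (sg ^+ k * tau))) c2 (lam ^+ k * M)].
  have sub := @cylW (ts - sg ^+ k * tau) (ts - sg ^+ k * tau) ts xs _ _ (lexx _) sgr.
  exists c2; split; first by move=> z /sub; exact: osc1.
  by apply: filterS osc2 => z hz /sub.
elim: k => [|k [IH1 IH2 [c2 IH3]]].
  by rewrite !expr0 !mul1r; split => //; exists c1.
have [[M0 t0 t1 tst] BO hA hB hC] := IH1; rewrite !exprS -!mulrA.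
have r0 := osc_radius_gt0 M0 t0.
split; first exact: admissible_step.
  have [[M00 t00 _ _] _ _ _ _] := adm.
  rewrite osc_radius_scale//; apply: ler_pM => //; first exact: ltW.
  by rewrite mulr_ge0// ?exprn_ge0 ?(ltW sg0)// ltW// osc_radius_gt0.
have [c3 [osc1 osc2]] := oscillation_step M0 t0 t1 tst tsT BO hA hB hC IH3.
have sub : cyl (ts - sg * (sg ^+ k * tau)) ts xs (osc_radius (lam * (lam ^+ k * M)) (sg * (sg ^+ k * tau)))
    `<=` cyl (ts - sg ^+ k * tau / 4) ts xs (osc_radius (lam ^+ k * M) (sg ^+ k * tau) / 4).
  (* The new cylinder fits into the quarter cylinder because both sg and th are at most 1/4. *)
  apply: cylW; first by rewrite lerD2l lerN2 [leRHS]mulrC ler_pM2r.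
  by rewrite osc_radius_scale// [leRHS]mulrC ler_pM2r.
exists c3; split; first by move=> z /sub; exact: osc1.
by apply: filterS osc2 => z hz /sub/hz; rewrite lamE.
Qed.

End oscillation.

(** * Choice of the constants *)

Section uniform_oscillation.
Context (R : realType) (n : nat) (Lam Lam0 p m : R).
Local Notation E := (R * 'rV[R]_n)%type.
Local Notation mu := (lebesgue_st R n).
Local Notation ee := (expR (1 : R)).
Hypotheses (n0 : (0 < n)%N) (L0 : 0 < Lam) (L00 : 0 <= Lam0) (p2 : 2 < p).
Hypothesis (mp : 1 + (maxn n 2)%:R / p < m).

Let p0 : 0 < p. Proof. by move: p2; lra. Qed.

Lemma exponent_gt1 : 1 < m.
Proof. by apply: le_lt_trans mp; rewrite lerDl divr_ge0// ltW. Qed.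

(** The lower bound on m gives n/(m-1) < p; q is the midpoint between max(2, n/(m-1)) and p. *)
Lemma exists_time_exponent : exists q, [/\ 2 <= q, q < p & n%:R < q * (m - 1)].
Proof.
have m10 : 0 < m - 1 by rewrite subr_gt0 exponent_gt1.
have np : n%:R / (m - 1) < p.
  have : (maxn n 2)%:R < p * (m - 1).
    by rewrite mulrC -ltr_pdivrMr// ltrBrDl.
  rewrite ltr_pdivrMr//; apply: le_lt_trans.
  by rewrite ler_nat leq_max leqnn.
exists ((Num.max 2 (n%:R / (m - 1)) + p) / 2).
have [h1 h2] : 2 <= Num.max 2 (n%:R / (m - 1)) /\ n%:R / (m - 1) <= Num.max 2 (n%:R / (m - 1)).
  by rewrite !le_max !lexx orbT.
have h3 : Num.max 2 (n%:R / (m - 1)) < p by rewrite gt_max p2.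
move: h1 h2 h3; set q := Num.max _ _ => h1 h2 h3; split; [lra|lra|].
by rewrite -ltr_pdivrMr//; apply: le_lt_trans h2 _; lra.
Qed.

Lemma powR_split (x a b : R) : 0 < x -> a + b = 1 -> x `^ a * x `^ b = x.
Proof.
move=> x0 ab; rewrite -powRD; last by apply/implyP => _; rewrite gt_eqF.
by rewrite ab powRr1 ?(ltW x0).
Qed.

Let split1 : (p - 1) / p + p^-1 = 1. Proof. by field; rewrite gt_eqF. Qed.
Let split2 : 1 - 2 / p + p^-1 * 2 = 1. Proof. by field; rewrite gt_eqF. Qed.

(** A small [sg] works: sg <= th amounts to sg <= lam, and sg <= th^2 bounds sg^(1 - 2/p), a
    positive power because p > 2, by a power of lam. *)
Lemma exists_decay (lam e : R) : 0 < lam -> lam < 1 -> 0 < e -> exists sg : R,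
  let th := lam `^ ((p - 1) / p) * sg `^ p^-1 in
  [/\ 0 < sg, sg <= 4^-1 /\ th <= 4^-1, sg <= th, sg <= th ^+ 2 &
    sg <= lam /\ sg `^ e <= lam].
Proof.
move=> l0 l1 e0.
have e1 : 0 < 1 - 2 / p by rewrite subr_gt0 ltr_pdivrMr// mul1r.
have b0 : 0 < lam `^ ((p - 1) / p * 2) by exact: powR_gt0.
have q4 : 0 < 4^-1 :> R by [].
have p'0 : 0 < p^-1 by rewrite invr_gt0.
near ((0 : R)^'+) => sg.
have sg0 : 0 < sg by near: sg; exact: nbhs_right_gt.
have sg4 : sg <= 4^-1 by near: sg; exact: nbhs_right_le.
have sgl : sg <= lam by near: sg; exact: nbhs_right_le.
have h1 : 1 * sg `^ (1 - 2 / p) < lam `^ ((p - 1) / p * 2) by near: sg; exact: near_small_power.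
have h2 : 1 * sg `^ p^-1 < 4^-1 by near: sg; exact: near_small_power.
have h3 : 1 * sg `^ e < lam by near: sg; exact: near_small_power.
have pe : 0 <= (p - 1) / p by rewrite divr_ge0 ?(ltW p0)//; move: p2; lra.
exists sg => /=; split.
- by [].
- split => //; apply: le_trans (ltW h2); rewrite ler_wpM2r ?powR_ge0//.
  have {2}<- : 1 `^ ((p - 1) / p) = 1 :> R by rewrite powR1.
  by rewrite ge0_ler_powR// ?nnegrE// ltW.
- rewrite -{1}(powR_split sg0 split1).
  by rewrite ler_wpM2r ?powR_ge0// ge0_ler_powR// ?nnegrE// ltW.
- rewrite -{1}(powR_split sg0 split2).
  rewrite exprMn -!(powR_mulrn 2 (powR_ge0 _ _)) -!powRrM ler_wpM2r ?powR_ge0//.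
  by apply: ltW; rewrite mul1r in h1.
- by split => //; rewrite mul1r in h3; exact: ltW.
Unshelve. all: by end_near. Qed.

(** The order of the quantifiers carries the dependence of the constants: the rates [lam] and [sg],
    hence the Hoelder exponent, precede U, s and d, which only affect the initial size [kap]. *)
Lemma uniform_oscillation : exists lam sg : R,
  [/\ 0 < lam, lam < 1, 0 < sg, sg < 1 & sg <= lam] /\
  forall U s d : R, 0 <= U -> 0 < s -> 0 < d -> exists2 kap : R, 0 < kap &
  forall T Omega f A u G, subsolution Lam p m U T Omega f A u G ->
  viscosity_supersolution (`]0, T[ `*` Omega)
    (fun xi X => Lam * enorm xi `^ p - Lam0 * mminus X) (- Lam) (lsc_envelope u) ->
  forall (ts : R) (xs : 'rV[R]_n) k, s <= ts -> ts < T ->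
    (forall x, enorm (x - xs) <= d -> Omega x) ->
    exists c, oscillates u (lsc_envelope u)
      (cyl (ts - sg ^+ k * kap) ts xs (sg ^+ k * kap)) c (lam ^+ k * (2 * U + 1)).
Proof.
have m1 := exponent_gt1.
have [q [q2 qp qn]] := exists_time_exponent.
have q0 : 0 < q by exact: lt_le_trans q2.
have [C C0 gap] := subsolution_gap L0 p2 m1 q2 qp qn.
have al0 : 0 < chain_exp n p m q by exact: chain_exp_gt0.
have aq0 : 0 < chain_exp n p m q / q by exact: divr_gt0.
have p10 : 0 < p - 1 by move: p2; lra.
pose c := (8 * (C * (2 `^ conj_exp p * 64 `^ (p - 1)^-1)))^-1.
have c0 : 0 < c by rewrite invr_gt0 !mulr_gt0 ?powR_gt0.
have cE : C * (2 `^ conj_exp p * 64 `^ (p - 1)^-1 * c) = 8^-1.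
  by rewrite /c; field; rewrite !gt_eqF// ?powR_gt0.
have [del [del0 del4 delE]] : exists del : R, [/\ 0 < del, del <= 4^-1 &
    Lam * (3 `^ p * c `^ (1 - p) * del `^ (p - 1)) < 12^-1].
  have q4 : 0 < 4^-1 :> R by [].
  have q12 : 0 < 12^-1 :> R by [].
  near ((0 : R)^'+) => del; exists del; split.
  - by near: del; exact: nbhs_right_gt.
  - by near: del; exact: nbhs_right_le.
  - by rewrite mulrA mulrA; near: del; exact: near_small_power.
pose lam := 1 - del / 2.
have l0 : 0 < lam by rewrite /lam; move: del4; lra.
have l1 : lam < 1 by rewrite /lam; move: del0; lra.
have [sg /= [sg0 [sg4 th4] sgth sgth2 [sgl sgal]]] := exists_decay l0 l1 aq0.
have sg1 : sg < 1 by apply: le_lt_trans sg4 _; rewrite invf_lt1 ?ltr1n.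
exists lam, sg; split; first by split.
(* The initial oscillation is at most 2U; the added 1 keeps M positive when U = 0. *)
move=> U s d U0 s0 d0; pose M := 2 * U + 1.
have M0 : 0 < M by rewrite /M; lra.
have cM0 : 0 < c * M by exact: mulr_gt0.
have e1 : 0 < 1 - 2 / p by rewrite subr_gt0 ltr_pdivrMr// mul1r.
have b0 : 0 < (c * M) `^ ((p - 1) / p * 2) by exact: powR_gt0.
have d2 : 0 < d / 2 by exact: divr_gt0.
have dM : 0 < del * M by exact: mulr_gt0.
have p'0 : 0 < p^-1 by rewrite invr_gt0.
have q'0 : 0 < q^-1 by rewrite invr_gt0.
(* All conditions hold for small [tau]. The one against the squared radius, of order tau^(2/p),
   relies on p > 2. *)
have [tau [t0 t1 ts [hA hB hC] geo]] : exists tau : R,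
    [/\ 0 < tau, tau <= 1, tau <= s,
     [/\ 8 * C * osc_step_size q tau `^ chain_exp n p m q <= M,
       48 * tau * Lam0 < osc_radius p c M tau ^+ 2 & 12 * tau * Lam < del * M] &
     3 * osc_radius p c M tau + ee * osc_step_size q tau <= d].
  near ((0 : R)^'+) => tau; exists tau.
  have t0 : 0 < tau by near: tau; exact: nbhs_right_gt.
  have step (e : R) : 0 < e -> osc_step_size q tau `^ e <= tau `^ (e / q).
    move=> e0; rewrite /osc_step_size -powRrM [q^-1 * e]mulrC.
    apply: ge0_ler_powR; rewrite ?nnegrE ?divr_ge0 ?(ltW t0) ?(ltW e0) ?(ltW q0)//.
    by rewrite ler_pdivrMr// ler_peMr ?ler1n// ltW.
  have k1 : 8 * C * tau `^ (chain_exp n p m q / q) < M by near: tau; exact: near_small_power.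
  have k2 : 48 * Lam0 * tau `^ (1 - 2 / p) < (c * M) `^ ((p - 1) / p * 2).
    by near: tau; exact: near_small_power.
  have k3 : 12 * Lam * tau `^ 1 < del * M by near: tau; exact: near_small_power.
  have k4 : 3 * (c * M) `^ ((p - 1) / p) * tau `^ p^-1 < d / 2 by near: tau; exact: near_small_power.
  have k5 : ee * tau `^ q^-1 < d / 2 by near: tau; exact: near_small_power.
  split.
  - by [].
  - by near: tau; exact: nbhs_right_le.
  - by near: tau; exact: nbhs_right_le.
  - split.
    + by apply: le_trans (ltW k1); rewrite ler_pM2l ?mulr_gt0// step.
    + rewrite -{1}(powR_split t0 split2).
      rewrite /osc_radius exprMn -!(powR_mulrn 2 (powR_ge0 _ _)) -!powRrM.
      rewrite (_ : 48 * _ * _ = 48 * Lam0 * tau `^ (1 - 2 / p) * tau `^ (p^-1 * 2)); last by ring.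
      by rewrite ltr_pM2r// powR_gt0.
    + by move: k3; rewrite powRr1 ?(ltW t0)// mulrAC.
  - rewrite [leRHS](_ : d = d / 2 + d / 2); last by field.
    apply: lerD; first by rewrite /osc_radius mulrA ltW.
    apply: le_trans (ltW k5); rewrite ler_pM2l ?expR_gt0//.
    by have := step 1 ltr01; rewrite powRr1 ?powR_ge0// mul1r.
have r0 : 0 < osc_radius p c M tau by rewrite mulr_gt0 ?powR_gt0.
(* A single length serves as duration and as radius, to match the space-time distance. *)
exists (Num.min tau (osc_radius p c M tau)); first by rewrite lt_min t0.
move=> T Omega f A u G S visc t xs k st tT BO.
have adm : admissible Lam Lam0 p m q C c del Omega t xs M tau.
  split => //; first by split => //; rewrite subr_ge0 (le_trans ts).
  by move=> x xx; apply/BO/(le_trans xx).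
have cylQ z : cyl (t - tau) t xs (osc_radius p c M tau) z -> (`]0, T[ `*` Omega) z.
  move=> [/andP[z1 z2] z3]; split => /=.
    by rewrite in_itv/= (lt_trans z2 tT) andbT (le_lt_trans _ z1)// subr_ge0 (le_trans ts).
  apply: BO; apply: le_trans (ltW z3) _; apply: le_trans geo.
  have h0 : 0 <= ee * osc_step_size q tau by rewrite mulr_ge0 ?expR_ge0 ?powR_ge0.
  by rewrite -[leLHS]addr0 lerD// ler_peMl ?ler1n// ltW.
have osc0 : oscillates u (lsc_envelope u) (cyl (t - tau) t xs (osc_radius p c M tau)) (- U) M.
  split.
    move=> z /cylQ Qz; apply: (lsc_envelope_ge (O := `]0, T[ `*` Omega)).
      by apply: open_nbhs_nbhs; split => //; exact: open_cylinder S.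
    by apply: filterS (sub_u_bound S) => y uy /uy; rewrite ler_norml => /andP[].
  apply: filterS (sub_u_bound S) => y uy /cylQ/uy.
  by rewrite ler_norml /M => /andP[_ h]; apply: le_trans h _; move: U0; lra.
have [c2 [osc1 osc2]] := oscillation_iterate n0 L0 L00 p2 q2 C0 c0 del0 del4 cE delE
  (measurable_cylinder S) (sub_u_meas S) (gap _ _ _ _ _ _ _ S U0) visc erefl sg0 sg4 sgth sgth2 th4 sgl
  sgal k adm tT osc0.
have sub : cyl (t - sg ^+ k * Num.min tau (osc_radius p c M tau)) t xs
   (sg ^+ k * Num.min tau (osc_radius p c M tau)) `<=`
   cyl (t - sg ^+ k * tau) t xs (sg ^+ k * osc_radius p c M tau).
  apply: cylW; first by rewrite lerD2l lerN2 ler_pM2l ?exprn_gt0// ge_min lexx.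
  by rewrite ler_pM2l ?exprn_gt0// ge_min lexx orbT.
exists c2; split; first by move=> z /sub; exact: osc1.
by apply: filterS osc2 => z hz /sub.
Unshelve. all: by end_near. Qed.

End uniform_oscillation.

(** * Regularity of the solution *)

Section Lnorm_facts.
Context (R : realType) (n : nat).
Local Notation E := (R * 'rV[R]_n)%type.
Local Notation mu := (lebesgue_st R n).
Implicit Types (D : set E) (g : E -> R).

Lemma LnormOn_pinfty D g :
  LnormOn +oo D g = ess_sup mu (fun z => `|(g \_ D) z|%:E)%E.
Proof.
by rewrite /LnormOn unlock lebesgue_st_gt0.
Qed.

Lemma LnormOn_pinfty_ae D g (M : R) : (LnormOn +oo D g <= M%:E)%E ->
  {ae mu, forall z, D z -> `|g z| <= M}.
Proof.
rewrite LnormOn_pinfty => gM; have := ess_sup_ge mu (fun z => `|(g \_ D) z|%:E)%E.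
apply: filterS => z gz Dz; rewrite -lee_fin; apply: le_trans gM; apply: le_trans gz.
by rewrite /patch mem_set.
Qed.

Lemma LnormOn_pinfty_ge0 D g : (0 <= LnormOn +oo D g)%E.
Proof.
rewrite LnormOn_pinfty; apply: ess_sup_gee; first exact: lebesgue_st_gt0.
by apply: aeW => z; rewrite lee_fin.
Qed.

Lemma LnormOn_pow (r : R) D g : 0 < r ->
  LnormOn r%:E D g = ((\int[mu]_(z in D) (`|g z| `^ r)%:E) `^ r^-1)%E.
Proof.
move=> r0; rewrite /LnormOn unlock; congr (_ `^ _)%E.
rewrite [RHS]integral_mkcond; apply: eq_integral => z _.
rewrite /patch /=; case: ifP => // _.
by rewrite normr0 powR0// gt_eqF.
Qed.

Lemma integral_LnormOn_lty (r : R) D g : 0 < r -> (LnormOn r%:E D g < +oo)%E ->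
  (\int[mu]_(z in D) (`|g z| `^ r)%:E < +oo)%E.
Proof.
move=> r0; rewrite LnormOn_pow//; case: (X in (X `^ _)%E) => //=.
- by move=> x _; rewrite ltry.
- by rewrite gt_eqF ?invr_gt0.
Qed.

Lemma integral_LnormOn_le (r M : R) D g : 0 < r -> 0 <= M -> (LnormOn r%:E D g <= M%:E)%E ->
  (\int[mu]_(z in D) (`|g z| `^ r)%:E <= (M `^ r)%:E)%E.
Proof.
move=> r0 M0; rewrite LnormOn_pow//.
have : (0 <= \int[mu]_(z in D) (`|g z| `^ r)%:E)%E.
  by apply: integral_ge0 => z _; rewrite lee_fin powR_ge0.
case: (X in (_ <= X)%E) => //= [x|_]; last by rewrite gt_eqF ?invr_gt0.
rewrite !lee_fin => x0 xM.
have -> : x = (x `^ r^-1) `^ r by rewrite -powRrM mulVf ?gt_eqF// powRr1.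
by rewrite ge0_ler_powR ?nnegrE ?powR_ge0// ltW.
Qed.

Lemma measurable_closed_cylinder (T : R) (Omega : set 'rV[R]_n) : open Omega ->
  measurable (`[0, T] `*` Omega : set E).
Proof.
move=> oO; rewrite (_ : _ `*` _ = (fst @^-1` `[0, T]) `&` (setT `*` Omega)); last first.
  by apply/seteqP; split => [[t x] [? ?]|[t x] [? [_ ?]]].
apply: measurableI; first by rewrite -[X in measurable X]setTI; exact: measurable_fst.
apply: open_measurable_st; rewrite openE => -[t x] [_ Ox].
exists (setT, Omega) => //; split => /=; first exact: filterT.
by apply: open_nbhs_nbhs; split.
Qed.

Lemma subsolution_intro (Lam p m T : R) (Omega : set 'rV[R]_n)
    (f : E -> R) (A : E -> 'M[R]_n) (u : E -> R) (G : E -> 'rV[R]_n) :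
  let D : set E := `[0, T] `*` Omega in
  let Q : set E := `]0, T[ `*` Omega in
  0 < Lam -> 0 < p -> 0 < m -> open Omega ->
  in_L m%:E D f -> (LnormOn m%:E D f <= Lam%:E)%E ->
  (forall i j, measurable_fun D (fun z => A z i j)) ->
  (LnormOn +oo D (fun z => opnorm (A z)) <= Lam%:E)%E ->
  in_L +oo Q u -> weak_gradient Q u G -> in_L_rV p%:E Q G ->
  distributional_subsolution Q Lam^-1 p A f u G ->
  subsolution Lam p m (fine (LnormOn +oo Q u)) T Omega f A u G.
Proof.
move=> D Q L0 p0 m0 oO [mf _] fL mA AL [mu_ uoo] wg [mG Goo] sub.
have mD : measurable D by exact: measurable_closed_cylinder.
have QD : Q `<=` D.
  by move=> z [/= z1 z2]; split => //=; move: z1; apply: subset_itvW.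
have mQ : measurable Q.
  apply: open_measurable_st; rewrite openE => -[t x] [/= tT Ox]; exists (`]0, T[%classic, Omega) => //.
  by split => /=; apply: open_nbhs_nbhs; split.
split => //.
- by apply: LnormOn_pinfty_ae; rewrite fineK// ge0_fin_numE// LnormOn_pinfty_ge0.
- have := integral_LnormOn_lty p0 Goo; apply: le_lt_trans.
  rewrite le_eqVlt; apply/orP; left; apply/eqP; apply: eq_integral => z _.
  by rewrite ger0_norm// enorm_ge0.
- exact: measurable_funS mf.
- apply: le_trans (integral_LnormOn_le m0 (ltW L0) fL); apply: ge0_subset_integral => //.
  apply/measurable_EFinP; apply: (measurableT_comp (measurable_powR m)).
  exact: measurableT_comp.
- by move=> i j; exact: measurable_funS (mA i j).
- apply: filterS (LnormOn_pinfty_ae AL) => z h /QD/h; exact/le_trans/ler_norm.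
Qed.

End Lnorm_facts.

Lemma geometric_below (R : realType) (x e : R) : 0 < x -> x < 1 -> 0 < e ->
  exists k : nat, x ^+ k < e.
Proof.
move=> x0 x1 e0; have : (1 * x ^+ k) @[k --> \oo] --> (0 : R).
  by apply: cvg_geometric; rewrite ger0_norm// ltW.
move=> /cvgr_lt /(_ _ e0)[N _ hN]; exists N; rewrite -[ltLHS]mul1r.
by apply: hN => /=.
Qed.

Section regularity.
Context (R : realType) (n : nat) (Lam Lam0 p m lam sg kap U s d T : R).
Local Notation E := (R * 'rV[R]_n)%type.
Local Notation mu := (lebesgue_st R n).
Context (Omega : set 'rV[R]_n) (u : E -> R).
Hypotheses (lam0 : 0 < lam) (lam1 : lam < 1) (sg0 : 0 < sg) (sg1 : sg < 1) (sglam : sg <= lam).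
Hypotheses (U0 : 0 <= U) (kap0 : 0 < kap).
Local Notation Q := (`]0, T[ `*` Omega : set E).
Local Notation w := (lsc_envelope u).
Hypothesis uU : {ae mu, forall z, Q z -> `|u z| <= U}.
Hypothesis oQ : open Q.
Local Notation v := (fun z => fine (w z)).

Lemma lsc_envelope_bound z : Q z -> w z \is a fin_num /\ `|v z| <= U.
Proof.
move=> Qz; have Qn : nbhs z Q by exact: open_nbhs_nbhs.
have h1 : ((- U)%:E <= w z)%E.
  by apply: (lsc_envelope_ge Qn); apply: filterS uU => y h /h; rewrite ler_norml => /andP[].
have h2 : (w z <= U%:E)%E.
  by apply: (lsc_envelope_le Qn); apply: filterS uU => y h /h; rewrite ler_norml => /andP[].
move: h1 h2; case: (w z) => [x| |]//=; rewrite !lee_fin => h1 h2.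
by split => //; rewrite ler_norml h1.
Qed.

Hypothesis osc : forall (ts : R) (xs : 'rV[R]_n) k, s <= ts -> ts < T ->
  (forall x, enorm (x - xs) <= d -> Omega x) ->
  exists c, oscillates u w (cyl (ts - sg ^+ k * kap) ts xs (sg ^+ k * kap)) c
    (lam ^+ k * (2 * U + 1)).

Lemma cyl_oscillation ts xs r c M : oscillates u w (cyl (ts - r) ts xs r) c M ->
  forall z, cyl (ts - r) ts xs r z -> (c%:E <= w z)%E /\ (w z <= (c + M)%:E)%E.
Proof.
move=> [h1 h2] z zc; split; first exact: h1.
by apply: lsc_envelope_le h2; apply: open_nbhs_nbhs; split => //; exact: open_cyl.
Qed.

(** Cylinders lie strictly before their final time, so two points close in time are put into one
    cylinder ending slightly after the later of them and still before T. *)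
Lemma later_time (a b r : R) : 0 < r -> `|a - b| < r -> a < T -> b < T ->
  exists ts, [/\ a < ts, b < ts, ts < T, ts - r < a & ts - r < b].
Proof.
move=> r0; rewrite ltr_norml => /andP[h1 h2] aT bT.
pose e := Num.min (T - Num.max a b) (r - `|a - b|).
have : exists2 e, 0 < e & [/\ a + e < T, b + e < T, a + e < b + r & b + e < a + r].
  exists (Num.min (Num.min (T - a) (T - b)) (Num.min (b + r - a) (a + r - b)) / 2).
    by rewrite divr_gt0// !lt_min !subr_gt0 aT bT; apply/andP; split => //; apply/andP; split; lra.
  set e' := Num.min _ _.
  have e0 : 0 < e'.
    by rewrite !lt_min !subr_gt0 aT bT; apply/andP; split => //; apply/andP; split; lra.
  have : e' <= e' by [].
  rewrite {2}/e' !le_min => /andP[/andP[e1 e2] /andP[e3 e4]].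
  by clearbody e'; split; lra.
move=> [e' e0 [e1 e2 e3 e4]].
have [ab|ba] := leP a b.
  by exists (b + e'); split; lra.
by exists (a + e'); split; lra.
Qed.

Lemma pair_oscillation k (z y : E) : s < z.1 < T -> s < y.1 < T ->
  (forall x, enorm (x - z.2) <= d -> Omega x) ->
  `|z.1 - y.1| < sg ^+ k * kap -> enorm (z.2 - y.2) < sg ^+ k * kap ->
  `|v z - v y| <= lam ^+ k * (2 * U + 1).
Proof.
move=> /andP[zs zT] /andP[ys yT] BO zy1 zy2.
have r0 : 0 < sg ^+ k * kap by rewrite mulr_gt0 ?exprn_gt0.
have [ts [z1 y1 tsT z2 y2]] := later_time r0 zy1 zT yT.
have sts : s <= ts by apply: ltW; apply: lt_trans z1.
have [c /cyl_oscillation oc] := osc k sts tsT BO.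
have [zw1 zw2] := oc z (conj (introT andP (conj z2 z1)) (eq_ind_r (fun x => x < _) r0 (etrans (congr1 (@enorm R n) (subrr _)) (enorm0 R n)))).
rewrite enormC in zy2.
have [yw1 yw2] := oc y (conj (introT andP (conj y2 y1)) zy2).
move: zw1 zw2 yw1 yw2; case: (w z) => [a| |]//; case: (w y) => [b| |]//=.
by rewrite !lee_fin ler_norml => *; apply/andP; split; lra.
Qed.

(* Half of the exponent for which [sg ^ _ = lam], so as to be strictly below 1. *)
Definition holder_exponent : R := ln lam / ln sg / 2.

Lemma holder_exponentP : [/\ 0 < holder_exponent, holder_exponent < 1 & lam <= sg `^ holder_exponent].
Proof.
have ls : ln sg < 0 by rewrite ln_lt0// sg0.
have ll : ln lam < 0 by rewrite ln_lt0// lam0.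
have lsl : ln sg <= ln lam by rewrite ler_ln ?posrE.
have q0 : 0 < ln lam / ln sg by rewrite nmulr_rgt0 ?invr_lt0.
have q1 : ln lam / ln sg <= 1 by rewrite ler_ndivrMr// mul1r.
have e0 : 0 < holder_exponent by rewrite divr_gt0.
split => //; first by rewrite /holder_exponent; lra.
rewrite /powR gt_eqF// -{1}(lnK (_ : lam \is Num.pos)) ?posrE// ler_expR.
rewrite /holder_exponent mulrAC divfK ?lt_eqF//.
by move: ll; lra.
Qed.

(** At distances of at least [kap] the bound 2U on the difference suffices. Below, the distance is
    located between two consecutive scales sg^k kap and the decay lam^k is turned into a power of
    it. *)
Lemma pair_holder (z y : E) : s < z.1 < T -> s < y.1 < T -> Q z -> Q y ->
  (forall x, enorm (x - z.2) <= d -> Omega x) ->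
  `|v z - v y| / st_dist z y `^ holder_exponent <=
    (2 * U + 1) / lam / kap `^ holder_exponent.
Proof.
have M0 : 0 < 2 * U + 1 by move: U0; lra.
have ub (a b : R) : a <= U -> b <= U -> a + b <= 2 * U + 1 by lra.
move=> zT yT Qz Qy BO; have [e0 e1 le] := holder_exponentP.
set e := holder_exponent in e0 e1 le *; set r := st_dist z y.
have r0 : 0 <= r by exact: sqrtr_ge0.
have ke0 : 0 < kap `^ e by exact: powR_gt0.
have M1 : 2 * U + 1 <= (2 * U + 1) / lam by rewrite ler_pdivlMr// ler_piMr ?ltW.
have rhs0 : 0 <= (2 * U + 1) / lam / kap `^ e by rewrite !divr_ge0// ltW.
(* At distance 0 the quotient is 0, since the inverse of 0 is 0. *)
have [r_eq0|r_neq0] := eqVneq r 0.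
  by rewrite r_eq0 powR0 ?gt_eqF// invr0 mulr0.
have {r_neq0}r0 : 0 < r by rewrite lt_neqAle eq_sym r_neq0.
have re0 : 0 < r `^ e by exact: powR_gt0.
have d1 : `|z.1 - y.1| <= r.
  by rewrite -sqrtr_sqr; apply: ler_wsqrtr; rewrite lerDl sqr_ge0.
have d2 : enorm (z.2 - y.2) <= r.
  rewrite -(ger0_norm (enorm_ge0 _)) -sqrtr_sqr; apply: ler_wsqrtr.
  by rewrite lerDr sqr_ge0.
have [kr|rk] := leP kap r.
  have [_ vz] := lsc_envelope_bound Qz; have [_ vy] := lsc_envelope_bound Qy.
  apply: ler_pM => //; first by rewrite invr_ge0 ltW.
    apply: le_trans M1; apply: le_trans (ub _ _ vz vy).
    exact: ler_normB.
  by rewrite lef_pV2 ?posrE// ge0_ler_powR ?nnegrE ?(ltW e0) ?(ltW kap0) ?(ltW r0).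
have exk : exists j, sg ^+ j * kap <= r.
  have [j jr] := geometric_below sg0 sg1 (divr_gt0 r0 kap0).
  by exists j; rewrite -ler_pdivlMr// ltW.
(* The least index has the form k + 1, so sg^(k+1) kap <= r < sg^k kap; the mismatch of one step
   costs the factor 1/lam. *)
case: (ex_minnP exk) => [[|k]]; first by rewrite expr0 mul1r leNgt rk.
move=> hk min_k; have rk1 : r < sg ^+ k * kap.
  by rewrite ltNge; apply/negP => /min_k; rewrite ltnn.
have := pair_oscillation (k := k) zT yT BO (le_lt_trans d1 rk1) (le_lt_trans d2 rk1).
rewrite ler_pdivrMr// => /le_trans; apply.
have lk : lam ^+ k.+1 <= (r / kap) `^ e.
  apply: (@le_trans _ _ ((sg `^ e) ^+ k.+1)); first by apply: lerXn2r; rewrite ?nnegrE ?powR_ge0// ltW.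
  rewrite -powR_expr ?(ltW sg0)//; apply: ge0_ler_powR; rewrite ?nnegrE.
  - exact: ltW.
  - by rewrite exprn_ge0// ltW.
  - by apply: divr_ge0; exact: ltW.
  - by rewrite ler_pdivlMr.
rewrite powRM ?invr_ge0 ?(ltW r0) ?(ltW kap0)// in lk.
rewrite -powR_inv1 ?(ltW kap0)// -powRrM mulN1r powRN in lk.
rewrite (_ : lam ^+ k * _ = lam ^+ k.+1 * ((2 * U + 1) / lam)); last first.
  by rewrite exprSr; field; rewrite gt_eqF.
rewrite (_ : (2 * U + 1) / lam / _ * _ = r `^ e / kap `^ e * ((2 * U + 1) / lam)); last by ring.
by rewrite ler_wpM2r// divr_ge0 ?ltW.
Qed.

Lemma v_continuous z : Q z -> s < z.1 < T ->
  (forall x, enorm (x - z.2) <= d -> Omega x) -> {for z, continuous v}.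
Proof.
move=> Qz zT BO; have M0 : 0 < 2 * U + 1 by move: U0; lra.
apply/cvgrPdist_lt => e e0.
have [k lk] := geometric_below lam0 lam1 (divr_gt0 e0 M0).
set r := sg ^+ k * kap; have r0 : 0 < r by rewrite mulr_gt0 ?exprn_gt0.
have /andP[z1 z2] := zT.
have : nbhs z (cyl (Num.max s (z.1 - r)) (Num.min T (z.1 + r)) z.2 r).
  apply: open_nbhs_nbhs; split; first exact: open_cyl.
  split; last by rewrite subrr enorm0.
  by rewrite gt_max lt_min z1 z2 ltrBlDr ltrDl r0.
apply: filterS => y [/andP[]]; rewrite gt_max lt_min => /andP[y1 y2] /andP[y3 y4] y5.
have yT : s < y.1 < T by rewrite y1.
have d1 : `|z.1 - y.1| < r by rewrite ltr_norml; apply/andP; split; move: y2 y4; lra.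
rewrite enormC in y5.
apply: le_lt_trans (pair_oscillation zT yT BO d1 y5) _.
by rewrite -ltr_pdivlMr.
Qed.

(** Upper bound: u <= c + lam^k M, with c <= v on a small cylinder. Lower bound: near [z] the
    envelope forces u > v(z) - e/3 almost everywhere, and v is continuous. *)
Lemma locally_close z e : Q z -> s < z.1 < T ->
  (forall x, enorm (x - z.2) <= d -> Omega x) -> 0 < e ->
  exists2 W, nbhs z W & {ae mu, forall y, W y -> `|u y - v y| <= e}.
Proof.
have arith (a b c t : R) : `|a - b| < t / 3 -> a - t / 3 < c -> b - t <= c.
  by rewrite ltr_norml => /andP[h1 h2] h3; lra.
have arith2 (a b c t : R) : b - t <= a -> a <= c + t -> c <= b -> `|a - b| <= t.
  by move=> h1 h2 h3; rewrite ler_norml; apply/andP; split; lra.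
move=> Qz zT BO e0; have M0 : 0 < 2 * U + 1 by move: U0; lra.
have e3 : 0 < e / 3 by exact: divr_gt0.
have [k lk] := geometric_below lam0 lam1 (divr_gt0 e0 M0).
have Mk : lam ^+ k * (2 * U + 1) <= e by rewrite -ler_pdivlMr// ltW.
set r := sg ^+ k * kap; have r0 : 0 < r by rewrite mulr_gt0 ?exprn_gt0.
have [wz _] := lsc_envelope_bound Qz.
have [ts [zts _ tsT zr _]] : exists ts, [/\ z.1 < ts, z.1 < ts, ts < T, ts - r < z.1 & ts - r < z.1].
  by apply: later_time => //; [rewrite subrr normr0|have /andP[] := zT|have /andP[] := zT].
have sts : s <= ts by have /andP[h _] := zT; apply: ltW; exact: lt_trans h zts.
have [c [oc1 oc2]] := osc k sts tsT BO.
have /cvgrPdist_lt/(_ _ e3) near_v := v_continuous Qz zT BO.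
have [W zW uW] : exists2 W, nbhs z W & {ae mu, forall y, W y -> v z - e / 3 < u y}.
  apply: lsc_envelope_gt; rewrite -[ltRHS](fineK wz) lte_fin ltrBlDr ltrDl//.
have zc : nbhs z (cyl (ts - r) ts z.2 r).
  apply: open_nbhs_nbhs; split; first exact: open_cyl.
  by split; [rewrite zr|rewrite subrr enorm0].
have zQ : nbhs z Q by exact: open_nbhs_nbhs.
exists (W `&` cyl (ts - r) ts z.2 r `&` Q `&` [set y | `|v z - v y| < e / 3]).
  by do 3 apply: filterI => //.
apply: filterS2 uW oc2 => y uy1 uy2 [[[/uy1 h1 yc] Qy] yv].
have h2 := uy2 yc; have := oc1 y yc; have [wy _] := lsc_envelope_bound Qy.
rewrite -(fineK wy) lee_fin => h3; apply: (arith2 _ _ c) => //.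
- exact: arith yv h1.
- by apply: le_trans h2 _; rewrite lerD2l.
Qed.

End regularity.

(** * Distance to the complement, and conclusion *)

Section distance_to_complement.
Context (R : realType) (n : nat).
Implicit Types (K Omega : set 'rV[R]_n).

Lemma ball_enorm (x y : 'rV[R]_n) (e : R) : enorm (x - y) < e -> ball x e y.
Proof.
move=> xy; split; first exact: le_lt_trans (enorm_ge0 _) xy.
move=> i j; rewrite (ord1 i); apply: le_lt_trans xy.
by have := coord_le_enorm (x - y) j; rewrite !mxE.
Qed.

Lemma open_enorm_ball Omega x : open Omega -> Omega x ->
  exists2 d : R, 0 < d & forall y, enorm (y - x) <= d -> Omega y.
Proof.
move=> oO Ox; have /nbhs_ballP[e /= e0 eO] : nbhs x Omega by exact: open_nbhs_nbhs.
exists (e / 2); first exact: divr_gt0.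
move=> y yx; apply/eO/ball_enorm; rewrite enormC; apply: le_lt_trans yx _.
by rewrite ltr_pdivrMr// ltr_pMr// ltr1n.
Qed.

(** Compactness gives one radius that is good for all points of [K]. *)
Lemma set_dist_gt0 K Omega : compact K -> open Omega -> K `<=` Omega ->
  (0 < set_dist K (~` Omega))%E.
Proof.
move=> cK oO KO; have cov := (compact_near_coveringP K).1 cK.
have : \forall e \near (0 : R)^'+, K `<=` (fun x => forall y, enorm (x - y) < e -> Omega y).
  apply: cov => x Kx.
  have /nbhs_ballP[r /= r0 rO] : nbhs x Omega by apply: open_nbhs_nbhs; split => //; exact: KO.
  have r2 : 0 < r / 2 by exact: divr_gt0.
  near=> x' e => /= y x'y; apply: rO; rewrite [r]splitr.
  have x'r : ball x (r / 2) x' by near: x'; exact: nbhsx_ballx.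
  have er : e <= r / 2 by near: e; exact: nbhs_right_le.
  by apply: ball_triangle x'r _; apply/ball_enorm/(lt_le_trans x'y).
move=> Hn; near (0 : R)^'+ => e.
have e0 : 0 < e by near: e; exact: nbhs_right_gt.
apply: (@lt_le_trans _ _ e%:E); first by rewrite lte_fin.
apply: le_ereal_inf_tmp => _ [x Kx [y Oy <-]]; rewrite lee_fin leNgt; apply/negP => xy.
apply: Oy; move: x Kx y xy; near: e; exact: Hn.
Unshelve. all: by end_near. Qed.

(** Half the distance, so that closed balls of this radius stay inside; the value 1 covers an
    infinite distance, when [K] or the complement is empty. *)
Definition inner_radius (D : \bar R) : R := if D is r%:E then r / 2 else 1.

Lemma inner_radius_gt0 D : (0 < D)%E -> 0 < inner_radius D.
Proof. by case: D => [r| |]//=; rewrite lte_fin => r0; exact: divr_gt0. Qed.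

Lemma inner_radiusP K Omega x y : (0 < set_dist K (~` Omega))%E -> K x ->
  enorm (y - x) <= inner_radius (set_dist K (~` Omega)) -> Omega y.
Proof.
move=> D0 Kx xy; apply: contrapT => Oy.
have : (set_dist K (~` Omega) <= (enorm (x - y))%:E)%E.
  by apply: ereal_inf_lbound; exists x => //; exists y.
move: D0 xy; case: (set_dist _ _) => [r| |]//=; rewrite lte_fin enormC lee_fin => r0 h1 h2.
have := le_trans h2 h1; rewrite leNgt ltr_pdivrMr// ltr_pMr ?ltr1n//.
Qed.

End distance_to_complement.

Section conclusion.
Context (R : realType) (n : nat).
Local Notation E := (R * 'rV[R]_n)%type.
Local Notation mu := (lebesgue_st R n).

Lemma ae_eq_of_close (Q : set E) (u v : E -> R) :
  (forall e, 0 < e -> {ae mu, forall z, Q z -> `|u z - v z| <= e}) ->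
  {ae mu, forall z, Q z -> u z = v z}.
Proof.
move=> H; have : {ae mu, forall z, forall k : nat, Q z -> `|u z - v z| <= k.+1%:R^-1}.
  by apply/ae_foralln => k; apply: H; rewrite invr_gt0.
apply: filterS => z hz Qz; apply/eqP; rewrite -subr_eq0 -normr_le0; apply/ler_addgt0Pr => e e0.
rewrite add0r; apply: le_trans (hz (truncn e^-1) Qz) _.
rewrite invf_ple ?posrE//; apply: ltW; exact: truncnS_gt.
Qed.

Lemma holder_norm_le (gamma : R) (D : set E) (v : E -> R) (a b : R) :
  (forall z, D z -> `|v z| <= a) ->
  (forall z y, D z -> D y -> `|v z - v y| / st_dist z y `^ gamma <= b) ->
  (holder_norm gamma D v <= (a + b)%:E)%E.
Proof.
move=> va vb; rewrite EFinD; apply: leeD.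
  by apply: ge_ereal_sup => _ [z Dz <-]; rewrite lee_fin; exact: va.
by apply: ge_ereal_sup => _ [z Dz [y Dy <-]]; rewrite lee_fin; exact: vb.
Qed.

End conclusion.
Theorem theorem1 (R : realType) (n : nat) (Lambda Lambda0 p m : R) :
  (0 < n)%N -> 0 < Lambda -> 0 <= Lambda0 -> 2 < p ->
  1 + (maxn n 2)%:R / p < m ->
  exists2 gamma : R, 0 < gamma < 1 &
  exists C : R -> R -> \bar R -> R,
  forall (T s : R) (Omega K : set 'rV[R]_n)
         (f : R * 'rV[R]_n -> R) (A : R * 'rV[R]_n -> 'M[R]_n)
         (u : R * 'rV[R]_n -> R) (G : R * 'rV[R]_n -> 'rV[R]_n),
    let D : set (R * 'rV[R]_n) := `[0, T] `*` Omega in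
    let Q : set (R * 'rV[R]_n) := `]0, T[ `*` Omega in
    open Omega -> 0 < T ->
    in_L m%:E D f -> (LnormOn m%:E D f <= Lambda%:E)%E ->
    (forall i j, measurable_fun D (fun z => A z i j)) ->
    (LnormOn +oo D (fun z => opnorm (A z)) <= Lambda%:E)%E ->
    compact K -> K `<=` Omega -> 0 < s < T ->
    in_L +oo Q u ->
    weak_gradient Q u G -> in_L_rV p%:E Q G ->
    distributional_subsolution Q Lambda^-1 p A f u G ->
    viscosity_supersolution Q
      (fun xi X => Lambda * enorm xi `^ p - Lambda0 * mminus X)
      (- Lambda) (lsc_envelope u) ->
    exists v : R * 'rV[R]_n -> R,
      [/\ {ae lebesgue_st R n, forall z, Q z -> u z = v z},
          (forall z, Q z -> {for z, continuous v}) &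
          (holder_norm gamma (`]s, T[ `*` K) v <=
           (C (fine (LnormOn +oo Q u)) s (set_dist K (~` Omega)))%:E)%E].
Proof.
move=> n0 L0 L00 p2 mp; have p0 : 0 < p by apply: lt_trans p2.
have m0 : 0 < m by apply: lt_trans (exponent_gt1 p2 mp).
have [lam [sg [[lam0 lam1 sg0 sg1 sglam] osc]]] := uniform_oscillation n0 L0 L00 p2 mp.
have [e0 e1 _] := holder_exponentP lam0 lam1 sg0 sg1 sglam.
exists (holder_exponent lam sg); first by rewrite e0.
(* The initial size becomes a function of (U, s, d) alone, so that the final constant can be named
   before the domain and the solution. *)
have /choice[kap kapP] : forall x : R * R * R, exists kap : R,
    0 <= x.1.1 -> 0 < x.1.2 -> 0 < x.2 -> 0 < kap /\
    forall T Omega f A u G, subsolution Lambda p m x.1.1 T Omega f A u G ->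
    viscosity_supersolution (`]0, T[ `*` Omega)
    (fun xi X => Lambda * enorm xi `^ p - Lambda0 * mminus X) (- Lambda) (lsc_envelope u) ->
    forall (ts : R) (xs : 'rV[R]_n) k, x.1.2 <= ts -> ts < T ->
    (forall y, enorm (y - xs) <= x.2 -> Omega y) ->
    exists c, oscillates u (lsc_envelope u)
      (cyl (ts - sg ^+ k * kap) ts xs (sg ^+ k * kap)) c (lam ^+ k * (2 * x.1.1 + 1)).
  move=> [[U s] d] /=.
  have [[[U0 s0] d0]|npos] := pselect ((0 <= U /\ 0 < s) /\ 0 < d).
    by have [kap kap0 h] := osc U s d U0 s0 d0; exists kap.
  by exists 0 => U0 s0 d0; case: npos.
exists (fun U s D => U + (2 * U + 1) / lam / kap (U, s, inner_radius D) `^ holder_exponent lam sg).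
move=> T s Omega K f A u G D Q oO T0 inf fL mA AL cK KO /andP[s0 sT] inu wg inG sub visc.
have S := subsolution_intro L0 p0 m0 oO inf fL mA AL inu wg inG sub.
set U := fine (LnormOn +oo Q u) in S *.
have U0 : 0 <= U by apply: fine_ge0; exact: LnormOn_pinfty_ge0.
have uU := sub_u_bound S; have oQ : open Q := open_cylinder S.
(* Continuity and equality almost everywhere are claimed on all of [Q], so the decay is used near
   each point with a starting time and a radius adapted to it, not with those of [K] and s. *)
have local_osc z : Q z -> exists s' d' kap', [/\ 0 < kap', s' < z.1 < T,
    forall x, enorm (x - z.2) <= d' -> Omega x &
    forall (ts : R) (xs : 'rV[R]_n) k, s' <= ts -> ts < T ->
    (forall y, enorm (y - xs) <= d' -> Omega y) ->
    exists c, oscillates u (lsc_envelope u)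
      (cyl (ts - sg ^+ k * kap') ts xs (sg ^+ k * kap')) c (lam ^+ k * (2 * U + 1))].
  move=> [/=]; rewrite in_itv/= => /andP[z0 zT] /(open_enorm_ball oO)[d' d'0 dO].
  have z20 : 0 < z.1 / 2 by exact: divr_gt0.
  have [k0 hk] := kapP (U, z.1 / 2, d') U0 z20 d'0.
  exists (z.1 / 2), d', (kap (U, z.1 / 2, d')); split => //.
    by rewrite zT andbT ltr_pdivrMr// ltr_pMr// ltr1n.
  exact: hk S visc.
exists (fun z => fine (lsc_envelope u z)); split.
- apply: ae_eq_of_close => e e0'; apply: ae_local => z Qz.
  have [s' [d' [kap' [k0 zT dO hk]]]] := local_osc z Qz.
  exact: (locally_close lam0 lam1 sg0 U0 k0 uU oQ hk Qz zT dO e0').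
- move=> z Qz; have [s' [d' [kap' [k0 zT dO hk]]]] := local_osc z Qz.
  exact: (v_continuous lam0 lam1 sg0 U0 k0 hk Qz zT dO).
have dist0 : (0 < set_dist K (~` Omega))%E by exact: set_dist_gt0.
have d0 := inner_radius_gt0 dist0.
have [k0 hk] := kapP (U, s, inner_radius (set_dist K (~` Omega))) U0 s0 d0.
have inQ z : (`]s, T[ `*` K) z -> s < z.1 < T /\ Q z.
  move=> [/=]; rewrite in_itv/= => /andP[z1 z2] z3; split; first by rewrite z1.
  by split => /=; [rewrite in_itv/= z2 (lt_trans s0 z1)|exact: KO].
apply: holder_norm_le => [z /inQ[_ Qz]|z y zK yK].
  by have [] := lsc_envelope_bound uU oQ Qz.
have [zT Qz] := inQ z zK; have [yT Qy] := inQ y yK.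
apply: (pair_holder lam0 lam1 sg0 sg1 sglam U0 k0 uU oQ (hk _ _ _ _ _ _ S visc) zT yT Qz Qy).
by move=> x; apply: inner_radiusP dist0 _; case: zK.
Qed.
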